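(* Let $(W,S)$ be a Coxeter system with $S$ finite, and let $T\subset S$ be such that $W_{S-T}$ is finite, $m_{st}\in\{2,4,\infty\}$ for all $s\in S-T$ and $t\in T$, and $m_{tt'}\in\{1,2,\infty\}$ for all $t,t'\in T$. Let $\overline{W_T}$ be the normal closure of $W_T$ in $W$, which is a right-angled Coxeter group with generating set $S_T=\{wtw^{-1}:t\in T,\ w\in W_{S-T}\}$. Let $\varphi$ be a function from $T$ to a set $I$ of indeterminates, extended to $S_T$ by $\varphi(wtw^{-1})=\varphi(t)$ for $t\in T$, $w\in W_{S-T}$. Then the f-polynomial of the nerve $N_{\overline{W_T}}$ of $(\overline{W_T},S_T)$ is $$f_{N_{\overline{W_T}},\varphi}=\sum_{\Sigma}\,[W_{S-T}\colon W_{\Sigma_0}]\prod_{t\in T}\frac{\varphi(t)^{k(t)}}{k(t)!},$$ where the sum runs over all admissible subsets $\Sigma\subset S$, and $k(t)$ and $\Sigma_0$ are associated with $\Sigma$ as defined in the context.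
   Context: A Coxeter system $(W,S)$ is a group $W$ with a generating set $S$ and presentation $W=\langle S\mid (st)^{m_{st}}=1 \text{ for all } s,t\in S\rangle$, where $m_{ss}=1$ and $m_{st}=m_{ts}\in\{2,3,\dots,\infty\}$ for $s\ne t$ ($m_{st}=\infty$ means no relation). For $U\subset S$, $W_U$ is the subgroup generated by $U$, and $U^\perp=\{s\in S: m_{su}=2\text{ for all }u\in U\}$. $(W,S)$ is right-angled if all $m_{st}\in\{1,2,\infty\}$. The Dynkin diagram of $W_U$ has vertex set $U$, with $s\neq t$ joined by an edge iff $m_{st}\ne 2$. Type $B_k$: generators $s_1,\dots,s_k$ with $m_{s_1s_2}=4$, $m_{s_is_{i+1}}=3$ for $2\le i\le k-1$, and all other pairs commuting ($B_1$ is a single generator $s_1$). The distinguished generator is $s_1$. Admissible subsets: $\Sigma\subset S$ is admissible if $W_\Sigma$ is finite and, writing $T'=T\cap\Sigma$ and letting $\Sigma_t$ (for $t\in T'$) be the vertex set of the connected component containing $t$ of the Dynkin diagram of $W_\Sigma$, the following hold: $\Sigma=\bigcup_{t\in T'}\Sigma_t$; each $\Sigma_t$ is of type $B_{k(t)}$ for some $k(t)\geq 1$; and $t$ is the unique element of $\Sigma_t\cap T$ and it is the distinguished generator $s_1$ of $\Sigma_t$. (The empty set is admissible.) For $t\in T-T'$ put $\Sigma_t=\emptyset$, $k(t)=0$. Put $\Sigma_0=\left(\bigcup_{t\in T}\Sigma_t\right)^\perp-T$, with $\emptyset^\perp=S$. The nerve $N_{V}$ of a Coxeter system $(V,R)$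 is the simplicial complex of all subsets $U\subset R$ (including $\emptyset$) such that the subgroup $V_U$ is finite. For a simplicial complex $X$ and a function $\varphi$ from its vertex set to $I$, the f-polynomial is $f_{X,\varphi}=\sum_{\sigma\in X}\prod_{s\in\sigma}\varphi(s)$. *)

(* Defs.v *)
From HB Require Import structures.
From mathcomp Require Import all_boot all_order all_algebra.
From mathcomp Require Import finmap.
From mathcomp Require Import boolp classical_sets functions cardinality.
From mathcomp Require Import monalg.

Set Implicit Arguments.
Unset Strict Implicit.
Unset Printing Implicit Defensive.

Import GRing.Theory.

Local Open Scope ring_scope.

Section Groups.
Variable W : groupType.
Implicit Types (A H K V : set W).

Definition is_subgroup H : Prop :=
  [/\ H 1%g, (forall x y, H x -> H y -> H (x * y)%g)
    & (forall x, H x -> H x^-1%g)].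

Definition is_normal_subgroup H : Prop :=
  is_subgroup H /\ (forall g x, H x -> H (g * x * g^-1)%g).

Definition generated A : set W := smallest is_subgroup A.

Definition normal_closure A : set W := smallest is_normal_subgroup A.

(* The number of left cosets xK with x in H; the value is 0 if there are
   infinitely many of them. *)
Definition subgroup_index H K : nat :=
  #|` fset_set [set [set (x * k)%g | k in K] | x in H]%classic |.

End Groups.

(* In a Coxeter matrix m, Some n stands for the integer n and None for
   infinity. *)
Section Coxeter.
Variable (W : groupType) (S : {fset W}).
Implicit Types (m : S -> S -> option nat) (U T Sigma : {set S}) (s t : S).

Definition is_coxeter_matrix m : Prop :=
  [/\ forall s, m s s = Some 1%N,
      forall s t, m s t = m t s
    & forall s t, s != t -> forall n, m s t = Some n -> (2 <= n)%N].

Definition coxeter_relations (G : groupType) m (f : S -> G) : Prop :=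
  forall s t n, m s t = Some n -> ((f s * f t) ^+ n)%g = 1%g.

(* (V, S) is a Coxeter system with Coxeter matrix m, where V is a subgroup of
   W: S generates V, the relations hold in V, and they are defining relations,
   i.e. every map from S to a group that respects them extends to a
   homomorphism on V (which is unique because S generates V; the values of h
   outside V are irrelevant). *)
Definition coxeter_system (V : set W) m : Prop :=
  [/\ is_coxeter_matrix m,
      V = generated [set` S]%classic,
      coxeter_relations m (fun s => val s)
    & forall (G : groupType) (f : S -> G), coxeter_relations m f ->
        exists h : W -> G,
          (forall x y, V x -> V y -> h (x * y)%g = (h x * h y)%g) /\
          (forall s, h (val s) = f s)].

Definition right_angled m : Prop :=
  forall s t, m s t \in [:: Some 1%N; Some 2%N; None].

(* The subgroup W_U. *)
Definition parabolic U : set W :=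
  generated [set val s | s in [set` U]]%classic.

Definition perp m U : {set S} := [set s | [forall u in U, m s u == Some 2%N]].

(* The nerve of (<S>, S). *)
Definition nerve : {set {set S}} :=
  [set U : {set S} | `[< finite_set (parabolic U) >]].

Definition dynkin_edge m U : rel S :=
  fun s t => [&& s \in U, t \in U, s != t & m s t != Some 2%N].

(* The set Sigma_t; it is empty for t outside Sigma. *)
Definition dynkin_component m Sigma t : {set S} :=
  if t \in Sigma then [set s | connect (dynkin_edge m Sigma) t s] else finset.set0.

(* U is of type B_k, where k = #|U| >= 1, with distinguished generator t: the
   sequence r lists s_1 = t, s_2, ..., s_k, so that s_i is nth t r i.-1. *)
Definition type_B m U t : Prop :=
  exists r : seq S,
    [/\ uniq r, r =i U, ohead r = Some t
      & forall i j, (i < j < size r)%N ->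
          m (nth t r i) (nth t r j) =
          Some (if j == i.+1 then if i == 0%N then 4%N else 3%N else 2%N)].

Definition admissible m T Sigma : Prop :=
  [/\ finite_set (parabolic Sigma),
      Sigma = \bigcup_(t in T :&: Sigma) dynkin_component m Sigma t
    & forall t, t \in T :&: Sigma ->
        type_B m (dynkin_component m Sigma t) t /\
        dynkin_component m Sigma t :&: T = [set t]].

(* k(t) *)
Definition type_rank m Sigma t : nat := #|dynkin_component m Sigma t|.

Definition Sigma0 m T Sigma : {set S} :=
  perp m (\bigcup_(t in T) dynkin_component m Sigma t) :\: T.

(* S_T; fset_set sends an infinite set to fset0, but this set is finite as soon
   as W_{S-T} is. *)
Definition conjugate_generators T : {fset W} :=
  fset_set [set x | exists t w, [/\ t \in T, parabolic (~: T) w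
                                  & x = (w * val t * w^-1)%g]]%classic.

Definition is_extension (I : Type) T (phi : {t | t \in T} -> I)
    (psi : conjugate_generators T -> I) : Prop :=
  forall (x : conjugate_generators T) (t : {t | t \in T}) (w : W),
    parabolic (~: T) w -> val x = (w * val (val t) * w^-1)%g -> psi x = phi t.

End Coxeter.

(* Rational polynomials in the indeterminates i : I. *)
Definition indet (I : choiceType) (i : I) : {malg rat[{cmonom I}]} :=
  << ucm i >>.

Definition f_polynomial (V : finType) (I : choiceType) (X : {set {set V}})
    (phi : V -> I) : {malg rat[{cmonom I}]} :=
  \sum_(sigma in X) \prod_(s in sigma) indet (phi s).

(* Main.v *)
Require Import Defs.
From HB Require Import structures.
From mathcomp Require Import all_boot all_order all_algebra.
From mathcomp Require Import finmap.
From mathcomp Require Import boolp classical_sets functions cardinality.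
From mathcomp Require Import monalg.
From mathcomp Require Import all_field.
From mathcomp Require Import zify ring.

Set Implicit Arguments.
Unset Strict Implicit.
Unset Printing Implicit Defensive.

Import GRing.Theory Num.Theory.

(** Write G for W_{S-T} and N for the normal closure of W_T.

    The main tool is an action of W on W x Y, in which s outside T sends (g, y) to
    (g s, y) and t in T sends (g, y) to (g, F_t(g) y). It exists as soon as the
    permutations F_t(g) of Y are involutions that agree or commute where the relations of
    W ask for it ([twisted_action]). Three choices of F are used.
    - For Y a group H and F_t(g) the multiplication by f(g t g^-1), it extends a map f
      from S_T to H to a homomorphism on N, as soon as f respects the commutations that
      hold in S_T: hence N is a right-angled Coxeter group ([conjugate_coxeter]).
    - For F_t the indicator of a coset, it shows that the centralizer of t in G is the
      parabolic subgroup of t^perp - T ([conjugate_eq]).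
    - For two reflections of the line, it shows that two elements of S_T whose product has
      finite order commute, and describes their relative position
      ([finite_order_classification]). So the nerve consists of the commuting subsets of
      S_T ([nerveP]).

    For the count, an admissible set is listed as a word, a chain, which runs through its
    components B_k, each from its distinguished generator on. A component t, s_2, ..., s_k
    yields the commuting reflections t, s_2 t s_2, s_3 s_2 t s_2 s_3, ... in the
    coordinate vectors e_1, ..., e_k of the root system, and a chain thus yields an ordered
    clique of S_T. Every ordered clique whose elements are sorted by type is conjugate
    under G to the clique of exactly one chain ([clique_chain], [chain_clique_unique]), and
    the pointwise stabilizer of that clique is W_{Sigma_0} ([chain_stabilizer]). So Sigma
    accounts for [G : W_{Sigma_0}] ordered cliques. Each simplex with k(t) vertices of type
    t has prod_t k(t)! sorted orderings, and the formula follows by counting the sorted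
    ordered cliques in two ways ([sum_ordered_cliques], [sum_admissible]).

    The conjugacy statement is proved by adding one vertex x at a time to the clique of a
    chain ([extend_clique]). When the chain ends in a generator y outside T, conjugation by
    y exchanges the last two vertices and fixes the others, so that x and y x y both
    extend the clique of the shorter chain; induction puts both in standard form, and the
    two forms are compared by means of lengths and double cosets in the Coxeter group W
    ([coset_min_lmul], [double_coset_sandwich]).

    This needs the elementary theory of Coxeter groups: the exchange condition, which comes
    from the action of W on signed reflections ([inversion_parity], [exchange]), shortest
    coset representatives, and the fact that s u = u s and s u s = u s u hold only if the
    entry m of the Coxeter matrix is 2 or 3, which is read off from a linear representation
    ([braid_orders]). *)

(** * A linear representation by reflections *)

Section ReflectionRepresentation.
Variables (F : fieldType) (S : finType) (B : S -> S -> F).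
Local Open Scope ring_scope.
Implicit Types (s t : S) (v : S -> F).

Definition pairing s v : F := \sum_t B s t * v t.

Definition reflection s v : S -> F := fun r => v r - pairing s v * (r == s)%:R.

Lemma reflectionE s v r : reflection s v r = v r - pairing s v * (r == s)%:R.
Proof. by []. Qed.

Lemma pairing_reflection s t v :
  pairing s (reflection t v) = pairing s v - B s t * pairing t v.
Proof.
rewrite /pairing /reflection.
under eq_bigr => r _ do rewrite mulrBr.
rewrite sumrB; congr (_ - _); rewrite (bigD1 t) //= eqxx mulr1 big1 ?addr0 // => r /negPf ->.
by rewrite mulr0 mulr0.
Qed.

(** The terms are combinations of z^k and z^-k, and z is an n-th root of unity other than
    1 and -1, so each geometric sum vanishes. *)
Lemma recurrence_sum0 (q : nat -> F) (z : F) n : z != 0 -> z ^+ n = 1 -> z ^+ 2 != 1 ->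
    (forall k, q k.+2 = (z + z^-1) * q k.+1 - q k) -> \sum_(0 <= k < n) q k = 0.
Proof.
move=> z0 zn z2 qE.
have geo (x : F) : x ^+ n = 1 -> x != 1 -> \sum_(0 <= k < n) x ^+ k = 0.
  move=> xn x1; apply: (mulfI (x := x - 1)); first by rewrite subr_eq0.
  by rewrite mulr0 big_mkord -subrX1 xn subrr.
have zV1 : z^-1 != 1 by rewrite invr_eq1; apply: contraNneq z2 => ->; rewrite expr1n.
have z1 : z != 1 by rewrite -invr_eq1.
have rE (x : F) : x != 0 -> x + x^-1 = z + z^-1 ->
    forall k, q k.+1 - x^-1 * q k = x ^+ k * (q 1%N - x^-1 * q 0%N).
  move=> x0 xz; elim=> [|k IHk]; first by rewrite expr0 mul1r.
  by rewrite exprS -mulrA -IHk qE -xz; field.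
have E k : (z - z^-1) * q k = z ^+ k * (q 1%N - z^-1 * q 0%N) - z^-1 ^+ k * (q 1%N - z * q 0%N).
  have := rE z^-1; rewrite invr_eq0 invrK addrC => /(_ z0 erefl k) <-.
  by rewrite -(rE z z0 erefl k); ring.
have zz : z - z^-1 != 0.
  rewrite subr_eq0; apply: contraNneq z2 => e; rewrite expr2 {1}e mulVf //.
apply: (mulfI zz); rewrite mulr0 mulr_sumr.
under eq_bigr => k _ do rewrite E.
rewrite sumrB -!mulr_suml !geo ?mul0r ?subrr //.
by rewrite exprVn zn invr1.
Qed.

Hypothesis Bss : forall s, B s s = 2%:R.

Lemma reflectionK s v : reflection s (reflection s v) = v.
Proof.
apply: funext => r; rewrite {1}/reflection pairing_reflection Bss /reflection.
by ring.
Qed.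

(** The pairings of the iterates of v with the two roots obey the recurrence of
    [recurrence_sum0], with z + z^-1 the trace of the product of the two reflections. The
    displacement of v after n steps is a combination of the two sums of these pairings. *)
Lemma reflection_order s t (n : nat) v : B s t = B t s ->
    (n = 2%N /\ B s t = 0) \/ (exists z : F, [/\ z != 0, z ^+ n = 1, z ^+ 2 != 1
       & B s t ^+ 2 = z + z^-1 + 2%:R]) ->
  iter n (reflection s \o reflection t) v = v.
Proof.
move=> Bst nz; set a := B s t in nz.
pose vk k := iter k (reflection s \o reflection t) v.
pose p k := pairing s (vk k); pose q k := pairing t (vk k).
have pS k : p k.+1 = a * q k - p k.
  by rewrite /p /vk iterS /= !pairing_reflection Bss -/(vk k) -/(p k) -/(q k) -/a; ring.
have qS k : q k.+1 = (a ^+ 2 - 1) * q k - a * p k.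
  rewrite /q /vk iterS /= !pairing_reflection Bss -Bst -/(vk k) -/(p k) -/(q k) -/a.
  by ring.
have vkE k r : vk k r = v r - (\sum_(0 <= i < k) q i) * (r == t)%:R
    - (\sum_(0 <= i < k) (p i - a * q i)) * (r == s)%:R.
  elim: k => [|k IHk]; first by rewrite !big_geq // !mul0r !subr0.
  rewrite !big_nat_recr //= /reflection pairing_reflection -/(vk k) IHk.
  by rewrite -/(p k) -/(q k) -/a; ring.
apply: funext => r; rewrite -/(vk n) vkE.
suff [sq sp] : \sum_(0 <= i < n) q i = 0 /\ \sum_(0 <= i < n) p i = 0.
  by rewrite sumrB -mulr_sumr sq sp; ring.
case: nz => [[-> a0]|[z [z0 zn z2 az]]].
  rewrite !big_nat_recr //= !big_geq // qS pS a0; split; ring.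
split; apply: (recurrence_sum0 z0 zn z2) => k.
  rewrite !(qS, pS); have -> : z + z^-1 = a ^+ 2 - 2%:R by rewrite az; ring.
  by ring.
rewrite !(qS, pS); have -> : z + z^-1 = a ^+ 2 - 2%:R by rewrite az; ring.
by ring.
Qed.

Definition simple_root s : S -> F := fun r => (r == s)%:R.

Lemma pairing_simple s t : pairing s (simple_root t) = B s t.
Proof.
rewrite /pairing (bigD1 t) //= /simple_root eqxx mulr1 big1 ?addr0 // => r /negPf ->.
by rewrite mulr0.
Qed.

Lemma reflection_commute s t : s != t -> B s t = B t s -> 2%:R != 0 :> F ->
    reflection s (reflection t (simple_root s)) = reflection t (reflection s (simple_root s)) ->
  B s t = 0.
Proof.
move=> /negPf st Bst F2 /(congr1 (fun f => f t)).
rewrite /= !(reflectionE, pairing_reflection, pairing_simple) /simple_root eq_sym st eqxx Bss -Bst => e.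
move/eqP: e; rewrite -subr_eq0 => /eqP e; apply: (mulfI F2).
by rewrite mulr0; apply: oppr_inj; rewrite oppr0 -[RHS]e /=; ring.
Qed.

Lemma reflection_braid s t : s != t -> B s t = B t s -> 2%:R != 0 :> F ->
    reflection s (reflection t (reflection s (simple_root s))) =
    reflection t (reflection s (reflection t (simple_root s))) ->
  B s t ^+ 2 = 1.
Proof.
move=> /negPf st Bst F2 /(congr1 (fun f => f s)).
rewrite /= !(reflectionE, pairing_reflection, pairing_simple) /simple_root st eqxx Bss -Bst => e.
apply: (mulfI F2); move/eqP: e; rewrite -subr_eq0 => /eqP e.
by apply/eqP; rewrite -subr_eq0 -oppr_eq0; apply/eqP; rewrite -[RHS]e /=; ring.
Qed.

End ReflectionRepresentation.

Section Cosine.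
Local Open Scope ring_scope.

(** An entry c = B(s, t) for which the product of the reflections in s and t has order
    dividing m(s, t) if this is finite, and which still tells apart the cases m = 2, m = 3 and m > 3. *)
Definition is_cosine (o : option nat) (c : algC) : Prop :=
  [/\ forall n, o = Some n -> (n = 2%N /\ c = 0) \/ (exists z : algC,
        [/\ z != 0, z ^+ n = 1, z ^+ 2 != 1 & c ^+ 2 = z + z^-1 + 2%:R]),
      c = 0 -> o = Some 2%N
    & c ^+ 2 = 1 -> o = Some 3%N].

(** For m finite the number is e + e^-1 with e a primitive 2m-th root of unity, a
    conjugate of 2 cos (pi / m); its square is z + z^-1 + 2 with z = e^2. It vanishes iff
    z = -1, and its square is 1 iff z is a primitive cube root of unity. *)
Lemma cosine_exists (o : option nat) : (forall n, o = Some n -> (1 < n)%N) ->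
  exists c, is_cosine o c.
Proof.
case: o => [n /(_ n erefl) n1|_]; last first.
  exists 2%:R; split=> // /eqP; first by rewrite pnatr_eq0.
  by rewrite -natrX (eqr_nat _ _ 1).
have n0 : (0 < n)%N by apply: ltnW.
have [e ep] : {e : algC | (2 * n)%N.-primitive_root e}.
  by apply: C_prim_root_exists; rewrite muln_gt0.
have e0 : e != 0.
  apply/eqP => e0; have /eqP := prim_expr_order ep.
  by rewrite e0 expr0n muln_eq0 /= eqn0Ngt n0 /= eq_sym oner_eq0.
have zp : n.-primitive_root (e ^+ 2).
  have := exp_prim_root ep 2; rewrite (gcdn_idPl _) ?dvdn_mulr //.
  by rewrite mulKn.
have z0 : e ^+ 2 != 0 by rewrite expf_neq0.
exists (e + e^-1).
have c2 : (e + e^-1) ^+ 2 = e ^+ 2 + (e ^+ 2)^-1 + 2%:R.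
  by field.
have zn := prim_expr_order zp.
have zk k : (e ^+ 2 ^+ k == 1) = (n %| k)%N by rewrite -(prim_order_dvd zp).
split.
- move=> _ [<-]; have [n2|n2] := eqVneq n 2%N.
    left; split=> //; apply: (mulfI e0); rewrite mulr0 mulrDr mulfV // -expr2.
    have /eqP := zn; rewrite n2 -[X in _ == X](expr1n _ 2) eqf_sqr -[_ == 1]/(e ^+ 2 ^+ 1 == 1) zk.
    by rewrite n2 /= => /eqP ->; rewrite addNr.
  right; exists (e ^+ 2); split; rewrite ?zk //.
  by apply/negP => /(@dvdn_leq n 2 isT); rewrite leqNgt ltn_neqAle eq_sym n2 n1.
- move=> ce; congr Some.
  have : e ^+ 2 ^+ 2 == 1.
    have := congr1 (fun c => c * e) ce; rewrite mul0r mulrDl mulVf // -expr2 => /eqP.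
    by rewrite addr_eq0 => /eqP ->; rewrite sqrrN expr1n.
  rewrite zk => /(@dvdn_leq n 2 isT) n2; by apply/eqP; rewrite eqn_leq n2 n1.
- rewrite c2 => ce; congr Some.
  have : e ^+ 2 ^+ 3 == 1.
    rewrite -subr_eq0; apply/eqP.
    have -> : e ^+ 2 ^+ 3 - 1 = (e ^+ 2 - 1) * (e ^+ 2) * ((e ^+ 2 + (e ^+ 2)^-1 + 2%:R) - 1) by field.
    by rewrite ce subrr mulr0.
  rewrite zk => n3; move: n3 n1; have : prime 3 by [].
  by move=> /primeP[_ /(_ n)] h /h /orP[/eqP ->|/eqP].
Qed.
End Cosine.

(** The universal property of a Coxeter group is stated for groups; the group of
    permutations of an arbitrary type turns it into a construction of actions. *)
(** * Permutations of a type, and subgroups *)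

Record permutation (Y : Type) : Type := Permutation {
  perm_fun : Y -> Y;
  perm_inv : Y -> Y;
  perm_funK : cancel perm_fun perm_inv;
  perm_invK : cancel perm_inv perm_fun }.

Section PermutationGroup.
Variable Y : Type.
Implicit Types p q r : permutation Y.

HB.instance Definition _ := gen_eqMixin (permutation Y).
HB.instance Definition _ := gen_choiceMixin (permutation Y).

Lemma permutation_ext p q : perm_fun p =1 perm_fun q -> p = q.
Proof.
case: p q => [f f' fK f'K] [g g' gK g'K] /= /funext fg.
rewrite fg in fK f'K *.
have fg' : f' = g' by apply: funext => y; rewrite -{1}(g'K y) fK.
rewrite fg' in fK f'K *.
by rewrite (Prop_irrelevance fK gK) (Prop_irrelevance f'K g'K).
Qed.

Definition perm_one := @Permutation Y id id (fun=> erefl) (fun=> erefl).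

Definition perm_mul p q : permutation Y :=
  Permutation (can_comp (perm_funK p) (perm_funK q))
              (can_comp (perm_invK q) (perm_invK p)).

Definition perm_opp p := Permutation (perm_invK p) (perm_funK p).

Lemma perm_mulA : associative perm_mul.
Proof. by move=> p q r; apply: permutation_ext. Qed.

Lemma perm_mul1 : left_id perm_one perm_mul.
Proof. by move=> p; apply: permutation_ext. Qed.

Lemma perm_mulr1 : right_id perm_one perm_mul.
Proof. by move=> p; apply: permutation_ext. Qed.

Lemma perm_mulV : left_inverse perm_one perm_opp perm_mul.
Proof. by move=> p; apply: permutation_ext => y /=; rewrite perm_funK. Qed.

Lemma perm_mulrV : right_inverse perm_one perm_opp perm_mul.
Proof. by move=> p; apply: permutation_ext => y /=; rewrite perm_invK. Qed.

HB.instance Definition _ := isGroup.Build (permutation Y)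
  perm_mulA perm_mul1 perm_mulr1 perm_mulV perm_mulrV.

Lemma perm_funM p q y : perm_fun (p * q)%g y = perm_fun p (perm_fun q y).
Proof. by []. Qed.

Lemma perm_funX p n y : perm_fun (p ^+ n)%g y = iter n (perm_fun p) y.
Proof. by elim: n => [|n IHn] //; rewrite expgS perm_funM IHn. Qed.

End PermutationGroup.

Lemma cat_cons_split (A : Type) (a b c1 c2 : seq A) (u : A) : a ++ b = c1 ++ u :: c2 ->
  (exists c, a = c1 ++ u :: c /\ c2 = c ++ b) \/ (exists c, b = c ++ u :: c2 /\ c1 = a ++ c).
Proof.
elim: a c1 => [|v a IHa] [|w c1] /=.
- by move=> ->; right; exists [::].
- by move=> ->; right; exists (w :: c1).
- by case=> -> <-; left; exists a.
- by case=> -> /IHa[[c [-> ->]]|[c [-> ->]]]; [left | right]; exists c.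
Qed.

Section Subgroups.
Local Open Scope group_scope.
Variable W : groupType.
Implicit Types (A B H : set W) (x y : W).

Lemma generated_subgroup A : is_subgroup (generated A).
Proof.
split; first by move=> M [[]].
- move=> x y Hx Hy M MA; have [[_ MM _] _] := MA.
  by apply: MM; [apply: Hx | apply: Hy].
- by move=> x Hx M MA; have [[_ _ MV] _] := MA; apply: MV; apply: Hx.
Qed.

Lemma generated_in A x : A x -> generated A x.
Proof. by move=> Ax M [_]; apply. Qed.

Lemma generated_min A H : is_subgroup H -> (A `<=` H)%classic -> (generated A `<=` H)%classic.
Proof. by move=> sH AH; apply: smallest_sub. Qed.

Lemma commute_subgroup x : is_subgroup (commute x).
Proof.
split; first exact: commute1.
- by move=> y z; apply: commuteM.
- by move=> y; apply: commuteV.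
Qed.

Lemma conjg_subgroup H g : is_subgroup H -> is_subgroup [set x | H (g * x * g^-1)]%classic.
Proof.
move=> [H1 HM HV]; split=> /=; first by rewrite mulg1 mulgV.
- by move=> x y Hx Hy; have := HM _ _ Hx Hy; rewrite !mulgA mulgVK.
- by move=> x Hx; have := HV _ Hx; rewrite !invgM invgK mulgA.
Qed.

(** Adding a commuting involution x to F at most doubles it: F and x F. *)
Lemma commuting_generated_finite (c : seq W) :
    (forall x, x \in c -> x * x = 1) ->
    (forall x x' : W, x \in c -> x' \in c -> x * x' = x' * x) ->
  finite_set (generated [set` c]%classic).
Proof.
elim: c => [_ _|x c IHc cinv ccomm].
  apply: (@sub_finite_set _ _ [set 1]%classic); last exact: finite_set1.
  apply: generated_min => //; split=> //= [u v -> ->|u ->]; rewrite ?mulg1 ?invg1 //.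
have fc : finite_set (generated [set` c]%classic).
  apply: IHc => [u uc|u u' uc vc]; first by apply: cinv; rewrite inE uc orbT.
  by apply: ccomm; rewrite inE ?uc ?vc orbT.
set F := generated _ in fc.
have [F1 FM FV] := generated_subgroup [set` c]%classic.
have xF u : F u -> commute x u.
  apply: generated_min; first exact: commute_subgroup.
  by move=> v vc; apply: ccomm; rewrite ?mem_head // inE (vc : v \in c) orbT.
have xx : x * x = 1 by apply: cinv; apply: mem_head.
apply: (@sub_finite_set _ _ (F `|` [set x * u | u in F])%classic); last first.
  by rewrite finite_setU; split=> //; apply: finite_image.
apply: generated_min; last first.
  move=> u /=; rewrite inE => /orP[/eqP ->|uc]; last by left; apply: generated_in.
  by right; exists 1; rewrite ?mulg1.
split; first by left.
  move=> u u2 [Fu|[u' Fu <-]] [Fv|[v' Fv <-]].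
  - by left; apply: FM.
  - by right; exists (u * v'); [apply: FM | rewrite !mulgA (xF _ Fu)].
  - by right; exists (u' * u2); [apply: FM | rewrite mulgA].
  - left; rewrite (xF _ Fu) -mulgA (mulgA x) xx mul1g; exact: FM.
move=> u [Fu|[u' Fu <-]]; first by left; apply: FV.
right; exists u'^-1; first exact: FV.
have xV : x^-1 = x by apply: mulg1_eq.
by rewrite invgM xV (commuteV (xF _ Fu)).
Qed.

Lemma conj_eq g r x : (g * r * g^-1 == x) = (r == g^-1 * x * g).
Proof. by apply/eqP/eqP => [<-|->]; rewrite !mulgA ?mulVg ?mulgV ?mul1g ?mulgVK ?mulgK. Qed.

Lemma commute_conj h x y : commute x y -> commute (h * x * h^-1) (h * y * h^-1).
Proof. by rewrite /commute !mulgA !mulgVK -!(mulgA h) => ->. Qed.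

Lemma finite_subgroup_torsion (H : set W) z : is_subgroup H -> finite_set H -> H z ->
  exists2 n, (0 < n)%N & z ^+ n = 1.
Proof.
move=> [H1 HM HV] fH Hz.
have Hzn n : H (z ^+ n) by elim: n => [|n IHn]; rewrite ?expgS //; apply: HM.
set F := fset_set H; pose s := [seq z ^+ i | i <- iota 0 (size F).+1].
have : ~~ uniq s.
  apply/negP => us; have : (size s <= size F)%N.
    apply: uniq_leq_size us _ => x /mapP[i _ ->].
    by rewrite /F in_fset_set //; apply/mem_set.
  by rewrite size_map size_iota ltnn.
move=> /(uniqPn 1)[i [j [ij]]]; rewrite size_map size_iota => js.
rewrite !(nth_map 0%N) ?size_iota //; last exact: ltn_trans ij js.
rewrite !nth_iota //; last exact: ltn_trans ij js.
rewrite !add0n => e; exists (j - i)%N; first by rewrite subn_gt0.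
by rewrite expgnFr ?(ltnW ij) // -e mulgV.
Qed.

End Subgroups.

(** * Lengths and parabolic subgroups in a Coxeter group *)

Section CoxeterTheory.
Local Open Scope group_scope.
Variables (W : groupType) (S : {fset W}) (m : S -> S -> option nat).
Hypothesis hW : coxeter_system [set: W]%classic m.
Implicit Types (s t u v : S) (w x y z : W) (a b c : seq S) (J K : {set S}).

Lemma coxeter_mss s : m s s = Some 1%N.
Proof. by case: hW => -[]. Qed.

Lemma coxeter_sym s t : m s t = m t s.
Proof. by case: hW => -[]. Qed.

Lemma coxeter_neq s t : m s t = Some 2%N -> s != t.
Proof. by move=> mst; apply/eqP => st; move: mst; rewrite st coxeter_mss. Qed.

Lemma coxeter_rel s t n : m s t = Some n -> (val s * val t) ^+ n = 1.
Proof. by case: hW => _ _ rel _; apply: rel. Qed.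

Lemma coxeter_ss s : val s * val s = 1.
Proof. by have := coxeter_rel (coxeter_mss s). Qed.

Lemma coxeter_sV s : (val s)^-1 = val s.
Proof. exact: mulg1_eq (coxeter_ss s). Qed.

Lemma coxeter_sK s w : val s * (val s * w) = w.
Proof. by rewrite mulgA coxeter_ss mul1g. Qed.

Lemma coxeter_sKr s w : w * val s * val s = w.
Proof. by rewrite -mulgA coxeter_ss mulg1. Qed.

Lemma commute_of_m2 s t : m s t = Some 2%N -> val s * val t = val t * val s.
Proof.
move/coxeter_rel; rewrite expg2 => h.
by have := mulg1_eq h; rewrite invgM !coxeter_sV.
Qed.

(** To act on a type it suffices to give the generators and check the relations
    pointwise. *)
Lemma coxeter_action (Y : Type) (f : S -> Y -> Y) :
    (forall s t n, m s t = Some n -> forall y : Y, iter n (f s \o f t) y = y) ->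
  exists act : W -> Y -> Y,
    [/\ forall y : Y, act 1 y = y,
        forall w w' (y : Y), act (w * w') y = act w (act w' y)
      & forall s, act (val s) = f s].
Proof.
move=> frel.
have fK s : cancel (f s) (f s) by move=> y; have := frel _ _ _ (coxeter_mss s) y.
pose F s := Permutation (fK s) (fK s).
have [s t n mst|h [hM hs]] := (let: And4 _ _ _ p := hW in p) _ F.
  by apply: permutation_ext => y; rewrite perm_funX -[RHS](frel _ _ _ mst).
exists (fun w => perm_fun (h w)); split.
- have h1 : h 1 = 1.
    by apply: (mulgI (h 1)); rewrite -hM // !mulg1.
  by move=> y; rewrite h1.
- by move=> w w' y; rewrite hM.
- by move=> s; rewrite hs.
Qed.

Fixpoint wprod a : W := if a is s :: a' then val s * wprod a' else 1.

Lemma wprod_cat a b : wprod (a ++ b) = wprod a * wprod b.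
Proof. by elim: a => [|s a IHa] /=; rewrite ?mul1g // IHa mulgA. Qed.

Lemma wprod_rcons a s : wprod (rcons a s) = wprod a * val s.
Proof. by rewrite -cats1 wprod_cat /= mulg1. Qed.

Lemma wprod_rev a : wprod (rev a) = (wprod a)^-1.
Proof.
by elim: a => [|s a IHa]; rewrite ?invg1 // rev_cons wprod_rcons IHa /= invgM coxeter_sV.
Qed.

Lemma parabolicP J w : parabolic J w <-> exists2 a, all [in J] a & wprod a = w.
Proof.
split=> [|[a Ja <-]].
  apply: (@generated_min _ _ [set w | exists2 a, all [in J] a & wprod a = w]%classic).
  - split=> /=; first by exists [::].
    + by move=> x y [a Ja <-] [b Jb <-]; exists (a ++ b); rewrite ?all_cat ?Ja // wprod_cat.
    + by move=> x [a Ja <-]; exists (rev a); rewrite ?all_rev // wprod_rev.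
  - by move=> _ [s /= Js <-]; exists [:: s]; rewrite /= ?Js // mulg1.
have [P1 PM _] := generated_subgroup [set val s | s in [set` J]]%classic.
elim: a Ja => [_|s a IHa /= /andP[Js Ja]]; first exact: P1.
by apply: PM; [apply: generated_in; exists s | apply: IHa].
Qed.

Lemma parabolic1 J : parabolic J 1.
Proof. by have [P1 _ _] := generated_subgroup [set val s | s in [set` J]]%classic. Qed.

Lemma parabolicM J x y : parabolic J x -> parabolic J y -> parabolic J (x * y).
Proof. by have [_ PM _] := generated_subgroup [set val s | s in [set` J]]%classic; apply: PM. Qed.

Lemma parabolicV J x : parabolic J x -> parabolic J x^-1.
Proof. by have [_ _ PV] := generated_subgroup [set val s | s in [set` J]]%classic; apply: PV. Qed.

Lemma parabolic_gen J s : s \in J -> parabolic J (val s).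
Proof. by move=> Js; apply: generated_in; exists s. Qed.

Lemma parabolicS J K w : J \subset K -> parabolic J w -> parabolic K w.
Proof.
move=> /fintype.subsetP JK; apply: generated_min; first exact: generated_subgroup.
by move=> _ [s /= /JK Ks <-]; apply: parabolic_gen.
Qed.

Lemma wprod_onto w : exists a, wprod a = w.
Proof.
case: hW => _ VS _ _.
have : generated [set` S]%classic w by rewrite -VS.
move=> gw; have : parabolic [set: S] w.
  move: gw; apply: generated_min; first exact: generated_subgroup.
  by move=> x /= Sx; apply: generated_in; exists [` Sx]%fset; rewrite /= ?finset.in_setT.
by move=> /parabolicP[a _ <-]; exists a.
Qed.

(** W acts on pairs of an element r and a sign: s conjugates r, and changes the sign iff
    r = s. The sign change eta w r under w is the parity of the number of times that r
    occurs in the inversion sequence of any word for w, which is therefore independent of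
    the word. *)
Lemma inversion_parity : exists eta : W -> W -> bool,
  [/\ forall r, eta 1 r = false,
      forall w r s, eta (val s * w) r = eta w r (+) (w * r * w^-1 == val s)
    & forall w s, eta (w * val s) (val s) = ~~ eta w (val s)].
Proof.
pose f s (y : W * bool) := (val s * y.1 * val s, y.2 (+) (y.1 == val s)).
have fneg s r e : f s (r, ~~ e) = ((f s (r, e)).1, ~~ (f s (r, e)).2).
  by rewrite /f /= addNb.
have frel s t n : m s t = Some n -> forall yb : W * bool, iter n (f s \o f t) yb = yb.
  move=> mst [r e].
  pose p := val s * val t.
  have pV : p^-1 = val t * val s by rewrite invgM !coxeter_sV.
  have tp k : val t * p ^+ k = p ^- k * val t.
    elim: k => [|k IHk]; first by rewrite expg0 invg1 mulg1 mul1g.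
    by rewrite [in RHS]expgSr invgM pV expgS -!mulgA -IHk.
  have rho k x : (p ^+ k * r * p ^- k == x * val t) = (r == p ^- k * x * p ^- k * val t).
    by rewrite conj_eq -!mulgA tp.
  have rho0 k : (p ^+ k * r * p ^- k == val t) = (r == p ^- (2 * k) * val t).
    by rewrite -{1}[val t]mul1g rho mulg1 mul2n -addnn expgnDr invgM.
  have rho1 k : (val t * (p ^+ k * r * p ^- k) * val t == val s)
             = (r == p ^- (2 * k).+1 * val t).
    rewrite -{2}(coxeter_sV t) conj_eq coxeter_sV -pV rho.
    by rewrite mul2n -addnn -addnS expgnDr expgS !invgM -!mulgA.
  (* The k-th step crosses the reflections numbered 2k and 2k+1 of the dihedral group.
     They are n-periodic, so each one is met an even number of times in n steps. *)
  have iterE k : iter k (f s \o f t) (r, e) = (p ^+ k * r * p ^- k,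
      e (+) \big[addb/false]_(0 <= j < 2 * k) (r == p ^- j * val t)).
    elim: k => [|k IHk].
      by rewrite /= muln0 big_geq // mul1g invg1 mulg1 addbF.
    rewrite iterS IHk /= /f /=; congr pair.
      by rewrite expgS invgM pV /p -!mulgA.
    rewrite mulnS addnC !addnS addn0 !big_nat_recr //= -!addbA; congr addb.
    by rewrite rho0 rho1.
  rewrite iterE (coxeter_rel mst) invg1 mul1g mulg1; congr pair.
  rewrite mul2n -addnn (@big_cat_nat _ _ _ n) ?leq_addr //=.
  rewrite -{2}(add0n n) big_addn addnK.
  under [X in _ (+) (_ (+) X)]eq_bigr => j _ do
    rewrite addnC expgnDr (coxeter_rel mst) mul1g.
  by rewrite addbb addbF.
have [act [act1 actM acts]] := coxeter_action frel.
pose eta w r := (act w (r, false)).2.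
have act_eq w r e : act w (r, e) = (w * r * w^-1, eta w r (+) e).
  have [a <-] := wprod_onto w; rewrite /eta.
  elim: a e => [|s a IHa] e /=; first by rewrite !act1 mul1g invg1 mulg1.
  rewrite !actM !acts IHa /f /= [act _ (r, false)]IHa /= addbF.
  rewrite invgM coxeter_sV !mulgA; congr pair.
  by rewrite -!addbA [e (+) _]addbC.
exists eta; split.
- by move=> r; rewrite /eta act1.
- by move=> w r s; rewrite /eta actM acts act_eq /f /= addbF.
- move=> w s; rewrite /eta actM acts /f /= eqxx /= coxeter_ss mul1g.
  by rewrite act_eq addbT.
Qed.

Lemma length_exists w : exists n, `[< exists2 a, wprod a = w & size a = n >].
Proof. by have [a aw] := wprod_onto w; exists (size a); apply/asboolP; exists a. Qed.

Definition length w : nat := ex_minn (length_exists w).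

Lemma length_word w : exists2 a, wprod a = w & size a = length w.
Proof. by rewrite /length; case: ex_minnP => n /asboolP. Qed.

Lemma length_wprod a : (length (wprod a) <= size a)%N.
Proof. by rewrite /length; case: ex_minnP => n _; apply; apply/asboolP; exists a. Qed.

Lemma length1 : length 1 = 0%N.
Proof. by apply/eqP; rewrite -leqn0 (length_wprod [::]). Qed.

Lemma length_eq0 w : length w = 0%N -> w = 1.
Proof. by have [[|s a] <- //= <-] := length_word w. Qed.

Lemma lengthM x y : (length (x * y) <= length x + length y)%N.
Proof.
have [a <- <-] := length_word x; have [b <- <-] := length_word y.
by rewrite -wprod_cat -size_cat length_wprod.
Qed.

Lemma lengthV w : length w^-1 = length w.
Proof.
suff le x : (length x^-1 <= length x)%N by apply/eqP; rewrite eqn_leq le -{1}(invgK w) le.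
by have [a <- <-] := length_word x; rewrite -wprod_rev -size_rev length_wprod.
Qed.

(** If eta (wprod a) s holds, then s occurs in the inversion sequence of a, which is the
    conclusion. Otherwise eta (w s) s holds, and a letter can be deleted from a reduced
    word of w s to give a word of w, so w would be shorter than w s. *)
Lemma exchange a s : (length (wprod a * val s) <= length (wprod a))%N ->
  exists a1 u a2, a = a1 ++ u :: a2 /\ wprod a * val s = wprod (a1 ++ a2).
Proof.
have [eta [eta1 etaM etaS]] := inversion_parity.
have del b r : eta (wprod b) r ->
    exists b1 u b2, b = b1 ++ u :: b2 /\ wprod b * r = wprod (b1 ++ b2).
  elim: b => [|u b IHb] /=; first by rewrite eta1.
  rewrite etaM; have [/eqP eu _|_] := boolP (_ == val u).
    exists [::], u, b; split=> //=.
    by rewrite -mulgA -[_ * r](mulgVK (wprod b)) eu coxeter_sK.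
  rewrite addbF => /IHb[b1 [v [b2 [-> eb]]]].
  by exists (u :: b1), v, b2; split=> //=; rewrite -mulgA eb.
have [|/negPf neta le] := boolP (eta (wprod a) (val s)); first by move/del.
have [b eb sb] := length_word (wprod a * val s).
have : eta (wprod b) (val s) by rewrite eb etaS neta.
move=> /del[b1 [u [b2 [bE]]]]; rewrite eb coxeter_sKr => eb'.
have := leq_trans (eq_leq sb) le; rewrite eb' bE size_cat /= addnS -size_cat.
by move=> /(leq_trans) /(_ (length_wprod _)); rewrite ltnn.
Qed.

Lemma length_mul w s : length (w * val s) = (length w).+1 \/ length w = (length (w * val s)).+1.
Proof.
have le1 x : (length (x * val s) <= (length x).+1)%N.
  by rewrite -addn1 (leq_trans (lengthM _ _)) // leq_add2l -[val s]mulg1 (length_wprod [:: s]).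
have [le|gt] := leqP (length (w * val s)) (length w); last first.
  by left; apply/eqP; rewrite eqn_leq le1 gt.
right; apply/eqP; rewrite eqn_leq -{1}(coxeter_sKr s w) le1 /=.
have [a aw sa] := length_word w; rewrite -aw in le *.
have [a1 [u [a2 [aE ->]]]] := exchange le.
by rewrite aw -sa aE size_cat /= addnS ltnS -size_cat length_wprod.
Qed.

Lemma length_gen s : length (val s) = 1%N.
Proof.
by have := length_mul 1 s; rewrite mul1g length1 => -[].
Qed.

Lemma word_delete a : exists b, [/\ {subset b <= a}, wprod b = wprod a & size b = length (wprod a)].
Proof.
elim/last_ind: a => [|a s [b [ba eb sb]]]; first by exists [::]; rewrite length1.
rewrite wprod_rcons -eb.
have [up|down] := length_mul (wprod b) s.
  exists (rcons b s); rewrite wprod_rcons size_rcons up sb eb; split=> // u.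
  by rewrite !mem_rcons !inE => /orP[->//|/ba->]; rewrite orbT.
have [a1 [u [a2 [bE e]]]] := exchange (leq_trans (leqnSn _) (eq_leq (esym down))).
rewrite e.
exists (a1 ++ a2); split=> //.
  by move=> v va; rewrite mem_rcons inE ba ?orbT // bE mem_cat inE orbCA -mem_cat va orbT.
by apply/succn_inj; rewrite -e -down eb -sb bE !size_cat /= addnS.
Qed.

Lemma parabolic_word J w : parabolic J w ->
  exists a, [/\ all [in J] a, wprod a = w & size a = length w].
Proof.
move=> /parabolicP[a /allP Ja <-]; have [b [ba eb sb]] := word_delete a.
by exists b; split=> //; apply/allP => s /ba /Ja.
Qed.

Lemma parabolic_genE J s : parabolic J (val s) = (s \in J) :> Prop.
Proof.
apply: propext; split; last exact: parabolic_gen.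
move=> /parabolic_word[[|u [|v a]]]; rewrite length_gen => -[] //= /andP[Ju _].
by rewrite mulg1 => /val_inj <-.
Qed.

(** By exchange, the last letter of a is equal in W to an element of W_J, and a generator
    that lies in W_J is in J. *)
Lemma parabolic_reduced J a : parabolic J (wprod a) -> size a = length (wprod a) -> all [in J] a.
Proof.
elim/last_ind: a => // a s IHa; rewrite wprod_rcons size_rcons all_rcons => Jas sas.
have [b [Jb eb sb]] := parabolic_word Jas.
have le : (length (wprod a) <= size a)%N := length_wprod a.
have [a1 [u [a2 [bE e]]]] : exists b1 u b2, b = b1 ++ u :: b2 /\ wprod b * val s = wprod (b1 ++ b2).
  by apply: exchange; rewrite eb coxeter_sKr -sas (leq_trans le).
rewrite eb coxeter_sKr in e.
have Ja : parabolic J (wprod a).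
  apply/parabolicP; exists (a1 ++ a2) => //; move: Jb; rewrite bE !all_cat /=.
  by case/and3P => -> _.
have Js : parabolic J (val s) by have := parabolicM (parabolicV Ja) Jas; rewrite mulKg.
rewrite parabolic_genE in Js; rewrite Js IHa //.
apply/eqP; rewrite eqn_leq le andbT -ltnS sas.
by have [->|->] := length_mul (wprod a) s; rewrite // ltnW.
Qed.

(** This replaces arguments on the support of an element: concatenating reduced words of
    x and y gives a reduced word of x y, all of whose letters lie in J. *)
Lemma parabolic_factor J x y : parabolic J (x * y) ->
  length (x * y) = (length x + length y)%N -> parabolic J x /\ parabolic J y.
Proof.
have [a <- sa] := length_word x; have [b <- sb] := length_word y.
rewrite -wprod_cat -sa -sb -size_cat => Jab sab.
have := parabolic_reduced Jab (esym sab); rewrite all_cat => /andP[Ja Jb].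
by split; apply/parabolicP; [exists a | exists b].
Qed.

Lemma parabolic_wfactor J x a : parabolic J (x * wprod a) ->
  length (x * wprod a) = (length x + size a)%N -> parabolic J x /\ all [in J] a.
Proof.
move=> Jxa ell; have sa : size a = length (wprod a).
  by apply/eqP; rewrite eqn_leq length_wprod andbT -(leq_add2l (length x)) -ell lengthM.
have [] := parabolic_factor Jxa; first by rewrite -sa.
by move=> Jx Ja; split=> //; apply: parabolic_reduced.
Qed.

Lemma parabolicI J K w : parabolic J w -> parabolic K w -> parabolic (J :&: K) w.
Proof.
have [a <- sa] := length_word w => Jw Kw; apply/parabolicP; exists a => //.
have /allP Ja := parabolic_reduced Jw sa; have /allP Ka := parabolic_reduced Kw sa.
by apply/allP => s sa'; rewrite /= inE Ja ?Ka.
Qed.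

Lemma length_parabolic_mul J w s : parabolic J w -> s \notin J ->
  length (w * val s) = (length w).+1.
Proof.
move=> Jw Js; have [//|down] := length_mul w s.
have [||_] := @parabolic_factor J (w * val s) (val s); rewrite ?coxeter_sKr //.
  by rewrite length_gen addn1 -down.
by rewrite parabolic_genE (negPf Js).
Qed.

Lemma length_parabolic_lmul J w s : parabolic J w -> s \notin J ->
  length (val s * w) = (length w).+1.
Proof.
move=> /parabolicV Jw Js; have := length_parabolic_mul Jw Js.
by rewrite -[LHS]lengthV invgM invgK coxeter_sV lengthV.
Qed.

(** The shortest elements of the cosets w W_J, tested on generators only; see
    [coset_min_length]. *)
Definition coset_min J w := forall s, s \in J -> length (w * val s) = (length w).+1.

Lemma coset_min_split J w : exists x y,
  [/\ w = x * y, coset_min J x, parabolic J y & length w = (length x + length y)%N].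
Proof.
have [n] := ubnP (length w); elim: n => // n IHn in w *; rewrite ltnS => wn.
have [/existsP[s /andP[Js /eqP down]]|] :=
  boolP [exists s, (s \in J) && (length w == (length (w * val s)).+1)].
  have [|x [y [wE xJ Jy ell]]] := IHn (w * val s); first by rewrite -down.
  exists x, (y * val s); split=> //; first by rewrite mulgA -wE coxeter_sKr.
    by apply: parabolicM => //; apply: parabolic_gen.
  apply/eqP; rewrite eqn_leq; apply/andP; split.
    by rewrite -[w](coxeter_sKr s) wE -mulgA lengthM.
  by rewrite down ell -addnS leq_add2l -addn1 -(length_gen s) lengthM.
rewrite negb_exists => /forallP wJ; exists w, 1; split; rewrite ?mulg1 ?length1 ?addn0 //.
  move=> s Js; have [//|down] := length_mul w s.
  by have := wJ s; rewrite Js /= down eqxx.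
exact: parabolic1.
Qed.

Lemma parabolic_rdescent J w : parabolic J w -> w <> 1 ->
  exists s, [/\ s \in J, parabolic J (w * val s) & length w = (length (w * val s)).+1].
Proof.
move=> Jw; have [a [Ja aw sa]] := parabolic_word Jw.
case/lastP: a => [|a s] in Ja aw sa *; first by move/(_ (esym aw)).
move: Ja aw sa; rewrite all_rcons wprod_rcons size_rcons => /andP[Js Ja] aw sa _.
have aE : w * val s = wprod a by rewrite -aw coxeter_sKr.
exists s; split=> //; first by apply: parabolicM => //; apply: parabolic_gen.
have [up|//] := length_mul w s.
by move: (length_wprod a); rewrite -aE up -sa ltnNge leqnSn.
Qed.

(** The exchange condition for a product of two reduced words, which tells in which of
    the two factors a letter is deleted. *)
Lemma exchange_mul x y s : (length (x * y * val s) <= length (x * y))%N ->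
     (exists x', [/\ x * y * val s = x' * y, (length x' < length x)%N
                  & forall J, parabolic J x -> parabolic J x'])
  \/ (exists y', [/\ y * val s = y', (length y' < length y)%N
                  & forall J, parabolic J y -> parabolic J y']).
Proof.
have [a ax sa] := length_word x; have [b bx sb] := length_word y.
have reduced_del J c1 v c2 : size (c1 ++ v :: c2) = length (wprod (c1 ++ v :: c2)) ->
    parabolic J (wprod (c1 ++ v :: c2)) -> parabolic J (wprod (c1 ++ c2)).
  move=> sc Jc; have := parabolic_reduced Jc sc; rewrite all_cat /= => /and3P[J1 _ J2].
  by apply/parabolicP; exists (c1 ++ c2); rewrite // all_cat J1.
have short c1 v c2 : (length (wprod (c1 ++ c2)) < size (c1 ++ v :: c2))%N.
  by rewrite size_cat addnS ltnS -size_cat length_wprod.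
rewrite -{1 2}ax -{1 2}bx -wprod_cat => /exchange[c1 [u [c2 [abE e]]]].
case: (cat_cons_split abE) => -[c [cE c2E]]; [left | right].
  exists (wprod (c1 ++ c)); split.
  - by rewrite -ax -bx -wprod_cat e c2E !wprod_cat mulgA.
  - by rewrite -sa cE short.
  - by move=> J; rewrite -ax cE; apply: reduced_del; rewrite -cE ax.
exists (wprod (c ++ c2)); split.
- by apply: (mulgI (wprod a)); rewrite -wprod_cat catA -c2E -e wprod_cat bx mulgA.
- by rewrite -sb cE short.
- by move=> J; rewrite -bx cE; apply: reduced_del; rewrite -cE bx.
Qed.

(** For a representative x0 of globally minimal length this is an induction on y: if the
    last letter of y shortened the product, then by exchange a letter could be deleted from
    y, which is reduced, or from x0, which is minimal. Finally x = x0 z with lengths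
    adding up, and a last letter of z would shorten x. *)
Lemma coset_min_length J x y : coset_min J x -> parabolic J y ->
  length (x * y) = (length x + length y)%N.
Proof.
have global x0 : (forall z, parabolic J z -> length x0 <= length (x0 * z))%N ->
    forall z, parabolic J z -> length (x0 * z) = (length x0 + length z)%N.
  move=> x0min z; have [n] := ubnP (length z); elim: n => // n IHn in z *; rewrite ltnS => zn Jz.
  have [->|/eqP z1] := eqVneq z 1; first by rewrite mulg1 length1 addn0.
  have [s [Js Jzs ell]] := parabolic_rdescent Jz z1.
  have IH : length (x0 * (z * val s)) = (length x0 + length (z * val s))%N.
    by apply: IHn => //; rewrite -ell.
  have [up|down] := length_mul (x0 * (z * val s)) s.
    by rewrite -mulgA coxeter_sKr IH -addnS -ell in up.
  case: (@exchange_mul x0 (z * val s) s); first by rewrite [X in (_ <= X)%N]down.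
    move=> [x' [x'E lt _]]; have := x0min (z * (z * val s)^-1).
    rewrite -mulgA coxeter_sKr in x'E; rewrite mulgA x'E mulgK.
    by rewrite leqNgt lt => /(_ (parabolicM Jz (parabolicV Jzs))).
  by move=> [y' [<- lt _]]; rewrite coxeter_sKr ell ltnNge leqnSn in lt.
move=> xJ Jy.
have [x0 [z [xE Jz x0min]]] : exists x0 z, [/\ x = x0 * z, parabolic J z &
    forall z', parabolic J z' -> (length x0 <= length (x0 * z'))%N].
  have ex : exists n, `[< exists2 z, parabolic J z & length (x * z) = n >].
    by exists (length (x * 1)); apply/asboolP; exists 1 => //; apply: parabolic1.
  case: (ex_minnP ex) => n /asboolP[z Jz <-] zmin.
  exists (x * z), z^-1; split; [by rewrite mulgK | exact: parabolicV |].
  move=> z' Jz'; apply: zmin; apply/asboolP; exists (z * z'); last by rewrite mulgA.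
  exact: parabolicM.
suff z1 : z = 1 by rewrite xE z1 mulg1 (global x0).
apply: contrapT => /(parabolic_rdescent Jz)[s [Js Jzs ell]].
have := xJ _ Js; rewrite xE -mulgA !(global x0) // ell; move: (length x0) (length (z * val s)) => i j; clear; lia.
Qed.

Lemma coset_min_parabolic J x : coset_min J x -> parabolic J x -> x = 1.
Proof.
move=> xJ Jx; have := coset_min_length xJ (parabolicV Jx).
rewrite mulgV length1 => /esym/eqP; rewrite addn_eq0 => /andP[/eqP lx _].
exact: length_eq0.
Qed.

Lemma coset_min_unique J x y z : coset_min J x -> coset_min J y -> parabolic J z ->
  y = x * z -> y = x.
Proof.
move=> xJ yJ Jz yE; suff -> : y = x * 1 by rewrite mulg1.
rewrite yE; congr (_ * _); apply: length_eq0; apply/eqP.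
have := coset_min_length xJ Jz; rewrite -yE => ly.
have := coset_min_length yJ (parabolicV Jz); rewrite yE mulgK -yE ly => /eqP.
by rewrite -addnA -[X in X == _]addn0 eqn_add2l eq_sym addn_eq0 => /andP[].
Qed.

(** If v in J shortens s x, the deleted letter can only be s itself. *)
Lemma coset_min_lmul J x s : coset_min J x ->
  coset_min J (val s * x) \/ exists2 v, v \in J & val s * x = x * val v.
Proof.
move=> xJ; have [sJ|] := pselect (coset_min J (val s * x)); first by left.
move=> /existsNP[v /not_implyP[Jv nup]]; right; exists v => //.
have [//|down] := length_mul (val s * x) v.
case: (@exchange_mul (val s) x v); first by rewrite [X in (_ <= X)%N]down.
  move=> [x' [e lt _]]; move: lt; rewrite length_gen ltnS leqn0 => /eqP/length_eq0 x1.
  by move: e; rewrite x1 mul1g => e; rewrite -[in RHS]e coxeter_sKr.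
by move=> [x' [<- lt _]]; rewrite xJ // ltnNge leqnSn in lt.
Qed.

(** The relations give only that the order of s t divides m(s, t). That m is the true
    order, for m = 2 and 3, is seen in the representation by reflections with entries
    B(s, t) = 2 cos (k pi / m), where k is prime to m. *)
Lemma braid_orders s t : s != t ->
     (val s * val t = val t * val s -> m s t = Some 2%N)
  /\ (val s * val t * val s = val t * val s * val t -> m s t = Some 3%N).
Proof.
move=> st.
have cos_ex (o : option nat) : exists c : algC,
    (forall n, o = Some n -> (1 < n)%N) -> is_cosine o c.
  have [/cosine_exists[c oc]|no] := pselect (forall n, o = Some n -> (1 < n)%N).
    by exists c.
  by exists 0%R.
have [c cP] := boolp.choice cos_ex.
pose B u v := if u == v then 2%:R%R else c (m u v).
have Bss u : B u u = 2%:R%R by rewrite /B eqxx.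
have Bsym u v : B u v = B v u by rewrite /B eq_sym coxeter_sym.
have m_ge2 u v : u != v -> forall n, m u v = Some n -> (1 < n)%N.
  by case: hW => -[_ _ ge2 _ _ _] /ge2.
have frel u v n : m u v = Some n -> forall x : S -> algC,
    iter n (reflection B u \o reflection B v) x = x.
  have [->|uv] := eqVneq u v.
    by rewrite coxeter_mss => -[<-] x; rewrite /= reflectionK.
  move=> muv x; apply: (reflection_order Bss); first exact: Bsym.
  rewrite /B (negPf uv).
  by have [/(_ _ muv)] := cP _ (m_ge2 _ _ uv).
have [act [act1 actM acts]] := coxeter_action frel.
have two0 : (2%:R != 0 :> algC)%R by rewrite pnatr_eq0.
have [_ c2 c3] := cP _ (m_ge2 _ _ st).
have Bst : B s t = c (m s t) by rewrite /B (negPf st).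
split=> e; [apply: c2 | apply: c3]; rewrite -Bst.
- apply: (reflection_commute Bss st) => //.
  by rewrite -!acts -!actM e.
- apply: (reflection_braid Bss st) => //.
  by rewrite -!acts -!actM -!mulgA !mulgA e.
Qed.

Lemma m2_of_commute s t : s != t -> val s * val t = val t * val s -> m s t = Some 2%N.
Proof. by case/braid_orders. Qed.

Lemma m3_of_braid s t : s != t -> val s * val t * val s = val t * val s * val t ->
  m s t = Some 3%N.
Proof. by case/braid_orders. Qed.

(** One step down an alternating word: once s is removed, the next descent is u. *)
Lemma dihedral_next s u z : s != u -> parabolic [set s; u] z ->
    length z = (length (z * val s)).+1 -> z * val s <> 1 ->
  length (z * val s) = (length (z * val s * val u)).+1 /\ parabolic [set s; u] (z * val s).
Proof.
move=> su Jz dz z1.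
have Jzs : parabolic [set s; u] (z * val s).
  by apply: parabolicM => //; apply: parabolic_gen; rewrite !inE eqxx.
split=> //.
have [v [+ _ dv]] := parabolic_rdescent Jzs z1.
rewrite !inE => /orP[/eqP vs|/eqP <- //].
by move: dv; rewrite vs coxeter_sKr dz; move: (length _) => i; clear; lia.
Qed.

(** The factor of w in the parabolic subgroup of s and u has a reduced word that ends in
    s and one that ends in u. Both alternate, so up to length three they give a braid
    relation, and from length four on w ends in both words of length four. *)
Lemma two_descents w s u : s != u ->
    length w = (length (w * val s)).+1 -> length w = (length (w * val u)).+1 ->
  [\/ val s * val u = val u * val s,
      (val s * val u * val s = val u * val s * val u /\
        exists2 x, w = x * (val s * val u * val s) & length w = (length x + 3)%N)
    | (exists2 x, w = x * (val s * val u * val s * val u) & length w = (length x + 4)%N) /\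
      (exists2 x, w = x * (val u * val s * val u * val s) & length w = (length x + 4)%N)].
Proof.
move=> su ds du.
have [x [z [wE xJ Jz ell]]] := coset_min_split [set s; u] w.
have Js : parabolic [set s; u] (val s) by apply: parabolic_gen; rewrite !inE eqxx.
have Ju : parabolic [set s; u] (val u) by apply: parabolic_gen; rewrite !inE eqxx orbT.
have dz v : v \in [set s; u] -> length w = (length (w * val v)).+1 ->
    length z = (length (z * val v)).+1.
  move=> Jv; rewrite ell wE -mulgA (coset_min_length xJ) -?addnS; last first.
    by apply: parabolicM => //; apply: parabolic_gen.
  by move/addnI.
have {}ds := dz _ (set21 _ _) ds; have {}du := dz _ (set22 _ _) du.
have neq1 v v' : v != v' -> length z = (length (z * val v)).+1 ->
    length z = (length (z * val v')).+1 -> z * val v <> 1.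
  move=> /eqP vv' dv dv' zv1; apply: vv'; apply: val_inj; rewrite /=.
  have : z * val v' = 1 by apply: length_eq0; apply/succn_inj; rewrite -dv' dv zv1 length1.
  by move=> zv'1; apply: (mulgI z); rewrite zv1 zv'1.
have us : u != s by rewrite eq_sym.
have step v v' y : [set v; v'] = [set s; u] -> v != v' -> parabolic [set s; u] y ->
    length y = (length (y * val v)).+1 -> y * val v <> 1 ->
    length (y * val v) = (length (y * val v * val v')).+1 /\ parabolic [set s; u] (y * val v).
  by move=> <-; apply: dihedral_next.
have us2 : [set u; s] = [set s; u] by rewrite finset.setUC.
have [ds1 Js1] := step s u z erefl su Jz ds (neq1 _ _ su ds du).
have [du1 Ju1] := step u s z us2 us Jz du (neq1 _ _ us du ds).
have len2 : length (z * val s * val u) = length (z * val u * val s).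
  by apply/succn_inj/succn_inj; rewrite -ds1 -du1 -ds -du.
have [z2|/eqP z2] := eqVneq (z * val s * val u) 1.
  have y2 : z * val u * val s = 1 by apply: length_eq0; rewrite -len2 z2 length1.
  by constructor 1; apply: (mulgI z); rewrite !mulgA z2 y2.
have y2 : z * val u * val s <> 1.
  by move=> y2; apply: z2; apply: length_eq0; rewrite len2 y2 length1.
have [ds2 Js2] := step u s _ us2 us Js1 ds1 z2.
have [du2 Ju2] := step s u _ erefl su Ju1 du1 y2.
have len3 : length (z * val s * val u * val s) = length (z * val u * val s * val u).
  by apply: succn_inj; rewrite -ds2 -du2.
have [z3|/eqP z3] := eqVneq (z * val s * val u * val s) 1.
  have y3 : z * val u * val s * val u = 1 by apply: length_eq0; rewrite -len3 z3 length1.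
  constructor 2; split; first by apply: (mulgI z); rewrite !mulgA z3 y3.
  exists x; last by rewrite ell ds ds1 ds2 z3 length1.
  rewrite wE; congr (_ * _); apply: (mulIg (val s * val u * val s)).
  by rewrite !mulgA z3 !coxeter_sKr coxeter_ss.
have y3 : z * val u * val s * val u <> 1.
  by move=> y3; apply: z3; apply: length_eq0; rewrite len3 y3 length1.
have [ds3 Js3] := step s u _ erefl su Js2 ds2 z3.
have [du3 Ju3] := step u s _ us2 us Ju2 du2 y3.
have xK v v' : z = z * val v * val v' * val v * val v' * (val v' * val v * val v' * val v).
  by rewrite !mulgA !coxeter_sKr.
constructor 3; split.
  exists (x * (z * val u * val s * val u * val s)); first by rewrite -mulgA -xK.
  rewrite (coset_min_length xJ); last by apply: parabolicM.
  by rewrite ell -addnA du du1 du2 du3 !addnS addn0.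
exists (x * (z * val s * val u * val s * val u)); first by rewrite -mulgA -xK.
rewrite (coset_min_length xJ); last by apply: parabolicM.
by rewrite ell -addnA ds ds1 ds2 ds3 !addnS addn0.
Qed.

(** The element p s = s q has the two descents s and u, for u a last letter of q. If m(s, u)
    were at least 3, then p = (p s) s would have a reduced word containing s. So u commutes
    with s, and it is removed from both p and q. *)
Lemma parabolic_intertwine J s p q : parabolic J p -> parabolic J q -> s \notin J ->
  p * val s = val s * q -> q = p /\ parabolic (J :&: perp m [set s]) p.
Proof.

have [n] := ubnP (length p); elim: n => // n IHn in p q *; rewrite ltnS => pn Jp Jq sJ eqpq.
have [p1|/eqP p1] := eqVneq p 1.
  rewrite p1 in eqpq *; split; last exact: parabolic1.
  by apply: (mulgI (val s)); rewrite -eqpq mul1g mulg1.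
have lp := length_parabolic_mul Jp sJ; have lq := length_parabolic_lmul Jq sJ.
have q1 : q <> 1.
  move=> q1; apply: p1; apply: (mulIg (val s)); rewrite eqpq q1 mulg1 mul1g //.
have [u [Ju Jqu du]] := parabolic_rdescent Jq q1.
have us : u != s by apply: contraNneq sJ => <-.
have lqu := length_parabolic_lmul Jqu sJ.
have cases := @two_descents (p * val s) s u.
have {cases} [] := cases; first by rewrite eq_sym.
- by rewrite coxeter_sKr.
- by rewrite eqpq lq -mulgA lqu -du.
- move=> su.
  have mus : m u s = Some 2%N by apply: m2_of_commute.
  have e : p * val u * val s = val s * (q * val u) by rewrite -mulgA -su mulgA eqpq mulgA.
  have Jpu : parabolic J (p * val u) by apply: parabolicM => //; apply: parabolic_gen.
  have lpu : length p = (length (p * val u)).+1.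
    apply/succn_inj; rewrite -lp -(length_parabolic_mul Jpu sJ) e lqu eqpq lq -du.
    by [].
  have [//|qpu Jp'] := IHn _ _ _ Jpu Jqu sJ e; first by rewrite -lpu.
  split; first exact: mulIg qpu.
  rewrite -(coxeter_sKr u p); apply: parabolicM => //; apply: parabolic_gen.
  by rewrite inE Ju inE; apply/forall_inP => v /finset.set1P ->; rewrite mus.
- move=> [_ [x xE lx]]; case/negP: sJ; rewrite lp addnS in lx.
  have pE : p = x * wprod [:: s; u] by rewrite -(coxeter_sKr s p) xE /= mulg1 !mulgA coxeter_sKr.
  have [||_ /and3P[]//] := @parabolic_wfactor J x [:: s; u]; rewrite -pE //.
  exact: succn_inj lx.
- move=> [_ [x xE lx]]; case/negP: sJ; rewrite lp addnS in lx.
  have pE : p = x * wprod [:: u; s; u] by rewrite -(coxeter_sKr s p) xE /= mulg1 !mulgA coxeter_sKr.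
  have [||_ /and4P[]//] := @parabolic_wfactor J x [:: u; s; u]; rewrite -pE //.
  exact: succn_inj lx.
Qed.

Lemma coset_min_split_in J K h : parabolic K h -> exists h1 p,
  [/\ h = h1 * p, coset_min J h1, parabolic J p & parabolic K h1].
Proof.
move=> Kh; have [h1 [p [hE min1 Jp ell]]] := coset_min_split J h.
exists h1, p; split=> //; rewrite hE in Kh ell.
by have [] := parabolic_factor Kh ell.
Qed.

Lemma coset_min_in J K h p : coset_min J h -> parabolic J p -> parabolic K (h * p) ->
  parabolic K h.
Proof.
by move=> hmin Jp Khp; have [] := parabolic_factor Khp (coset_min_length hmin Jp).
Qed.

(** By exchange, letters are removed from x until x s is shortest in its coset; s is never
    removed, as it is not in J. *)
Lemma coset_min_snoc J x s : parabolic J x -> s \notin J -> exists y z,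
  [/\ x * val s = y * val s * z, coset_min J (y * val s), parabolic J y & parabolic J z].
Proof.
have [n] := ubnP (length x); elim: n => // n IHn in x *; rewrite ltnS => xn Jx sJ.
have [xmin|/existsNP[v /not_implyP[Jv nup]]] := pselect (coset_min J (x * val s)).
  by exists x, 1; rewrite mulg1; split=> //; apply: parabolic1.
have [//|down] := length_mul (x * val s) v.
case: (@exchange_mul x (val s) v); first by rewrite [X in (_ <= X)%N]down.
  move=> [x' [e lt Jx']]; have [|y [z [x'E ymin Jy Jz]]] := IHn x' _ (Jx' J Jx) sJ.
    exact: leq_trans lt xn.
  exists y, (z * val v); split=> //; last by apply: parabolicM => //; apply: parabolic_gen.
  by rewrite mulgA -x'E -e coxeter_sKr.
move=> [x' [e lt _]]; move: lt; rewrite length_gen ltnS leqn0 => /eqP/length_eq0 x1.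
have sv : val s = val v by rewrite -[val s](coxeter_sKr v) e x1 mul1g.
by case/negP: sJ; rewrite (val_inj sv).
Qed.

(** The only way in which s h s can stay in the double coset W_J s W_J, without
    cancellation, is the braid relation s v s = v s v; the outer factors of h commute with
    s. This is the step that finds the next node v of a component of type B_k, joined to s
    by a simple edge. *)
Lemma double_coset_sandwich J s h h' k : s \notin J -> parabolic J h -> parabolic J h' ->
    parabolic J k -> val s * h * val s = h' * val s * k ->
    length (val s * h * val s) = (length h).+2 ->
  exists x v z, [/\ v \in J, m s v = Some 3%N, h = x * val v * z,
    parabolic (J :&: perp m [set s]) x & parabolic (J :&: perp m [set s]) z].
Proof.
move=> sJ Jh Jh' Jk e ell.
set J' := J :&: perp m [set s].
have J'J x : parabolic J' x -> parabolic J x by apply: parabolicS; apply: subsetIl.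
have sNJ x : parabolic J x -> val s <> x.
  by move=> Jx sx; case/negP: sJ; rewrite -parabolic_genE sx.
have J's x : parabolic J' x -> x * val s = val s * x.
  move=> J'x; apply/commute_sym; apply: (generated_min (commute_subgroup (val s)) _ J'x).
  move=> _ [u /= + <-]; rewrite !inE => /andP[_ /forall_inP/(_ s)].
  by rewrite inE eqxx => /(_ isT)/eqP/commute_of_m2/commute_sym.
have [a [z [h'E amin J'z Ja]]] := coset_min_split_in J' Jh'.
have Jb : parabolic J (z * k) by apply: parabolicM => //; apply: J'J.
set b := z * k in Jb.
have {}e : val s * h * val s = a * val s * b.
  by rewrite e h'E -[a * z * _]mulgA (J's _ J'z) /b !mulgA.
clearbody b.
(* So s h s = a s b is a factorization in which the lengths add up. *)
have asmin : coset_min J (a * val s).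
  move=> v Jv; have [//|down] := length_mul (a * val s) v.
  case: (@exchange_mul a (val s) v); first by rewrite [X in (_ <= X)%N]down.
    move=> [x [e' lt /(_ _ Ja) Jx]].
    have e'' : (a^-1 * x) * val s = val s * val v by rewrite -mulgA -e' -mulgA mulKg.
    have Jax : parabolic J (a^-1 * x) by apply: parabolicM => //; apply: parabolicV.
    have [vE] := parabolic_intertwine Jax (parabolic_gen Jv) sJ e''.
    rewrite -vE parabolic_genE => J'v.
    by move: (amin v J'v) lt; rewrite vE mulVKg => ->; rewrite ltnNge leqnSn.
  move=> [x [e' lt _]]; move: lt; rewrite length_gen ltnS leqn0 => /eqP/length_eq0 x1.
  case: (sNJ (val v)); first exact: parabolic_gen.
  by rewrite -[val s](coxeter_sKr v) e' x1 mul1g.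
have la : length (a * val s) = (length a).+1 := length_parabolic_mul Ja sJ.
have lsa : length (val s * a) = (length a).+1 := length_parabolic_lmul Ja sJ.
have lb : (length h).+1 = (length a + length b)%N.
  by apply: succn_inj; rewrite -ell e (coset_min_length asmin Jb) la addSn.
(* If s a s is shortest in its coset, then comparing lengths gives s a = a s, hence a = 1
   and s h s = s b. Otherwise s a s = a s v has the descents s and v. *)
have [sasmin|[v Jv sasE]] := coset_min_lmul s asmin.
  have lsas : length (val s * a * val s) = length a.
    apply/eqP; rewrite -(eqn_add2r (length b)) -mulgA -(coset_min_length sasmin Jb) -lb.
    by rewrite -mulgA -e -mulgA coxeter_sK (length_parabolic_mul Jh sJ).
  case: (@exchange_mul (val s) a s); first by rewrite lsas lsa.
    move=> [x [e' lt _]]; move: lt; rewrite length_gen ltnS leqn0 => /eqP/length_eq0 x1.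
    rewrite x1 mul1g in e'.
    have sa : a * val s = val s * a by rewrite -{2}e' -!mulgA coxeter_sK.
    have [_ J'a] := parabolic_intertwine Ja Ja sJ sa.
    rewrite (coset_min_parabolic amin J'a) mul1g in e.
    have hs : h * val s = b by apply: (mulgI (val s)); rewrite mulgA.
    case: (sNJ (h^-1 * b)); first by apply: parabolicM => //; apply: parabolicV.
    by rewrite -hs mulKg.
  by move=> [x [<-]]; rewrite la ltnNge leqnSn.
set w := val s * (a * val s) in sasE.
have lw : length w = (length a).+2 by rewrite sasE asmin // la.
have sv : s != v by apply: contraNneq sJ => ->.
have ws : w * val s = val s * a by rewrite /w mulgA coxeter_sKr.
have wv : w * val v = a * val s by rewrite sasE coxeter_sKr.
have [||svC|[braid [x wE lx]]|[[x wE lx] _]] := @two_descents w s v sv.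
- by rewrite ws lsa.
- by rewrite wv la.
- case: (sNJ (a * val v * a^-1)).
    by do ?apply: parabolicM => //; [apply: parabolic_gen | apply: parabolicV].
  apply: (mulIg a); rewrite mulgVK; apply: (mulIg (val s)).
  by rewrite -[val s * a * _]mulgA -/w sasE -!mulgA svC.
- have aE : a = x * val v.
    by apply: (mulIg (val s)); rewrite -wv wE braid !mulgA coxeter_sKr.
  have lax : length a = (length x).+1 by apply/succn_inj/succn_inj; rewrite -lw lx !addnS addn0.
  have [Jx _] : parabolic J x /\ parabolic J (val v).
    by apply: parabolic_factor; rewrite -aE // lax length_gen addn1.
  have sx : x * val s = val s * x.
    apply: (mulIg (val v)); rewrite -[RHS]mulgA -aE -ws wE -!mulgA.
    by rewrite !mulgA coxeter_sKr.
  have [_ J'x] := parabolic_intertwine Jx Jx sJ sx.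
  exists x, v, (a^-1 * h); split=> //; first exact: m3_of_braid.
    by rewrite -aE mulVKg.
  have zs : (a^-1 * h) * val s = val s * (val v * b).
    have hs : h * val s = w * b.
      by apply: (mulgI (val s)); rewrite mulgA e /w !mulgA coxeter_ss mul1g.
    by rewrite -mulgA hs sasE -!mulgA mulKg.
  have Jz : parabolic J (a^-1 * h) by apply: parabolicM => //; apply: parabolicV.
  have Jvb : parabolic J (val v * b) by apply: parabolicM => //; apply: parabolic_gen.
  by have [] := parabolic_intertwine Jz Jvb sJ zs.
- have aE : a = x * wprod [:: s; v].
    by apply: (mulIg (val s)); rewrite -wv wE /= mulg1 !mulgA coxeter_sKr.
  have [||_ /= /and3P[Js _ _]] := @parabolic_wfactor J x [:: s; v]; rewrite -?aE //.
    by apply/succn_inj/succn_inj; rewrite -lw lx /= !addnS.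
  by rewrite Js in sJ.
Qed.

End CoxeterTheory.
Arguments parabolic1 {W S J}.

(** * The normal closure of W_T *)

Section TwistedAction.
Local Open Scope group_scope.
Variables (W : groupType) (S : {fset W}) (m : S -> S -> option nat).
Hypothesis hW : coxeter_system [set: W]%classic m.
Variable T : {set S}.
Hypothesis hST : forall s t : S, s \notin T -> t \in T ->
  m s t \in [:: Some 2%N; Some 4%N; None].
Hypothesis hTT : forall t t' : S, t \in T -> t' \in T ->
  m t t' \in [:: Some 1%N; Some 2%N; None].
Implicit Types (s t : S) (g h w x : W).

(** Each relation is checked pointwise. For m(s, t) = 4 with s outside T, the square of
    s t acts on the fibre over g by F_t(g s) F_t(g), which has order two because the
    factors commute. *)
Lemma twisted_action (Y : Type) (F : S -> W -> Y -> Y) :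
    (forall t g (y : Y), t \in T -> F t g (F t g y) = y) ->
    (forall t t' g (y : Y), t \in T -> t' \in T -> m t t' = Some 2%N ->
       F t g (F t' g y) = F t' g (F t g y)) ->
    (forall s t g (y : Y), s \notin T -> t \in T -> m s t = Some 2%N ->
       F t (g * val s) y = F t g y) ->
    (forall s t g (y : Y), s \notin T -> t \in T -> m s t = Some 4%N ->
       F t g (F t (g * val s) y) = F t (g * val s) (F t g y)) ->
  exists act : W -> W * Y -> W * Y,
    [/\ forall p : W * Y, act 1 p = p,
        forall w w' (p : W * Y), act (w * w') p = act w (act w' p),
        forall w g (y : Y), parabolic (~: T) w -> act w (g, y) = (g * w^-1, y)
      & forall t w g (y : Y), t \in T -> parabolic (~: T) w ->
          act (w * val t * w^-1) (g, y) = (g, F t (g * w) y)].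
Proof.
move=> Finv F2 Fs2 Fs4.
pose f s (p : W * Y) := if s \in T then (p.1, F s p.1 p.2) else (p.1 * val s, p.2).
have fS s g y : s \notin T -> f s (g, y) = (g * val s, y) by rewrite /f => /negPf ->.
have fT t g y : t \in T -> f t (g, y) = (g, F t g y) by rewrite /f => ->.
have frel s t n : m s t = Some n -> forall p : W * Y, iter n (f s \o f t) p = p.
  have mixed s' t' n' p : s' \notin T -> t' \in T -> m s' t' = Some n' ->
      iter n' (f s' \o f t') p = p /\ iter n' (f t' \o f s') p = p.
    move=> s'T t'T mst; have := hST s'T t'T; rewrite mst !inE orbF.
    have fs g y := fS s' g y s'T; have ft g y := fT t' g y t'T.
    case: p => g y; case/orP => /eqP[n'E]; rewrite n'E in mst *.
      rewrite /= !(ft, fs) !(coxeter_sKr hW).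
      by rewrite Fs2 // Finv // Fs2 // Finv.
    rewrite /= !(ft, fs) !(coxeter_sKr hW).
    have E := Fs4 _ _ g _ s'T t'T mst.
    by split; congr pair; rewrite !(E, Finv).
  move=> mst [g y].
  have [sT|sT] := boolP (s \in T); have [tT|tT] := boolP (t \in T).
  - have := hTT sT tT; rewrite mst !inE orbF => /orP[] /eqP[nE]; rewrite nE in mst *.
      have [<-|st] := eqVneq s t; first by rewrite /= !fT // Finv.
      by case: hW => -[_ _ /(_ _ _ st _ mst)].
    rewrite /= !fT //; congr pair.
    by rewrite (F2 _ _ _ _ tT sT) ?Finv // (coxeter_sym hW).
  - by rewrite (coxeter_sym hW) in mst; case: (mixed _ _ _ (g, y) tT sT mst).
  - by case: (mixed _ _ _ (g, y) sT tT mst).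
  - have E k : iter k (f s \o f t) (g, y) = (g * (val t * val s) ^+ k, y).
      elim: k => [|k IHk]; first by rewrite mulg1.
      by rewrite iterS IHk /= !fS // expgSr !mulgA.
    by rewrite E (coxeter_sym hW) in mst *; rewrite (coxeter_rel hW mst) mulg1.
have [act [act1 actM acts]] := coxeter_action hW frel.
have actG w g y : parabolic (~: T) w -> act w (g, y) = (g * w^-1, y).
  move=> /(parabolicP hW)[a Ta <-]; elim: a Ta => [|s a IHa] /=.
    by rewrite act1 invg1 mulg1.
  move=> /andP[+ /IHa aE]; rewrite !inE => sT.
  by rewrite actM aE acts fS // invgM (coxeter_sV hW) mulgA.
exists act; split=> // t w g y tT Gw.
rewrite !actM actG; last exact: parabolicV.
by rewrite invgK acts fT // actG // mulgK.
Qed.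

Definition stabilizer_of t : W -> Prop := parabolic (perp m [set t] :\: T).

Lemma mem_perp1 s t : (s \in perp m [set t]) = (m s t == Some 2%N).
Proof.
rewrite inE; apply/forall_inP/idP => [/(_ t)|mst u /finset.set1P -> //].
by apply; rewrite inE.
Qed.

Lemma parabolicMr (J : {set S}) w s : s \in J -> parabolic J (w * val s) = parabolic J w.
Proof.
move=> Js; apply: propext; have Ps := parabolic_gen Js.
by split=> [Jws|Jw]; [rewrite -(coxeter_sKr hW s w) | ]; apply: parabolicM.
Qed.

Lemma stabilizer_commute t g : stabilizer_of t g -> g * val t = val t * g.
Proof.
move=> Pg; apply: (@generated_min _ _ (fun x => commute x (val t)) _ _ g Pg).
  have [c1 cM cV] := commute_subgroup (val t).
  split; first exact: commute_sym.
    by move=> x y /commute_sym xt /commute_sym yt; apply/commute_sym/cM.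
  by move=> x /commute_sym xt; apply/commute_sym/cV.
move=> _ [s /= + <-]; rewrite inE mem_perp1 => /andP[_ /eqP]; exact: commute_of_m2.
Qed.

(** Let F_t translate by the indicator function of the parabolic subgroup of t^perp - T,
    and let the other generators in T act trivially. Comparing the two sides over the
    point g^-1 shows that t' = t and that g lies in the support of F_t. *)
Lemma conjugate_eq t t' g : t \in T -> t' \in T -> parabolic (~: T) g ->
  g * val t * g^-1 = val t' -> t = t' /\ stabilizer_of t g.
Proof.
move=> tT t'T Gg e.
pose F u h (b : bool) := b (+) ((u == t) && `[< stabilizer_of t h >]).
have [||||act [act1 actM actG actT]] := @twisted_action bool F.
- by move=> u h b _; rewrite /F -addbA addbb addbF.
- by move=> u v h b _ _ _; rewrite /F -!addbA; congr (_ (+) _); rewrite addbC.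
- move=> s u h b sT _ msu; rewrite /F; have [eut|//] := eqVneq u t.
  rewrite /stabilizer_of parabolicMr // inE mem_perp1 sT -eut msu eqxx //.
- by move=> s u h b _ _ _; rewrite /F -!addbA; congr (_ (+) _); rewrite addbC.
have := actT t' 1 g^-1 false t'T parabolic1.
have P1 : stabilizer_of t 1 by exact: parabolic1.
rewrite mul1g invg1 !mulg1 -e. rewrite actT //. rewrite mulVg /F eqxx (asboolT P1) /= => -[].
have [<- /= |] := eqVneq t' t; last by [].
by case: asboolP => // /parabolicV; rewrite invgK.
Qed.

Lemma conjugate_eq2 t t' g g' : t \in T -> t' \in T -> parabolic (~: T) g ->
    parabolic (~: T) g' -> g * val t * g^-1 = g' * val t' * g'^-1 ->
  t = t' /\ stabilizer_of t (g'^-1 * g).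
Proof.
move=> tT t'T Gg Gg' e; apply: conjugate_eq => //.
  by apply: parabolicM => //; apply: parabolicV.
by rewrite invgM invgK -!mulgA [g * (_ * _)]mulgA !mulgA -!(mulgA g'^-1) e !mulgA mulVg mul1g mulgVK.
Qed.

(** Otherwise the reflections y |-> - y on the coset of 1 for t' and y |-> 1 - y on the
    coset of g for t satisfy all the conditions of [twisted_action], and the product of
    g t g^-1 and t' acts over the point 1 as a translation of the integers. *)
Lemma finite_order_classification t t' g n : t \in T -> t' \in T -> parabolic (~: T) g ->
    g * val t * g^-1 <> val t' -> (0 < n)%N -> (g * val t * g^-1 * val t') ^+ n = 1 ->
    [/\ t != t', m t t' = Some 2%N
      & exists2 h, stabilizer_of t' h & stabilizer_of t (g^-1 * h)]
 \/ [/\ t = t' & exists s h, [/\ s \notin T, m s t = Some 4%N, stabilizer_of t h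
      & stabilizer_of t (g^-1 * (h * val s))]].
Proof.
move=> tT t'T Gg xt' n0 xn; apply: contrapT => /not_orP[no2 no4].
pose A u h := (u == t') && `[< stabilizer_of t' h >].
pose B u h := (u == t) && `[< stabilizer_of t (g^-1 * h) >].
(* The two reflections generate the infinite dihedral group. A pair of values of F that
   has to commute contains both of them only in the two excluded configurations. *)
pose F u h (y : int) : int := (if A u h then - y else if B u h then 1 - y else y)%R.
have FS (a a' b b' : bool) (y : int) : ~~ (a && b') -> ~~ (a' && b) ->
    ((if a then - (if a' then - y else if b' then 1 - y else y)
      else if b then 1 - (if a' then - y else if b' then 1 - y else y)
      else (if a' then - y else if b' then 1 - y else y)) =
    (if a' then - (if a then - y else if b then 1 - y else y)
      else if b' then 1 - (if a then - y else if b then 1 - y else y)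
      else (if a then - y else if b then 1 - y else y)))%R.
  by case: a a' b b' => [] [] [] [].
have stab_s u s h : s \notin T -> m s u = Some 2%N ->
    `[< stabilizer_of u (h * val s) >] = `[< stabilizer_of u h >].
  by move=> sT msu; rewrite /stabilizer_of parabolicMr // inE mem_perp1 sT msu eqxx.
have [||||act [act1 actM actG actT]] := @twisted_action int F.
- move=> u h y _; rewrite /F; case: (A u h) => /=; first by rewrite opprK.
  by case: (B u h); rewrite ?subKr.
- have no u v h : m u v = Some 2%N -> ~~ (A u h && B v h).
    move=> muv; apply/negP => /andP[/andP[/eqP ut /asboolP h1] /andP[/eqP vt /asboolP h2]].
    case: no2; rewrite -ut -vt (coxeter_sym hW) muv eq_sym (coxeter_neq hW muv).
    by split=> //; exists h; rewrite ?ut ?vt.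
  move=> u v h y _ _ muv; apply: FS; first exact: no.
  by apply: no; rewrite (coxeter_sym hW).
- move=> s u h y sT _ msu; rewrite /F /A /B mulgA.
  have [eut|_] := eqVneq u t'; have [eu|_] := eqVneq u t; rewrite /= ?andbF //.
  + by rewrite !stab_s -?eut -?eu.
  + by rewrite !stab_s -?eut.
  + by rewrite !stab_s -?eu.
- have no s u h : s \notin T -> m s u = Some 4%N -> ~~ (A u h && B u (h * val s)).
    move=> sT msu; apply/negP => /andP[/andP[/eqP ut /asboolP h1] /andP[/eqP vt /asboolP h2]].
    case: no4; rewrite -ut -vt; split=> //; exists s, h; split=> //; rewrite ?vt //.
    by rewrite -vt ut.
  move=> s u h y sT _ msu; apply: FS; first exact: no sT msu.
  by have := no _ _ (h * val s) sT msu; rewrite (coxeter_sKr hW).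
have At y : F t' 1 y = (- y)%R.
  by rewrite /F /A eqxx asboolT //; apply: parabolic1.
have Bt y : F t g y = (1 - y)%R.
  have P1 : stabilizer_of t 1 by exact: parabolic1.
  rewrite /F /A /B eqxx mulVg (asboolT P1) /=.
  have [ett|//] := eqVneq t t'; case: asboolP => //=.
  by rewrite -ett => /stabilizer_commute e; case: xt'; rewrite e mulgK ett.
have xE y : act (g * val t * g^-1 * val t') (1, y) = (1, (1 + y)%R).
  have := actT t' 1 1 y t'T parabolic1; rewrite mul1g invg1 !mulg1 At => e.
  by rewrite actM e actT // mul1g Bt opprK.
have xk k : act ((g * val t * g^-1 * val t') ^+ k) (1, 0%R) = (1, Posz k).
  elim: k => [|k IHk]; first by rewrite act1.
  by rewrite expgS actM IHk xE.
have := xk n; rewrite xn act1 => -[n00]; by rewrite -n00 in n0.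
Qed.

Hypothesis hfin : finite_set (parabolic (~: T)).

Lemma in_conjugates x : x \in conjugate_generators T <->
  exists t w, [/\ t \in T, parabolic (~: T) w & x = w * val t * w^-1].
Proof.
rewrite /conjugate_generators in_fset_set; last first.
  pose f (p : S * W) := p.2 * val p.1 * p.2^-1.
  apply: (@sub_finite_set _ _ (f @` ([set: S] `*` parabolic (~: T)))%classic).
    by move=> _ [t [w [tT Gw ->]]]; exists (t, w).
  by apply: finite_image; apply: finite_setX => //; apply: finite_finset.
by split; [move/set_mem | move=> ?; apply/mem_set].
Qed.

Lemma conjugate_involution t w : w * val t * w^-1 * (w * val t * w^-1) = 1.
Proof. by rewrite !mulgA mulgVK -[w * _ * _]mulgA (coxeter_ss hW) mulg1 mulgV. Qed.

Lemma conjugate_lmul s x : x \in conjugate_generators T -> s \notin T ->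
  val s * x * val s \in conjugate_generators T.
Proof.
move=> /in_conjugates[t [w [tT Gw ->]]] sT; apply/in_conjugates; exists t, (val s * w).
split=> //; last by rewrite invgM (coxeter_sV hW) !mulgA.
by apply: parabolicM => //; apply: parabolic_gen; rewrite inE.
Qed.

Lemma gen_in_conjugates t : t \in T -> val t \in conjugate_generators T.
Proof.
move=> tT; apply/in_conjugates; exists t, 1; rewrite mul1g invg1 mulg1; split=> //.
exact: parabolic1.
Qed.

Lemma normal_closureE :
  normal_closure (parabolic T) = generated [set` conjugate_generators T]%classic.
Proof.
have [G1 GM GV] := generated_subgroup [set` conjugate_generators T]%classic.
apply/seteqP; split.
  apply: smallest_sub; last first.
    apply: generated_min => // _ [t tT <-].
    by apply: generated_in; apply: gen_in_conjugates.
  split=> // g x Hx; have [a <-] := wprod_onto hW g.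
  elim: a => [|s a IHa] /=; first by rewrite mul1g invg1 mulg1.
  rewrite invgM (coxeter_sV hW) !mulgA -(mulgA (val s)) -(mulgA (val s)).
  move: (_ * _^-1) IHa => y; have [sT|sT] := boolP (s \in T).
    have Gs : generated [set` conjugate_generators T]%classic (val s).
      by apply: generated_in; apply: gen_in_conjugates.
    by move=> Hy; exact: (GM _ _ (GM _ _ Gs Hy) Gs).
  have sub := conjg_subgroup (val s) (generated_subgroup [set` conjugate_generators T]%classic).
  rewrite -{2}(coxeter_sV hW s).
  move=> Hy; apply: (generated_min sub _ Hy) => z /= zX; apply: generated_in; rewrite /= (coxeter_sV hW).
  exact: conjugate_lmul.
move=> x Hx M [[sM nM] TM]; apply: (Hx M); split=> // z /in_conjugates[t [w [tT _ ->]]].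
by apply: nM; apply: TM; apply: parabolic_gen.
Qed.

Lemma conjugate_valP (x : conjugate_generators T) :
  exists t w, [/\ t \in T, parabolic (~: T) w & val x = w * val t * w^-1].
Proof. by apply/in_conjugates; apply: valP. Qed.

(** The entry 2 records commutation in W. That these commutations present N is the content
    of [conjugate_coxeter]. *)
Definition conjugate_matrix (x y : conjugate_generators T) : option nat :=
  if x == y then Some 1%N
  else if val x * val y == val y * val x then Some 2%N else None.

Lemma conjugate_matrix_right_angled : right_angled conjugate_matrix.
Proof. by move=> x y; rewrite /conjugate_matrix; case: ifP => // _; case: ifP. Qed.

(** Given f on S_T, the twisted action on W x H with F_t(g) the multiplication by
    f(g t g^-1) is well defined because f respects the commutations in S_T. On N it fixes the first
    coordinate 1 and multiplies the second one by the value of the extension of f. *)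
Lemma conjugate_coxeter : coxeter_system (normal_closure (parabolic T)) conjugate_matrix.
Proof.
have valV (x : conjugate_generators T) : val x * val x = 1.
  by have [t [w [_ _ ->]]] := conjugate_valP x; apply: conjugate_involution.
split.
- split=> [x|x y|x y xy n]; rewrite /conjugate_matrix ?eqxx //.
    by rewrite eq_sym; case: eqVneq => // _; rewrite eq_sym.
  by rewrite (negPf xy); case: ifP => // _ [<-].
- exact: normal_closureE.
- move=> x y n; rewrite /conjugate_matrix; case: eqVneq => [->|_].
    by case=> <-; rewrite expg1.
  case: eqP => // e [<-]; rewrite expg2 {1}e -mulgA [val x * _]mulgA valV mul1g.
  exact: valV.
move=> H f frel.
pose fW x : H := if insub x is Some y then f y else 1.
have fWE (y : conjugate_generators T) : fW (val y) = f y by rewrite /fW valK.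
have fWV x : fW x * fW x = 1.
  rewrite /fW; case: insubP => [y _ _|_]; last by rewrite mulg1.
  by have := frel y y 1%N; rewrite /conjugate_matrix eqxx => /(_ erefl).
have fWC x y : x * y = y * x -> fW x * fW y = fW y * fW x.
  rewrite /fW; case: insubP => [x' _ xE|_ _]; last by rewrite mulg1 mul1g.
  case: insubP => [y' _ yE|_ _]; last by rewrite mulg1 mul1g.
  have [->//|xy] := eqVneq x' y'; rewrite -xE -yE => e.
  have := frel x' y' 2%N; rewrite /conjugate_matrix (negPf xy) e eqxx => /(_ erefl).
  rewrite expg2 => e1.
  have fV (z : conjugate_generators T) : (f z)^-1 = f z.
    by apply: mulg1_eq; have := fWV (val z); rewrite fWE.
  by have := mulg1_eq e1; rewrite invgM !fV.
pose F (u : S) g (y : H) := fW (g * val u * g^-1) * y.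
have [||||act [act1 actM actG actT]] := @twisted_action H F.
- by move=> u g y _; rewrite /F mulgA fWV mul1g.
- move=> u v g y _ _ muv; rewrite /F !mulgA; congr (_ * y); apply: fWC.
  by rewrite !mulgA !mulgVK -!(mulgA g) (commute_of_m2 hW muv).
- move=> s u g y _ _ msu; rewrite /F; congr (fW _ * _).
  rewrite invgM (coxeter_sV hW) -!mulgA; congr (g * _).
  by rewrite !mulgA (commute_of_m2 hW msu) (coxeter_sKr hW).
- move=> s u g y _ _ msu; rewrite /F !mulgA; congr (_ * y); apply: fWC.
  rewrite invgM (coxeter_sV hW) !mulgA !mulgVK.
  have := coxeter_rel hW msu; rewrite (_ : 4 = 2 + 2)%N // expgnDr => e.
  have := mulg1_eq e; rewrite expg2 !invgM !(coxeter_sV hW) => {}e.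
  rewrite -[g * val u * val s]mulgA -(mulgA g) -(mulgA g).
  congr (_ * g^-1); rewrite -!mulgA; congr (g * _).
  by rewrite !mulgA in e *; rewrite e.
have subN : is_subgroup [set x | exists c, forall y : H, act x (1, y) = (1, c * y)]%classic.
  split=> /=; first by exists 1 => y; rewrite act1 mul1g.
    move=> x z [c cE] [d dE]; exists (c * d) => y.
    by rewrite actM dE cE mulgA.
  move=> x [c cE]; exists c^-1 => y.
  by rewrite -{1}(mulVKg c y) -cE -actM mulVg act1.
have NE x : normal_closure (parabolic T) x ->
    forall y : H, act x (1, y) = (1, (act x (1, 1)).2 * y).
  rewrite normal_closureE => Nx.
  have [c cE] : exists c, forall y : H, act x (1, y) = (1, c * y).
    apply: (generated_min subN _ Nx) => z /= /in_conjugates[t [w [tT Gw ->]]].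
    by exists (fW (w * val t * w^-1)) => y; rewrite actT // mul1g.
  by move=> y; rewrite !cE mulg1.
exists (fun x => (act x (1, 1)).2); split.
  by move=> x y Nx Ny; rewrite actM NE // NE //= mulg1.
move=> x; have [t [w [tT Gw xE]]] := conjugate_valP x.
by rewrite -fWE {1}[val x]xE actT //= mul1g /F mulg1 -xE.
Qed.

Lemma extension_exists (I : Type) (phi : {t | t \in T} -> I) :
  exists psi : conjugate_generators T -> I, is_extension phi psi.
Proof.
have ex (x : conjugate_generators T) : exists t : {t | t \in T},
    exists2 w, parabolic (~: T) w & val x = w * val (val t) * w^-1.
  have [t [w [tT Gw xE]]] := conjugate_valP x.
  by exists (Sub t tT), w.
have [tp tpP] := boolp.choice ex.
exists (phi \o tp) => x t w Gw xE; congr phi; apply: val_inj.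
have [w' Gw' xE'] := tpP x.
have [] := @conjugate_eq2 (val (tp x)) (val t) w' w _ _ Gw' Gw; rewrite -?xE //; exact: valP.
Qed.

End TwistedAction.

(** * Chains and cliques of commuting conjugates *)

Section Chains.
Local Open Scope group_scope.
Variables (W : groupType) (S : {fset W}) (m : S -> S -> option nat).
Hypothesis hW : coxeter_system [set: W]%classic m.
Variable T : {set S}.
Hypothesis hST : forall s t : S, s \notin T -> t \in T ->
  m s t \in [:: Some 2%N; Some 4%N; None].
Hypothesis hTT : forall t t' : S, t \in T -> t' \in T ->
  m t t' \in [:: Some 1%N; Some 2%N; None].
Implicit Types (s t u v y z : S) (g h w x : W) (L : seq S) (J K : {set S}).

Local Notation length := (length hW).
Local Notation G := (parabolic (~: T)).
Local Notation rank := (fun s : S => nat_of_ord (enum_rank s)).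

(** Chains are stored with the last letter at the head. A letter in T starts a new
    component; it commutes with all the earlier letters, and the letters in T occur in
    increasing order, so that an admissible set has only one chain. A letter outside T
    continues the component of the letter before it, and commutes with the rest. *)
Fixpoint chain L : bool :=
  if L is s :: L' then
    chain L' &&
    (if s \in T then
       all (fun y => m s y == Some 2%N) L' &&
       all (fun y => (y \in T) ==> (rank y < rank s)%N) L'
     else if L' is y :: L'' then
       (m y s == Some (if y \in T then 4%N else 3%N)) &&
       all (fun z => m z s == Some 2%N) L''
     else false)
  else true.

(** The reflection in the coordinate vector e_k of the last component, of type B_k. *)
Fixpoint chain_refl L : W :=
  if L is s :: L' then
    if s \in T then val s else val s * chain_refl L' * val s
  else 1.

Fixpoint chain_clique L : seq W :=
  if L is _ :: L' then chain_refl L :: chain_clique L' else [::].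

(** This is Sigma_0 for the set of letters Sigma of L; see [Sigma0_chain]. *)
Definition free_of L : {set S} := perp m [set s in L] :\: T.

(** The letter of T in the component that contains the head of L. *)
Fixpoint head_type L : option S :=
  if L is s :: L' then if s \in T then Some s else head_type L' else None.

Definition conjugate_of t x : Prop :=
  t \in T /\ exists2 g, G g & x = g * val t * g^-1.

Lemma chain_reflT s L : s \in T -> chain_refl (s :: L) = val s.
Proof. by move=> /= ->. Qed.

Lemma chain_reflN s L : s \notin T -> chain_refl (s :: L) = val s * chain_refl L * val s.
Proof. by move=> /= /negPf ->. Qed.

Lemma rank_inj : injective rank.
Proof. by move=> s t /ord_inj /enum_rank_inj. Qed.

Lemma in_free_of s L : (s \in free_of L) = (s \notin T) && all (fun y => m s y == Some 2%N) L.
Proof.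
rewrite /free_of 2!inE; congr andb; apply/forall_inP/allP => h y.
  by move=> yL; apply: h; rewrite inE.
by rewrite inE => /h.
Qed.

Lemma free_of_cons s L : free_of (s :: L) = free_of L :&: (perp m [set s] :\: T).
Proof.
apply/setP => u; rewrite finset.in_setI finset.in_setD !in_free_of mem_perp1 /=.
by case: (u \in T); rewrite //= andbC.
Qed.

Lemma parabolic_free_of_cons s L h : parabolic (free_of L :&: perp m [set s]) h ->
  parabolic (free_of (s :: L)) h.
Proof.
apply: parabolicS; rewrite free_of_cons; apply/fintype.subsetP => u.
rewrite !finset.in_setI => /andP[uL us]; rewrite uL finset.in_setD us andbT /=.
by move: uL; rewrite in_free_of => /andP[].
Qed.

Lemma free_of_nil : free_of [::] = ~: T.
Proof. by apply/setP => u; rewrite in_free_of inE andbT. Qed.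

Lemma free_of_G L h : parabolic (free_of L) h -> G h.
Proof.
move=> Jh; apply: parabolicS Jh; apply/fintype.subsetP => s.
by rewrite in_free_of inE => /andP[].
Qed.

Lemma parabolic_commute J K x w : (forall s u, s \in J -> u \in K -> m s u = Some 2%N) ->
  parabolic J x -> parabolic K w -> x * w = w * x.
Proof.
move=> JK Jx Kw; apply/commute_sym.
apply: (generated_min (commute_subgroup w) _ Jx) => _ [s sJ <-]; apply/commute_sym.
apply: (generated_min (commute_subgroup (val s)) _ Kw) => _ [u uK <-].
exact: (commute_of_m2 hW (JK _ _ sJ uK)).
Qed.

Lemma chain_refl_parabolic L : parabolic [set s in L] (chain_refl L).
Proof.
elim: L => [|s L IHL] /=; first exact: parabolic1.
have Ps : parabolic [set u in s :: L] (val s) by apply: parabolic_gen; rewrite !inE eqxx.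
case: ifP => // _; apply: parabolicM => //; apply: parabolicM => //.
by apply: parabolicS IHL; apply/fintype.subsetP => u; rewrite !inE => ->; rewrite orbT.
Qed.

Lemma chain_clique_parabolic L x : x \in chain_clique L -> parabolic [set s in L] x.
Proof.
elim: L => [//|s L IHL]; rewrite inE => /orP[/eqP ->|/IHL]; first exact: chain_refl_parabolic.
by move=> Lx; apply: parabolicS Lx; apply/fintype.subsetP => u; rewrite !inE => ->; rewrite orbT.
Qed.

Lemma free_commute L h x : parabolic (free_of L) h -> parabolic [set s in L] x -> h * x = x * h.
Proof.
apply: parabolic_commute => s u; rewrite in_free_of inE => /andP[_ /allP sL] /sL /eqP //.
Qed.

Lemma gen_commute s L x : all (fun z => m z s == Some 2%N) L -> parabolic [set z in L] x ->
  val s * x = x * val s.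
Proof.
move=> /allP sL Lx; apply: (@parabolic_commute [set s] [set z in L]) => //.
  by move=> u v /finset.set1P ->; rewrite inE => /sL /eqP; rewrite (coxeter_sym hW).
by apply: parabolic_gen; rewrite inE.
Qed.

Lemma conj_gen_inj s x w : val s * x * val s = val s * w * val s -> x = w.
Proof. by move/mulIg/mulgI. Qed.

(** By induction on the chain. For a last letter s outside T, both g and s g s fix the
    clique of the shorter chain: s fixes all its elements but the last, which it exchanges
    with the new one. So g s = s (s g s) intertwines elements of a parabolic subgroup that
    does not contain s, and g lies in the parabolic subgroup of letters commuting with s. *)
Lemma chain_stabilizer L g : chain L -> G g -> (forall x, x \in chain_clique L -> g * x = x * g) ->
  parabolic (free_of L) g.
Proof.
elim: L g => [|s L IHL] g; first by rewrite free_of_nil.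
move=> + Gg gfix => /= /andP[cL cs]; have [sT|sT] := boolP (s \in T).
  rewrite free_of_cons; apply: (parabolicI hW).
    by apply: IHL => // x xL; apply: gfix; rewrite inE xL orbT.
  have gs : g * val s = val s * g by rewrite -(chain_reflT L sT); apply: gfix; apply: mem_head.
  by have [] := @conjugate_eq _ _ _ hW T hST hTT s s g; rewrite ?gs ?mulgK.
rewrite (negPf sT) in cs; case: L IHL cL cs gfix => [//|y L] IHL cL /andP[mys msL] gfix.
have Gs : G (val s) by apply: parabolic_gen; rewrite inE.
have sJ : s \notin free_of (y :: L).
  rewrite in_free_of /= (coxeter_sym hW) (eqP mys) sT /=.
  by case: (y \in T).
set J := free_of (y :: L) in sJ *.
have Jg : parabolic J g by apply: IHL => // x xL; apply: gfix; rewrite inE xL orbT.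
have Jsgs : parabolic J (val s * g * val s).
  apply: IHL => //; first by do 2?apply: parabolicM.
  move=> x; rewrite inE => /orP[/eqP ->|xL].
    have := gfix (chain_refl (s :: y :: L)) (mem_head _ _); rewrite chain_reflN //.
    move: (chain_refl (y :: L)) => e ge.
    apply: (@conj_gen_inj s); rewrite !mulgA !(coxeter_sKr hW) (coxeter_ss hW) mul1g.
    by rewrite -!mulgA in ge *; rewrite ge.
  have sx := gen_commute msL (chain_clique_parabolic xL).
  have gx : g * x = x * g by apply: gfix; rewrite !inE xL !orbT.
  by rewrite -!mulgA sx (mulgA g) gx !mulgA sx.
have [] := parabolic_intertwine hW Jg Jsgs sJ; first by rewrite !mulgA (coxeter_ss hW) mul1g.
by move=> _ Jsg; apply: parabolic_free_of_cons.
Qed.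

Lemma conjugate_of_uniq t t' x : conjugate_of t x -> conjugate_of t' x -> t = t'.
Proof.
move=> [tT [g Gg ->]] [t'T [g' Gg' e]].
by have [] := @conjugate_eq2 _ _ _ hW T hST hTT _ _ _ _ tT t'T Gg Gg' e.
Qed.

Lemma conjugate_of_conj t x h : G h -> conjugate_of t x -> conjugate_of t (h * x * h^-1).
Proof.
move=> Gh [tT [g Gg ->]]; split=> //; exists (h * g); first exact: parabolicM.
by rewrite invgM !mulgA.
Qed.

Lemma conjugate_of_gen t : t \in T -> conjugate_of t (val t).
Proof.
by move=> tT; split=> //; exists 1; [apply: parabolic1 | rewrite mul1g invg1 mulg1].
Qed.

Lemma conjugate_of_invol t x : conjugate_of t x -> x * x = 1.
Proof. by move=> [_ [g _ ->]]; apply: (conjugate_involution hW). Qed.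

Lemma chain_neighbour s y L : s \notin T -> chain (s :: y :: L) ->
  [/\ m y s = Some (if y \in T then 4%N else 3%N), all (fun z => m z s == Some 2%N) L
    & chain (y :: L)].
Proof. by move=> /negPf sT /andP[cL]; rewrite sT => /andP[/eqP mys msL]. Qed.

Lemma chain_head s L : s \in T -> chain (s :: L) ->
  [/\ all (fun y => m s y == Some 2%N) L,
      all (fun y => (y \in T) ==> (rank y < rank s)%N) L & chain L].
Proof. by move=> sT /andP[cL]; rewrite sT => /andP[]. Qed.

Lemma chain_consT s L : s \in T -> chain L -> all (fun y => m s y == Some 2%N) L ->
  all (fun y => (y \in T) ==> (rank y < rank s)%N) L -> chain (s :: L).
Proof. by move=> sT cL msL rsL; rewrite [chain _]/= cL sT msL rsL. Qed.

Lemma chain_consN s y L : s \notin T -> chain (y :: L) ->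
  m y s = Some (if y \in T then 4%N else 3%N) -> all (fun z => m z s == Some 2%N) L ->
  chain (s :: y :: L).
Proof. by move=> sT cL mys msL; rewrite [chain _]/= (negPf sT) mys eqxx msL !andbT. Qed.

Lemma chain_tail s L : chain (s :: L) -> chain L.
Proof. by case/andP. Qed.

Lemma chain_refl_type s L : chain (s :: L) ->
  exists t, [/\ t \in s :: L, conjugate_of t (chain_refl (s :: L)) & head_type (s :: L) = Some t].
Proof.
elim: L s => [|y L IHL] s cL; have [sT|sT] := boolP (s \in T).
- by exists s; rewrite mem_head chain_reflT //= sT; split=> //; apply: conjugate_of_gen.
- by move: cL; rewrite /= (negPf sT).
- by exists s; rewrite mem_head chain_reflT //= sT; split=> //; apply: conjugate_of_gen.
have [t [tL te ht]] := IHL y (chain_tail cL).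
exists t; rewrite inE tL orbT chain_reflN //; split=> //; last by rewrite -ht /= (negPf sT).
rewrite -{2}(coxeter_sV hW); apply: conjugate_of_conj => //.
by apply: parabolic_gen; rewrite inE.
Qed.

Lemma conj_stabilizer t h p : stabilizer_of m T t p ->
  (h * p) * val t * (h * p)^-1 = h * val t * h^-1.
Proof.
move=> /(stabilizer_commute hW) e.
by rewrite invgM -(mulgA h) e !mulgA mulgK.
Qed.

(** The two ways to extend L are told apart by the type of the new reflection: it is new
    if the letter is in T, and it occurs in L otherwise. *)
Lemma chain_last_type s L h t : chain (s :: L) -> G h ->
    conjugate_of t (h * chain_refl (s :: L) * h^-1) ->
  (s \in T -> s = t /\ t \notin L) /\ (s \notin T -> t \in L).
Proof.
move=> cL Gh tx; have [t' [t'L t'x ht]] := chain_refl_type cL.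
have -> : t = t' by apply: conjugate_of_uniq tx _; apply: conjugate_of_conj.
split=> sT.
  have st : s = t' by move: ht; rewrite /= sT => -[].
  split=> //; rewrite -st; apply/negP => sL.
  by have [/allP/(_ _ sL)] := chain_head sT cL; rewrite (coxeter_mss hW).
move: t'L t'x; rewrite inE => /orP[/eqP -> [t'T]|//].
by rewrite t'T in sT.
Qed.

(** The condition for x, of type t, to be listed after z in a clique sorted by type. *)
Definition joins t x (z : W) : Prop :=
  [/\ z <> x, x * z = z * x & exists2 t', conjugate_of t' z & (rank t' <= rank t)%N].

Lemma joins_conj t x (z : W) h : joins t x z -> G h -> joins t (h * x * h^-1) (h * z * h^-1).
Proof.
move=> [zx xz [t' t'z rt']] Gh; split.
- by move=> /mulIg/mulgI.
- by rewrite !mulgA !mulgVK -!(mulgA h) xz.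
- by exists t' => //; apply: conjugate_of_conj.
Qed.

(** When the chain ends with y in T, [finite_order_classification] gives the position of x
    relative to y. If the types differ, the shortest representative of h lies in the
    parabolic subgroups of both the shorter chain and of y^perp. If they agree, it ends
    with a generator s with m(s, t) = 4, which is the second node of the component. *)
Lemma extend_at_head y L t x h : y \in T -> chain (y :: L) -> t \in T -> chain (t :: L) ->
    parabolic (free_of L) h -> x = h * val t * h^-1 ->
    joins t x (val y) ->
  exists s h', [/\ chain [:: s, y & L], parabolic (free_of (y :: L)) h'
    & x = h' * chain_refl [:: s, y & L] * h'^-1].
Proof.
move=> yT cyL tT ctL Jh xE [yx xy [y' y'y rkyt]].
have {y' y'y} rkyt : (rank y <= rank t)%N.
  by rewrite (conjugate_of_uniq (conjugate_of_gen yT) y'y).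
have tx : conjugate_of t x by split=> //; exists h => //; apply: free_of_G Jh.
have xy2 : (h * val t * h^-1 * val y) ^+ 2 = 1.
  rewrite -xE expg2 {2}xy -mulgA (mulgA (val y)) (coxeter_ss hW) mul1g.
  exact: conjugate_of_invol tx.
have xy' : h * val t * h^-1 <> val y by rewrite -xE => /esym.
have [h1 [p [hE h1min Pp Jh1]]] := coset_min_split_in hW (perp m [set t] :\: T) Jh.
have xE1 : x = h1 * val t * h1^-1 by rewrite xE hE conj_stabilizer.
have [] := finite_order_classification hW hST hTT tT yT (free_of_G Jh) xy' (ltn0Sn 1) xy2.
  move=> [ty mty [a Pa Pha]]; exists t, h1; rewrite chain_reflT //; split=> //.
    have [mtL rtL _] := chain_head tT ctL.
    apply: chain_consT; rewrite //= ?mty ?eqxx // yT rtL andbT.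
    by rewrite ltn_neqAle rkyt andbT; apply: contraNneq ty => /rank_inj ->.
  rewrite free_of_cons; apply: (parabolicI hW) => //.
  apply: (coset_min_in h1min (p := p * (h^-1 * a))); first exact: parabolicM.
  by rewrite !mulgA -hE mulgV mul1g.
move=> [ety [s [a [sT mst Pa Phas]]]]; rewrite -{}ety in yT cyL yx xy rkyt xy2 xy' *.
have sP : s \notin perp m [set t] :\: T.
  by rewrite finset.in_setD mem_perp1 mst andbF.
have [a' [q [asE a'min Pa' Pq]]] := coset_min_snoc hW Pa sP.
have h1E : h1 = a' * val s.
  apply: esym; apply: (coset_min_unique h1min a'min (z := p * (h^-1 * (a * val s)) * q^-1)).
    by apply: parabolicM; [apply: parabolicM | apply: parabolicV].
  by rewrite asE !mulgA -hE mulgV mul1g mulgK.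
have [Ja' Js] : parabolic (free_of L) a' /\ parabolic (free_of L) (val s).
  apply: (parabolic_factor (hW := hW)); rewrite -h1E //.
  by rewrite h1E (length_parabolic_mul _ Pa' sP) length_gen addn1.
rewrite (parabolic_genE hW) in_free_of in Js; case/andP: Js => _ msL.
exists s, a'; split.
- apply: chain_consN; rewrite ?tT 1?(coxeter_sym hW) //.
  by apply: sub_all msL => z; rewrite (coxeter_sym hW).
- by rewrite free_of_cons; apply: (parabolicI hW).
- rewrite chain_reflN // chain_reflT // xE1 h1E invgM (coxeter_sV hW) !mulgA //.
Qed.

Lemma free_clique L h x : parabolic (free_of L) h -> x \in chain_clique L -> h * x * h^-1 = x.
Proof. by move=> Jh /chain_clique_parabolic xL; rewrite (free_commute Jh xL) mulgK. Qed.

Lemma next_not_free y (z : S) L : y \notin T -> chain (y :: z :: L) -> y \notin free_of (z :: L).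
Proof.
move=> yT /(chain_neighbour yT)[mzy _ _]; rewrite in_free_of /= (coxeter_sym hW) mzy yT.
by case: (z \in T).
Qed.

Lemma parabolicU1 J s h : parabolic J h -> parabolic (s |: J) h.
Proof. by apply: parabolicS; apply: finset.subsetUr. Qed.

Lemma parabolicU1_gen J s : parabolic (s |: J) (val s).
Proof. by apply: parabolic_gen; apply: finset.setU11. Qed.

(** Induction on the chain L, by removing its last letter y. If y is in T, see
    [extend_at_head]. Otherwise the induction hypothesis applies to x and to y x y. *)
Lemma extend_clique L t x : chain L -> conjugate_of t x ->
    (forall z : W, z \in chain_clique L -> joins t x z) ->
  exists s h, [/\ chain (s :: L), parabolic (free_of L) h
    & x = h * chain_refl (s :: L) * h^-1].
Proof.
elim: L t x => [|y L IHL] t x cL tx xjoin.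
  case: tx => tT [g Gg xE]; exists t, g; rewrite free_of_nil chain_reflT //=; split=> //.
  by rewrite tT.
have cL1 := chain_tail cL.
have xjoin1 (z : W) : z \in chain_clique L -> joins t x z.
  by move=> zL; apply: xjoin; rewrite inE zL orbT.
have [s [h [cs Jh xE]]] := IHL _ _ cL1 tx xjoin1.
have yjoin : joins t x (chain_refl (y :: L)) by apply: xjoin; apply: mem_head.
have tx' := tx; rewrite xE in tx'.
have [sTt sNt] := chain_last_type cs (free_of_G Jh) tx'.
have tT : t \in T by case: tx.
have [yT|yT] := boolP (y \in T).
  rewrite chain_reflT // in yjoin.
  have [sT|sT] := boolP (s \in T).
    have [st _] := sTt sT; rewrite chain_reflT // st in xE; rewrite st in cs.
    exact: extend_at_head cL tT cs Jh xE yjoin.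
  have tL := sNt sT; have [_ /allP/(_ _ tL) + _] := chain_head yT cL.
  rewrite tT /= => ty; case: yjoin => _ _ [t' t'y].
  by rewrite -(conjugate_of_uniq (conjugate_of_gen yT) t'y) leqNgt ty.
case: L IHL cL cL1 xjoin xjoin1 cs Jh xE yjoin tx' sTt sNt => [|w L] IHL cL cL1 xjoin xjoin1
   cs Jh xE yjoin tx' sTt sNt.
  by move: cL; rewrite /= (negPf yT).
rewrite chain_reflN // in yjoin.
have [mwy myL _] := chain_neighbour yT cL.
have yNJ := next_not_free yT cL.
set J := free_of (w :: L) in Jh yNJ *.
set e := chain_refl (w :: L) in yjoin.
have Gy : G (val y) by apply: parabolic_gen; rewrite inE.
have yV := coxeter_sV hW y.
(* Conjugation by y exchanges e with y e y and fixes the rest of the clique. *)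
have yjoin1 (z : W) : z \in chain_clique (w :: L) -> joins t (val y * x * val y) z.
  rewrite inE => /orP[/eqP ->|zL].
    have := joins_conj yjoin Gy; rewrite yV !mulgA (coxeter_ss hW) mul1g (coxeter_sKr hW).
    by [].
  have := joins_conj (xjoin1 z _) Gy; rewrite inE zL orbT yV => /(_ isT).
  by rewrite (gen_commute myL (chain_clique_parabolic zL)) (coxeter_sKr hW).
have tyx : conjugate_of t (val y * x * val y).
  by rewrite -{2}yV; apply: conjugate_of_conj.
have [s' [h' [cs' Jh' xE']]] := IHL _ _ cL1 tyx yjoin1.
have tyx' := tyx; rewrite xE' in tyx'.
have [sTt' sNt'] := chain_last_type cs' (free_of_G Jh') tyx'.
have [sT|sT] := boolP (s \in T).
  have [st tL] := sTt sT.
  have s'T : s' \in T by apply: contraR tL => /sNt'.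
  have [s't _] := sTt' s'T.
  rewrite chain_reflT // st in xE; rewrite st in cs; rewrite chain_reflT // s't in xE'.
  have [h1 [p [hE h1min Pp Jh1]]] := coset_min_split_in hW (perp m [set t] :\: T) Jh.
  have [h2 [q [h'E h2min Pq Jh2]]] := coset_min_split_in hW (perp m [set t] :\: T) Jh'.
  have xE1 : x = h1 * val t * h1^-1 by rewrite xE hE conj_stabilizer.
  have yxE : (val y * h1) * val t * (val y * h1)^-1 = h2 * val t * h2^-1.
    by rewrite -(conj_stabilizer h2 Pq) -h'E -xE' xE1 invgM yV !mulgA.
  have [_ Pr] : t = t /\ stabilizer_of m T t (h2^-1 * (val y * h1)).
    apply: conjugate_eq2 yxE => //; last exact: free_of_G Jh2.
    by apply: parabolicM => //; apply: free_of_G Jh1.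
  (* Here x = h1 t h1^-1 and y x y = h2 t h2^-1. As y is not in the parabolic subgroup of
     h1 and h2, it must pass through h1, so y commutes with t and with h1. *)
  have [y1min|[v Pv yh1]] := coset_min_lmul y h1min.
    have yE : val y * h1 = h2.
      by apply: (coset_min_unique h2min y1min Pr); rewrite mulVKg.
    case/negP: yNJ; rewrite -(parabolic_genE hW).
    rewrite -(mulgK h1 (val y)) yE; apply: parabolicM => //; exact: parabolicV.
  have lyh := length_parabolic_lmul hW Jh1 yNJ.
  have [] : parabolic (v |: J) (val y) /\ parabolic (v |: J) h1.
    apply: (parabolic_factor (hW := hW)); last by rewrite lyh length_gen.
    by rewrite yh1; apply: parabolicM; [apply: parabolicU1 | apply: parabolicU1_gen].
  rewrite (parabolic_genE hW) finset.in_setU1 (negPf yNJ) orbF => /eqP yv _.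
  rewrite -{v}yv in Pv yh1.
  have [_ Jyh1] := parabolic_intertwine hW Jh1 Jh1 yNJ (esym yh1).
  move: Pv; rewrite finset.in_setD mem_perp1 => /andP[_ myt].
  exists t, h1; rewrite chain_reflT //; split=> //.
    have [mtL rtL _] := chain_head tT cs.
    apply: chain_consT => //; rewrite /= -/(all _ (w :: L)) ?(negPf yT) //.
    by rewrite (coxeter_sym hW) myt.
  exact: parabolic_free_of_cons Jyh1.
have s'T : s' \notin T by apply/negP => /sTt'[_ /negP]; apply; apply: sNt.
have [mws msL _] := chain_neighbour sT cs; have [mws' ms'L _] := chain_neighbour s'T cs'.
have sNJ := next_not_free sT cs; have s'NJ := next_not_free s'T cs'.
have he g : parabolic J g -> g * e = e * g.
  by move=> Jg; exact: (free_commute Jg (@chain_refl_parabolic (w :: L))).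
rewrite (chain_reflN _ sT) -/e in xE; rewrite (chain_reflN _ s'T) -/e in xE'.
have sV := coxeter_sV hW s; have s'V := coxeter_sV hW s'.
(* The element k compares the two forms of y x y, so it fixes the clique of w :: L. *)
pose k := val s' * h'^-1 * (val y * h * val s).
have kE : val y * h * val s = h' * val s' * k.
  by rewrite /k !mulgA (coxeter_sKr hW) mulgV mul1g.
have Gs : G (val s) by apply: parabolic_gen; rewrite inE.
have Gs' : G (val s') by apply: parabolic_gen; rewrite inE.
have Gh := free_of_G Jh; have Gh' := free_of_G Jh'.
have Gk : G k by do ?apply: parabolicM => //; apply: parabolicV.
have ke : k * e * k^-1 = e.
  have kV : k^-1 = val s * h^-1 * val y * h' * val s'.
    by rewrite /k !invgM invgK sV s'V yV !mulgA.
  have := xE'; rewrite xE => e1; rewrite kV /k.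
  have -> : val s' * h'^-1 * (val y * h * val s) * e * (val s * h^-1 * val y * h' * val s') =
     val s' * (h'^-1 * (val y * (h * (val s * e * val s) * h^-1) * val y) * h') * val s'.
    by rewrite !mulgA.
  by rewrite e1 -!mulgA !mulKg (coxeter_sK hW) (coxeter_ss hW) mulg1.
have Jk : parabolic J k.
  apply: chain_stabilizer => // z; rewrite inE => /orP[/eqP ->|zL].
    by rewrite -/e -{2}ke mulgVK.
  have zw : z \in chain_clique (w :: L) by rewrite inE zL orbT.
  have zP := chain_clique_parabolic zL; have zP' := chain_clique_parabolic zw.
  apply/commute_sym; rewrite /k; do ?apply: commuteM; do ?apply: commuteV; apply/commute_sym.
  - exact: gen_commute ms'L zP.
  - exact: free_commute Jh' zP'.
  - exact: gen_commute myL zP.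
  - exact: free_commute Jh zP'.
  - exact: gen_commute msL zP.
have J1 : parabolic (s' |: J) (val y * h * val s).
  rewrite kE; apply: parabolicM; last exact: parabolicU1.
  by apply: parabolicM; [apply: parabolicU1 | apply: parabolicU1_gen].
have lhs := length_parabolic_mul hW Jh sNJ.
(* Only y, s and s' are outside J. If s were not y, both would be letters of reduced words
   of y h s = h' s' k, where s' is the only letter outside J. *)
have sy : s = y.
  apply/eqP; apply: contraT => nsy.
  have yNJs : y \notin s |: J by rewrite finset.in_setU1 (negPf yNJ) orbF eq_sym.
  have Jhs : parabolic (s |: J) (h * val s).
    by apply: parabolicM; [apply: parabolicU1 | apply: parabolicU1_gen].
  have lyhs := length_parabolic_lmul hW Jhs yNJs.
  have [J1y J1hs] : parabolic (s' |: J) (val y) /\ parabolic (s' |: J) (h * val s).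
    by apply: (parabolic_factor (hW := hW)); rewrite mulgA // -mulgA lyhs length_gen.
  have [_ J1s] : parabolic (s' |: J) h /\ parabolic (s' |: J) (val s).
    by apply: (parabolic_factor (hW := hW)); rewrite // lhs length_gen addn1.
  move: J1y J1s; rewrite !(parabolic_genE hW) !finset.in_setU1 (negPf yNJ) (negPf sNJ) !orbF.
  by move=> /eqP ys' /eqP ss'; rewrite ss' ys' eqxx in nsy.
clearbody k; rewrite sy in xE kE J1 lhs.
(* Cancellation would give y h y = h and x = y e y, which is already in the clique. *)
have lyhy : length (val y * h * val y) = (length h).+2.
  have [->|down] := length_mul hW (val y * h) y; first by rewrite (length_parabolic_lmul hW Jh yNJ).
  case: (@exchange_mul _ _ _ hW (val y) h y); first by rewrite [X in (_ <= X)%N]down.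
    move=> [x' [ex lt _]]; move: lt; rewrite length_gen ltnS leqn0 => /eqP/length_eq0 x1.
    rewrite x1 mul1g in ex; case: yjoin => yey _ _; case: yey.
    have hy : h * val y = val y * h by rewrite -{2}ex -!mulgA (coxeter_sK hW).
    have -> : x = val y * (h * e * h^-1) * val y.
      rewrite xE !mulgA -hy -!mulgA; do 3!congr (_ * _).
      by rewrite -{1}yV -invgM hy invgM yV.
    by rewrite he // mulgK.
  by move=> [x' [<-]]; rewrite lhs ltnNge leqnSn.
have s'y : s' = y.
  have [+ _] : parabolic (s' |: J) (val y) /\ parabolic (s' |: J) (h * val y).
    by apply: (parabolic_factor (hW := hW)); rewrite mulgA // lyhy lhs length_gen.
  by rewrite (parabolic_genE hW) finset.in_setU1 (negPf yNJ) orbF => /eqP.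
rewrite s'y in kE.
have [c [v [z [Jv myv hE Jc Jz]]]] := double_coset_sandwich yNJ Jh Jh' Jk kE lyhy.
have Jz' : parabolic J z by apply: parabolicS Jz; apply: finset.subsetIl.
have zy : z * val y = val y * z.
  have Py : parabolic [set y] (val y) by apply: parabolic_gen; apply: finset.set11.
  apply: parabolic_commute Jz Py => u u'; rewrite finset.in_setI mem_perp1 => /andP[_ /eqP muy].
  by move=> /finset.set1P ->.
have [vT mvL] : v \notin T /\ all (fun u => m v u == Some 2%N) (w :: L).
  by apply/andP; rewrite -in_free_of.
exists v, c; rewrite (chain_reflN _ vT) (chain_reflN _ yT) -/e; split.
- apply: chain_consN => //; first by rewrite (negPf yT).
  by apply: sub_all mvL => u; rewrite (coxeter_sym hW).
- exact: parabolic_free_of_cons.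
- have zE : z * (val y * e * val y) * z^-1 = val y * e * val y.
    rewrite !mulgA zy -(mulgA _ z e) he // !mulgA -(mulgA _ z (val y)) zy.
    by rewrite !mulgA mulgK.
  by rewrite xE hE -{2}zE !invgM (coxeter_sV hW v) !mulgA.
Qed.

(** Ordered cliques of commuting elements of S_T, sorted by type; as in chains, the last
    element is at the head. *)
Fixpoint clique (c : seq W) : Prop :=
  if c is x :: c' then
    clique c' /\ exists2 t, conjugate_of t x & forall z : W, z \in c' -> joins t x z
  else True.

Lemma braid_of_m3 s u : m s u = Some 3%N ->
  val s * val u * val s = val u * val s * val u.
Proof.
move=> /(coxeter_rel hW) e.
have : val s * val u * val s * (val u * val s * val u) = 1.
  by rewrite -{}e !expgS expg0 mulg1 -!mulgA.
by move=> /mulg1_eq; rewrite !invgM !(coxeter_sV hW) !mulgA.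
Qed.

Lemma braid_of_m4 s u : m s u = Some 4%N ->
  val s * val u * val s * val u = val u * val s * val u * val s.
Proof.
move=> /(coxeter_rel hW); rewrite -[4%N]/(2 + 2)%N expgnDr => /mulg1_eq.
by rewrite expg2 !invgM !(coxeter_sV hW) !mulgA.
Qed.

(** In B_3, the simple reflection exchanging e_1 and e_2 fixes e_3. *)
Lemma braid_fix s u (x : W) : m u s = Some 3%N -> val s * x = x * val s ->
  val u * (val s * (val u * x * val u) * val s) * val u = val s * (val u * x * val u) * val s.
Proof.
move=> /braid_of_m3 b sx.
rewrite !mulgA b -!mulgA; do 2!congr (_ * _).
rewrite !(mulgA (val u)) b -!mulgA.
by rewrite !(mulgA (val s)) sx -!mulgA (coxeter_sK hW).
Qed.

Lemma chain_clique_type L (z : W) : chain L -> z \in chain_clique L ->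
  exists2 t, t \in L & conjugate_of t z.
Proof.
elim: L => [//|s L IHL] cL; rewrite inE => /orP[/eqP ->|zL].
  by have [t [tL te _]] := chain_refl_type cL; exists t.
have [t tL tz] := IHL (chain_tail cL) zL.
by exists t; rewrite // inE tL orbT.
Qed.

(** The new reflection s e s of a chain s :: y :: L is obtained from the last one, e. It
    commutes with e by the relation of order 4 if y is in T, and otherwise by conjugation
    with y, which fixes s e s and takes e to an earlier reflection. It differs from e, as s
    would otherwise be in the stabilizer of the clique. *)
Lemma chain_cliqueP L : chain L -> clique (chain_clique L).
Proof.
elim: L => [//|s L IHL] cL; have cL' := chain_tail cL; have {IHL} clL := IHL cL'.
split=> //; have [t [tsL te ht]] := chain_refl_type cL; exists t => // z zL.
have [sT|sT] := boolP (s \in T).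
  have [msL rsL _] := chain_head sT cL.
  have ets : s = t by move: ht; rewrite /= sT => -[].
  have [t' t'L t'z] := chain_clique_type cL' zL.
  have t'T : t' \in T by case: t'z.
  have rt' : (rank t' < rank s)%N by move/allP: rsL => /(_ _ t'L); rewrite t'T.
  rewrite chain_reflT // -ets; split.
  - move=> zs; rewrite zs in t'z.
    by rewrite (conjugate_of_uniq t'z (conjugate_of_gen sT)) ltnn in rt'.
  - apply: gen_commute (chain_clique_parabolic zL).
    by apply: sub_all msL => u; rewrite (coxeter_sym hW).
  - by exists t' => //; apply: ltnW.
case: L cL cL' clL tsL te ht zL => [|y L] cL cL' clL tsL te ht zL; first by [].
have [mys msL _] := chain_neighbour sT cL.
have Gs : G (val s) by apply: parabolic_gen; rewrite inE.
have sV := coxeter_sV hW s.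
case: clL => clL [t' t'y joinL].
have ett : t = t'.
  have := conjugate_of_conj Gs te; rewrite chain_reflN // sV.
  rewrite !mulgA (coxeter_ss hW) mul1g (coxeter_sKr hW) => /conjugate_of_uniq.
  by apply.
rewrite -{t'}ett in t'y joinL.
have joinL' (u : W) : u \in chain_clique L -> joins t (chain_refl [:: s, y & L]) u.
  move=> uL; have := joins_conj (joinL u uL) Gs; rewrite sV -chain_reflN //.
  by rewrite (gen_commute msL (chain_clique_parabolic uL)) (coxeter_sKr hW).
move: zL; rewrite inE => /orP[/eqP ->|]; last exact: joinL'.
split; last by exists t.
- rewrite (chain_reflN _ sT) => e.
  case/negP: (next_not_free sT cL); rewrite -(parabolic_genE hW).
  apply: chain_stabilizer => // u; rewrite inE => /orP[/eqP ->|uL].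
    by rewrite {2}e (coxeter_sKr hW).
  exact: gen_commute msL (chain_clique_parabolic uL).
- have [yT|yT] := boolP (y \in T).
    rewrite yT in mys; rewrite (chain_reflN _ sT) (chain_reflT _ yT).
    by rewrite -(braid_of_m4 mys) !mulgA.
  rewrite (negPf yT) in mys.
  case: L cL cL' clL tsL te ht msL t'y joinL joinL' => [|y' L] cL cL' clL tsL te ht msL t'y joinL joinL'.
    by move: cL'; rewrite /= (negPf yT).
  have [_ e'c _] := joinL' (chain_refl (y' :: L)) (mem_head _ _).
  have sc : val s * chain_refl (y' :: L) = chain_refl (y' :: L) * val s.
    by apply: gen_commute msL (@chain_refl_parabolic _).
  rewrite (chain_reflN _ sT) (chain_reflN _ yT) in e'c *.
  move: (chain_refl (y' :: L)) sc e'c => c sc e'c.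
  have ye' := braid_fix mys sc.
  set e' := val s * (val y * c * val y) * val s in e'c ye' *.
  have e'y : commute e' (val y) by rewrite /commute -{1}ye' (coxeter_sKr hW).
  exact: commuteM (commuteM e'y e'c) e'y.
Qed.

(** If the two chains first differ in letters s and s' outside T, then k = s' g s fixes the
    clique of their common part, so g s = s' k, and s' is a letter of a reduced word of the
    left-hand side. *)
Lemma chain_clique_unique L L' g : chain L -> chain L' -> G g ->
    chain_clique L' = [seq g * x * g^-1 | x <- chain_clique L] ->
  L = L' /\ parabolic (free_of L) g.
Proof.
move=> cL cL' Gg e.
suff eLL : L = L'.
  split=> //; apply: chain_stabilizer => // x xL; apply: (mulIg g^-1); rewrite mulgK.
  rewrite -eLL in e; have : nth 1 (chain_clique L) (index x (chain_clique L)) = x by rewrite nth_index.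
  by rewrite {1}e (nth_map 1) ?index_mem // nth_index.
elim: L L' cL cL' e => [|s L IHL] [|s' L'] // cL cL' e.
have [er eL] : chain_refl (s' :: L') = g * chain_refl (s :: L) * g^-1 /\
    chain_clique L' = [seq g * x * g^-1 | x <- chain_clique L] by case: e.
have eLL := IHL _ (chain_tail cL) (chain_tail cL') eL.
clear e; rewrite -{L'}eLL in eL cL' er *.
congr cons.
have gfix x : x \in chain_clique L -> g * x = x * g.
  move=> xL; apply: (mulIg g^-1); rewrite mulgK.
  have : nth 1 (chain_clique L) (index x (chain_clique L)) = x by rewrite nth_index.
  by rewrite {1}eL (nth_map 1) ?index_mem // nth_index.
have Jg := chain_stabilizer (chain_tail cL) Gg gfix.
have [t [tL te ht]] := chain_refl_type cL.
have [t' [t'L t'e ht']] := chain_refl_type cL'.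
have tt' : t = t'.
  by apply: conjugate_of_uniq t'e; rewrite er; apply: conjugate_of_conj.
rewrite -{t'}tt' in t'L t'e ht'.
have te' := te; rewrite -[chain_refl _]mul1g -[_ * _]mulg1 -{2}invg1 in te'.
have t'e' := t'e; rewrite -[chain_refl _]mul1g -[_ * _]mulg1 -{2}invg1 in t'e'.
have [sT1 sT2] := chain_last_type cL parabolic1 te'.
have [s'T1 s'T2] := chain_last_type cL' parabolic1 t'e'.
have [sT|sT] := boolP (s \in T).
  have [-> /negP tNL] := sT1 sT.
  have [s'T|/s'T2 //] := boolP (s' \in T).
  by have [->] := s'T1 s'T.
have tL1 := sT2 sT.
have s'T : s' \notin T by apply/negP => /s'T1[_ /negP].
case: L IHL cL cL' er eL gfix Jg tL te ht t'L t'e ht' te' t'e' sT1 sT2 s'T1 s'T2 tL1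
   => [//|y L] _ cL cL' er eL gfix Jg _ _ _ _ _ _ _ _ _ _ _ _ _.
rewrite (chain_reflN _ sT) (chain_reflN _ s'T) in er.
set e := chain_refl (y :: L) in er.
have [mys msL _] := chain_neighbour sT cL; have [mys' ms'L _] := chain_neighbour s'T cL'.
have sNJ := next_not_free sT cL; have s'NJ := next_not_free s'T cL'.
have sV := coxeter_sV hW s; have s'V := coxeter_sV hW s'.
pose k := val s' * g * val s.
have kE : g * val s = val s' * k by rewrite /k !mulgA (coxeter_ss hW) mul1g.
have Jk : parabolic (free_of (y :: L)) k.
  apply: chain_stabilizer; first exact: chain_tail cL.
    by do ?apply: parabolicM => //; apply: parabolic_gen; rewrite inE.
  move=> x; rewrite inE => /orP[/eqP ->|xL].
    rewrite -/e; apply: (mulIg k^-1); rewrite mulgK /k !invgM sV s'V.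
    have -> : val s' * g * val s * e * (val s * (g^-1 * val s')) =
        val s' * (g * (val s * e * val s) * g^-1) * val s' by rewrite !mulgA.
    by rewrite -er !mulgA (coxeter_ss hW) mul1g (coxeter_sKr hW).
  have xP := chain_clique_parabolic xL.
  apply/commute_sym; rewrite /k; do ?apply: commuteM; apply/commute_sym.
  - exact: gen_commute ms'L xP.
  - by apply: gfix; rewrite inE xL orbT.
  - exact: gen_commute msL xP.
have Jsg : parabolic (s |: free_of (y :: L)) (val s' * k).
  rewrite -kE; apply: parabolicM; first exact: parabolicU1.
  exact: parabolicU1_gen.
have [+ _] : parabolic (s |: free_of (y :: L)) (val s') /\ parabolic (s |: free_of (y :: L)) k.
  apply: (parabolic_factor (hW := hW)) => //.
  by rewrite (length_parabolic_lmul hW Jk s'NJ) length_gen.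
by rewrite (parabolic_genE hW) finset.in_setU1 (negPf s'NJ) orbF => /eqP.
Qed.

Lemma clique_chain c : clique c -> exists L g,
  [/\ chain L, G g & c = [seq g * x * g^-1 | x <- chain_clique L]].
Proof.
elim: c => [_|x c IHc [/IHc[L [g [cL Gg cE]]] [t tx xjoin]]].
  by exists [::], 1; split=> //; apply: parabolic1.
have GgV : G g^-1 by apply: parabolicV.
have tx' := conjugate_of_conj GgV tx; rewrite invgK in tx'.
have [z zL|s [h [csL Jh xE]]] := extend_clique cL tx'.
  have /xjoin/joins_conj/(_ GgV) : g * z * g^-1 \in c by rewrite cE; apply: map_f.
  by rewrite invgK !mulgA mulVg mul1g mulgVK.
exists (s :: L), (g * h); split=> //; first by apply: parabolicM => //; apply: free_of_G Jh.
rewrite [chain_clique _]/= -/(chain_refl (s :: L)) map_cons; congr cons.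
  rewrite invgM !mulgA -!(mulgA g) -xE.
  by rewrite !mulgA mulgV mul1g mulgK.
rewrite cE; apply/eq_in_map => z zL.
by rewrite invgM -{1}(free_clique Jh zL) !mulgA.
Qed.

End Chains.

(** * Admissible sets are the sets of letters of chains *)

Section Admissible.
Local Open Scope group_scope.
Variables (W : groupType) (S : {fset W}) (m : S -> S -> option nat).
Hypothesis hW : coxeter_system [set: W]%classic m.
Variable T : {set S}.
Hypothesis hST : forall s t : S, s \notin T -> t \in T ->
  m s t \in [:: Some 2%N; Some 4%N; None].
Hypothesis hTT : forall t t' : S, t \in T -> t' \in T ->
  m t t' \in [:: Some 1%N; Some 2%N; None].
Implicit Types (s t u v y z : S) (L A P : seq S) (Sigma : {set S}).

Local Notation chain := (chain m T).
Local Notation head_type := (head_type T).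
Local Notation rank := (fun s : S => nat_of_ord (enum_rank s)).

Lemma chain_uniq L : chain L -> uniq L.
Proof.
elim: L => [//|s L IHL] cL; rewrite cons_uniq IHL ?(chain_tail cL) // andbT.
have mss := coxeter_mss hW s; apply/negP => sL.
have [sT|sT] := boolP (s \in T).
  by have [/allP/(_ _ sL)] := chain_head sT cL; rewrite mss.
case: L IHL cL sL => [//|y L] _ cL; have [mys /allP msL _] := chain_neighbour sT cL.
rewrite inE => /orP[/eqP sy|/msL]; last by rewrite mss.
by move: mys; rewrite -sy mss (negPf sT).
Qed.

Lemma head_typeP s L : chain (s :: L) ->
  exists t, [/\ t \in s :: L, t \in T & head_type (s :: L) = Some t].
Proof. by move=> /(chain_refl_type hW)[t [tL [tT _] ht]]; exists t. Qed.

(** The letters of the component of t, in the order of the chain. *)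
Fixpoint block t L : seq S :=
  if L is s :: L' then
    if head_type L == Some t then s :: block t L' else block t L'
  else [::].

Lemma blockE t s L : block t (s :: L) =
  if head_type (s :: L) == Some t then s :: block t L else block t L.
Proof. by []. Qed.

Lemma block_sub t L : {subset block t L <= L}.
Proof.
elim: L => [//|s L IHL] u; rewrite blockE inE.
case: ifP => _; last by move/IHL ->; rewrite orbT.
by rewrite inE => /orP[->//|/IHL ->]; rewrite orbT.
Qed.

Lemma mem_block t L : t \in T -> t \in L -> t \in block t L.
Proof.
move=> tT; elim: L => [//|s L IHL]; rewrite inE blockE => /orP[/eqP <-|/IHL tL].
  by rewrite /= tT eqxx mem_head.
by case: ifP; rewrite ?inE tL ?orbT.
Qed.

Lemma block_nil t L : chain L -> t \notin L -> block t L = [::].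
Proof.
elim: L => [//|s L IHL] cL tL; rewrite blockE.
have [t' [t'L _ ->]] := head_typeP cL.
case: eqP => [[t't]|_]; first by rewrite t't in t'L; rewrite t'L in tL.
by apply: IHL (chain_tail cL) _; apply: contra tL; rewrite inE orbC => ->.
Qed.

Lemma block_cover L s : chain L -> s \in L -> exists t, [/\ t \in L, t \in T & s \in block t L].
Proof.
elim: L => [//|v L IHL] cL; rewrite inE => /orP[/eqP ->|sL].
  have [t [tL tT ht]] := head_typeP cL; exists t; split=> //.
  by rewrite blockE ht eqxx mem_head.
have [t [tL tT tb]] := IHL (chain_tail cL) sL; exists t; split=> //.
  by rewrite inE tL orbT.
by rewrite blockE; case: ifP; rewrite ?inE tb ?orbT.
Qed.

Lemma block_T L t u : u \in block t L -> u \in T -> u = t.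
Proof.
elim: L => [//|v L IHL]; rewrite blockE; case: eqP => // ht.
rewrite inE => /orP[/eqP -> vT|/IHL //].
by move: ht; rewrite /= vT => -[].
Qed.

Lemma head_typeN s y L : s \notin T -> head_type [:: s, y & L] = head_type (y :: L).
Proof. by move=> /negPf sT; rewrite [LHS]/= sT. Qed.

Lemma block_head t y L : chain (y :: L) -> y \in block t (y :: L) -> head_type (y :: L) = Some t.
Proof.
move=> cL; rewrite blockE; case: eqP => // _ /block_sub yL.
by have := chain_uniq cL; rewrite cons_uniq yL.
Qed.

(** A letter that does not commute with an earlier one is its immediate successor and
    outside T, so that it belongs to the same block. *)
Lemma block_closed L t s u : chain L -> s \in block t L -> u \in L -> m s u <> Some 2%N ->
  u \in block t L.
Proof.
elim: L s u => [//|v L IHL] s u cL sb.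
have cL' := chain_tail cL.
have [->|uv] := eqVneq u v.
  move=> _ msv; have [sv|sv] := eqVneq s v; first by rewrite sv in sb.
  have sL : s \in L by have := block_sub sb; rewrite inE (negPf sv).
  have sb' : s \in block t L.
    by move: sb; rewrite blockE; case: ifP; rewrite // inE (negPf sv).
  have [vT|vT] := boolP (v \in T).
    have [/allP/(_ _ sL)/eqP mvs _ _] := chain_head vT cL.
    by rewrite (coxeter_sym hW) in msv.
  case: L IHL cL sb cL' sL sb' => [//|y L] IHL cL sb cL' sL sb'.
  have [_ mvL _] := chain_neighbour vT cL.
  move: sL; rewrite inE => /orP[/eqP sy|sL]; last by move/allP/(_ _ sL)/eqP: mvL.
  rewrite sy in sb'; rewrite blockE head_typeN // (block_head cL' sb') eqxx; exact: mem_head.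
rewrite inE (negPf uv) orFb => uL msu.
suff ub : u \in block t L by rewrite blockE; case: ifP; rewrite ?inE ub ?orbT.
have [sv|sv] := eqVneq s v; last first.
  apply: (IHL s) => //.
  by move: sb; rewrite blockE; case: ifP; rewrite // inE (negPf sv).
rewrite sv in sb msu; have [vT|vT] := boolP (v \in T).
  by have [/allP/(_ _ uL)/eqP] := chain_head vT cL.
case: L IHL cL sb cL' uL => [//|y L] IHL cL sb cL' uL.
have [_ mvL _] := chain_neighbour vT cL.
move: uL; rewrite inE => /orP[/eqP ->|uL]; last first.
  by move/allP/(_ _ uL)/eqP: mvL; rewrite (coxeter_sym hW).
by have := block_head cL sb; rewrite head_typeN // blockE => ->; rewrite eqxx mem_head.
Qed.

Lemma block_chain t L : t \in T -> chain L -> chain (block t L).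
Proof.
move=> tT; elim: L => [//|v L IHL] cL; have cL' := chain_tail cL.
have cb := IHL cL'; rewrite blockE; case: eqP => // ht.
have [vT|vT] := boolP (v \in T).
  have vt : v = t by move: ht; rewrite /= vT => -[].
  rewrite block_nil //; first by apply: chain_consT.
  by have := chain_uniq cL; rewrite cons_uniq vt => /andP[].
case: L IHL cL cL' cb ht => [|y L] IHL cL cL' cb ht; first by rewrite /= (negPf vT) in ht.
have [myv mvL _] := chain_neighbour vT cL.
rewrite head_typeN // in ht; move: cb; rewrite blockE ht eqxx => cb.
by apply: chain_consN => //; apply/allP => z /block_sub; move: z; apply/allP.
Qed.

Lemma block_connect t L Sigma s : {subset L <= Sigma} -> t \in T -> chain L -> s \in block t L ->
  connect (dynkin_edge m Sigma) t s.
Proof.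
elim: L s => [//|v L IHL] s LS tT cL.
have LS' : {subset L <= Sigma} by move=> z zL; apply: LS; rewrite inE zL orbT.
have {}IHL u := IHL u LS' tT (chain_tail cL).
rewrite blockE; case: eqP => [ht|_]; last exact: IHL.
rewrite inE => /orP[/eqP ->|]; last exact: IHL.
have [vT|vT] := boolP (v \in T).
  have -> : v = t by move: ht; rewrite /= vT => -[].
  exact: connect0.
case: L IHL LS LS' cL ht => [|y L] IHL LS LS' cL ht; first by rewrite /= (negPf vT) in ht.
rewrite head_typeN // in ht; have [myv _ _] := chain_neighbour vT cL.
apply: connect_trans (IHL y _) _; first by rewrite blockE ht eqxx mem_head.
apply: connect1; rewrite /dynkin_edge LS' ?mem_head // LS ?mem_head //= myv.
apply/andP; split; last by case: (y \in T).
by have := chain_uniq cL; rewrite cons_uniq inE eq_sym negb_or => /andP[/andP[]].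
Qed.

(** The blocks are connected, as consecutive letters do not commute, and they are closed
    under the edges of the Dynkin diagram. *)
Lemma component_chain t L : t \in T -> chain L ->
  dynkin_component m [set s in L] t = [set s in block t L].
Proof.
move=> tT cL; rewrite /dynkin_component inE; case: ifP => tL; last first.
  by rewrite block_nil ?tL //; apply/setP => s; rewrite !inE.
apply/setP => s; rewrite !inE; apply/idP/idP => [|sb]; last first.
  by apply: block_connect sb => // u uL; rewrite inE.
have walk p : forall u, path (dynkin_edge m [set s in L]) u p -> u \in block t L ->
    last u p \in block t L.
  elim: p => [//|v p IHp] u /= /andP[/and4P[_ vL _ /eqP muv] pth] ub.
  by apply: IHp pth _; apply: block_closed ub _ muv; rewrite // inE in vL.
by case/connectP => p pth ->; apply: walk pth (mem_block tT tL).
Qed.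

Lemma chain_type_B t L : chain L -> t \in L -> (forall u, u \in L -> u \in T -> u = t) ->
  ohead (rev L) = Some t /\
  forall i j, (i < j < size L)%N -> m (nth t (rev L) i) (nth t (rev L) j) =
    Some (if j == i.+1 then if i == 0%N then 4%N else 3%N else 2%N).
Proof.
elim: L => [//|v L IHL] cL tL Tt; have cL' := chain_tail cL.
case: L IHL cL tL Tt cL' => [|y L] IHL cL tL Tt cL'.
  have [t' [t'L _ _]] := head_typeP cL; split; first by move: tL; rewrite !inE => /eqP ->.
  by move=> i [|j] /andP[].
have [t' [t'L t'T _]] := head_typeP cL'.
have t't : t' = t by apply: Tt => //; rewrite inE t'L orbT.
rewrite {}t't in t'L t'T.
have vt : v != t.
  by apply: contraTneq t'L => <-; have := chain_uniq cL; rewrite cons_uniq => /andP[].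
have vT : v \notin T by apply: contra vt => vT; rewrite (Tt v) ?mem_head.
have [] := IHL cL' t'L; first by move=> u uL; apply: Tt; rewrite inE uL orbT.
have [myv mvL _] := chain_neighbour vT cL.
move=> hd IH; rewrite rev_cons; split.
  by move: hd; case: (rev (y :: L)).
move=> i j; rewrite !nth_rcons size_rev => /andP[ij jL].
have jL' : (j <= size (y :: L))%N by [].
have iL : (i < size (y :: L))%N by apply: leq_trans ij jL'.
rewrite iL; have [jlt|jge] := ltnP j (size (y :: L)); first by apply: IH; rewrite ij jlt.
have jE : j = size (y :: L) by apply/eqP; rewrite eqn_leq jL' jge.
rewrite jE eqxx nth_rev //; have [ijS|ijS] := eqVneq (size (y :: L)) i.+1.
  rewrite -ijS subnn /= myv; congr Some.
  have -> : (y \in T) = (i == 0%N); last by [].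
  apply/idP/idP => [yT|/eqP i0].
    have yt : y = t by apply: Tt => //; rewrite !inE eqxx orbT.
    case: L ijS cL' Tt {IHL cL tL t'L hd IH mvL jL jL' iL jge jE} => [[<-]//|z L] ijS cL' Tt.
    have [w [wL wT _]] := head_typeP (chain_tail cL').
    have := chain_uniq cL'; rewrite cons_uniq yt => /andP[/negP[]].
    by rewrite -(Tt w) // !inE; move: wL; rewrite inE => ->; rewrite !orbT.
  have L0 : L = [::] by case: L ijS {IHL cL tL Tt t'L hd IH mvL jL jL' iL jge jE cL'} => //= z L; rewrite i0.
  by rewrite L0 in cL'; have := cL'; rewrite /=; case: (y \in T).
rewrite -[size _]/(size L).+1 in ijS iL *; rewrite subSS.
have iL' : (i < size L)%N by rewrite ltn_neqAle -ltnS iL andbT eq_sym.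
rewrite -(subnSK iL') /=; apply/eqP; move/allP: mvL; apply.
by apply: mem_nth; rewrite ltn_subrL; case: (size L) iL'.
Qed.

Lemma component_cover L : chain L ->
  \bigcup_(t in T :&: [set s in L]) dynkin_component m [set s in L] t = [set s in L].
Proof.
move=> cL; apply/setP => s; apply/finset.bigcupP/idP => [[t]|].
  rewrite finset.in_setI => /andP[tT _]; rewrite component_chain // !inE.
  exact: block_sub.
rewrite inE => sL; have [t [tL tT sb]] := block_cover cL sL.
by exists t; rewrite ?finset.in_setI ?tT ?inE ?tL // component_chain // inE.
Qed.

Lemma Sigma0_chain L : chain L -> Sigma0 m T [set s in L] = free_of m T L.
Proof.
move=> cL; rewrite /Sigma0 /free_of; congr (perp m _ :\: T).
rewrite -[RHS](component_cover cL) (big_setID [set s in L]) /= [X in _ :|: X]big1 ?finset.setU0 //.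
move=> t; rewrite finset.in_setD => /andP[tL _].
by rewrite /dynkin_component (negPf tL).
Qed.

Lemma type_rank_chain t L : t \in T -> chain L -> type_rank m [set s in L] t = size (block t L).
Proof.
move=> tT cL; rewrite /type_rank component_chain // cardsE.
apply/card_uniqP; apply: chain_uniq; exact: block_chain.
Qed.

Lemma clique_invol (c : seq W) (x : W) : clique T c -> x \in c -> x * x = 1.
Proof.
elim: c => [//|y c IHc] [cl [t ty _]]; rewrite inE => /orP[/eqP ->|]; last exact: IHc.
exact: conjugate_of_invol hW _ _ _ ty.
Qed.

Lemma clique_commute (c : seq W) (x x' : W) : clique T c -> x \in c -> x' \in c -> x * x' = x' * x.
Proof.
elim: c => [//|z c IHc] [cl [t tz zjoin]].
rewrite !inE => /orP[/eqP ->|xc] /orP[/eqP ->|yc] //; last exact: IHc.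
  by case: (zjoin _ yc).
by case: (zjoin _ xc).
Qed.

(** The generator s = s_i exchanges e_{i-1} and e_i and fixes the later vectors; for
    e_{i+1} this is [braid_fix]. *)
Lemma chain_refl_fixed v L s : chain (v :: L) -> s \in L -> s \notin T ->
  val s * chain_refl T (v :: L) = chain_refl T (v :: L) * val s.
Proof.
elim: L v => [//|y L IHL] v cL sL sT.
have [vT|vT] := boolP (v \in T).
  have [/allP/(_ _ sL)/eqP mvs _ _] := chain_head vT cL.
  by rewrite chain_reflT // (commute_of_m2 hW mvs).
have [myv mvL cL'] := chain_neighbour vT cL.
rewrite (chain_reflN _ vT); move: sL; rewrite inE => /orP[/eqP sy|sL].
  rewrite -{y}sy in IHL cL myv cL' *.
  case: L IHL cL mvL cL' => [|z L] IHL cL mvL cL'; first by rewrite /= (negPf sT) in cL'.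
  rewrite (negPf sT) in myv; rewrite (chain_reflN _ sT).
  have vc : val v * chain_refl T (z :: L) = chain_refl T (z :: L) * val v.
    exact: gen_commute hW _ _ _ mvL (@chain_refl_parabolic _ _ T (z :: L)).
  have := braid_fix hW myv vc.
  by move: (val v * _ * val v) => e e1; rewrite -[in RHS]e1 (coxeter_sKr hW).
have /eqP msv : m s v == Some 2%N by move/allP/(_ _ sL): mvL.
have sv := commute_of_m2 hW msv.
by rewrite !mulgA sv -(mulgA (val v) (val s)) (IHL _ cL' sL sT) -!mulgA sv.
Qed.

Lemma chain_clique_stable L s x : chain L -> s \in L -> s \notin T -> x \in chain_clique T L ->
  val s * x * val s \in chain_clique T L.
Proof.
elim: L x => [//|v L IHL] x cL sL sT; have cL' := chain_tail cL.
have [sL'|sL'] := boolP (s \in L).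
  rewrite inE => /orP[/eqP ->|xL]; last by rewrite inE (IHL x cL' sL' sT xL) orbT.
  by rewrite (chain_refl_fixed cL sL' sT) (coxeter_sKr hW) mem_head.
have sv : s = v by move: sL; rewrite inE (negPf sL') orbF => /eqP.
rewrite -{v sL}sv in cL *.
case: L IHL cL cL' sL' => [|y L] IHL cL cL' sL'; first by rewrite /= (negPf sT) in cL.
have [_ msL _] := chain_neighbour sT cL.
rewrite inE => /orP[/eqP ->|].
  rewrite chain_reflN // !mulgA (coxeter_ss hW) mul1g (coxeter_sKr hW).
  by rewrite inE mem_head orbT.
rewrite inE => /orP[/eqP ->|xL]; first by rewrite -(chain_reflN _ sT) mem_head.
rewrite (gen_commute hW msL (chain_clique_parabolic xL)) (coxeter_sKr hW).
by rewrite !inE xL !orbT.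
Qed.

Hypothesis hfin : finite_set (parabolic (~: T)).

(** The reflections of the clique generate a finite elementary abelian group F, which the
    letters outside T normalize, and these letters generate a subgroup K of the finite
    group G. So the parabolic subgroup is F K. *)
Lemma chain_finite L : chain L -> finite_set (parabolic [set s in L]).
Proof.
move=> cL; set c := chain_clique T L; have clc : clique T c := chain_cliqueP hW hST hTT cL.
set F := generated [set` c]%classic; set K := parabolic ([set s in L] :\: T).
have fF : finite_set F.
  apply: commuting_generated_finite => [x|x y]; first exact: clique_invol.
  exact: clique_commute.
have fK : finite_set K.
  apply: sub_finite_set hfin => w; apply: parabolicS; apply/fintype.subsetP => s.
  by rewrite !inE => /andP[].
have [F1 FM FV] := generated_subgroup [set` c]%classic; rewrite -/F in F1 FM FV.
have [K1 KM KV] := generated_subgroup [set val s | s in [set` [set s in L] :\: T]]%classic.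
rewrite -/K in K1 KM KV.
have normF (g : W) : K g -> forall f, F f -> F (g * f * g^-1) /\ F (g^-1 * f * g).
  pose N := [set g | forall f, F f -> F (g * f * g^-1) /\ F (g^-1 * f * g)]%classic.
  apply: (@generated_min _ _ N).
    split=> [f Ff|x x' Nx Ny f Ff|x Nx f Ff] /=; first by rewrite invg1 !mul1g !mulg1.
      split; first by have [] := Nx _ (proj1 (Ny _ Ff)); rewrite invgM !mulgA.
      by have [_] := Ny _ (proj2 (Nx _ Ff)); rewrite invgM !mulgA.
    by rewrite invgK; have [] := Nx _ Ff.
  move=> _ [s /= + <-]; rewrite !inE => /andP[sT sL] f Ff; rewrite (coxeter_sV hW).
  suff : F (val s * f * val s) by [].
  have sub := conjg_subgroup (val s) (generated_subgroup [set` c]%classic).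
  rewrite -{2}(coxeter_sV hW s); apply: (generated_min sub _ Ff) => x /= xc.
  by apply: generated_in; rewrite /= (coxeter_sV hW); apply: chain_clique_stable.
apply: (@sub_finite_set _ _ [set f * g | f in F & g in K]%classic); last first.
  exact: finite_image2.
apply: generated_min.
  split; first by exists 1 => //; exists 1; rewrite ?mulg1.
    move=> _ _ [f Ff [g Kg <-]] [f' Ff' [g' Kg' <-]].
    exists (f * (g * f' * g^-1)); first by apply: FM => //; case: (normF g Kg f' Ff').
    by exists (g * g'); [apply: KM | rewrite !mulgA mulgVK].
  move=> _ [f Ff [g Kg <-]]; exists (g^-1 * f^-1 * g).
    by case: (normF g Kg f^-1) => //; apply: FV.
  by exists g^-1; [apply: KV | rewrite mulgK invgM].
move=> _ [s /= sL <-]; have [sT|sT] := boolP (s \in T); last first.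
  exists 1 => //; exists (val s); last by rewrite mul1g.
  by apply: parabolic_gen; rewrite !inE sT; move: sL; rewrite inE.
exists (val s); last by exists 1; rewrite ?mulg1.
apply: generated_in; rewrite /= /c; move: sL; rewrite inE.
elim: L {cL c clc F K fF fK F1 FM FV K1 KM KV normF} => [//|v L IHL].
rewrite inE => /orP[/eqP <-|/IHL sL]; last by rewrite /= inE sL orbT.
by rewrite -(chain_reflT L sT) mem_head.
Qed.

Lemma chain_admissible L : chain L -> admissible m T [set s in L].
Proof.
move=> cL; split; [exact: chain_finite | by rewrite component_cover |].
move=> t; rewrite finset.in_setI inE => /andP[tT tL].
rewrite component_chain //; have cb := block_chain tT cL.
have tb := mem_block tT tL.
have Tb u : u \in block t L -> u \in T -> u = t := @block_T L t u.
have [hd rel] := chain_type_B cb tb Tb; split.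
  exists (rev (block t L)); split=> //.
  - by rewrite rev_uniq; apply: chain_uniq.
  - by move=> s; rewrite mem_rev inE.
  - by move=> i j; rewrite size_rev; apply: rel.
apply/setP => u; rewrite !inE; apply/andP/eqP => [[ub uT]|->]; first exact: Tb.
by split.
Qed.

Lemma chain_sep A y P z p : chain (A ++ y :: P) -> z \in A -> p \in P -> m p z = Some 2%N.
Proof.
elim: A => [//|v A IHA] cA; have cA' := chain_tail cA.
rewrite inE => /orP[/eqP ->|zA] pP; last exact: IHA cA' zA pP.
have [vT|vT] := boolP (v \in T).
  have [/allP mv _ _] := chain_head vT cA; rewrite (coxeter_sym hW); apply/eqP/mv.
  by rewrite mem_cat inE pP !orbT.
case: A {IHA cA'} cA => [|u A] cA; have [_ /allP mv _] := chain_neighbour vT cA; apply/eqP/mv => //.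
by rewrite mem_cat inE pP !orbT.
Qed.

Lemma chain_rank A y P z : chain (A ++ y :: P) -> z \in A -> z \in T -> y \in T ->
  (rank y < rank z)%N.
Proof.
elim: A => [//|v A IHA] cA; have cA' := chain_tail cA.
rewrite inE => /orP[/eqP ->|zA] zT yT; last exact: IHA.
have [_ /allP/(_ y) + _] := chain_head zT cA.
by rewrite yT mem_cat inE eqxx orbT => /(_ isT).
Qed.

Lemma chain_cat_tail A P : chain (A ++ P) -> chain P.
Proof. by elim: A => [//|v A IHA] /chain_tail. Qed.

(** Compare the chains from the first letter on, after a common part P. If y and y' are the
    next letters and differ, each of them occurs later in the other chain. A letter outside
    T does not commute with the last letter of P, but would have to in the other chain; and
    two letters of T would occur in both orders. *)
Lemma chain_eq_cat A A' P : chain (A ++ P) -> chain (A' ++ P) -> A ++ P =i A' ++ P -> A = A'.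
Proof.
elim/last_ind: A A' P => [|A y IHA] A' P.
  case: A' => [//|y A'] _ /chain_uniq + e; rewrite /= => /andP[/negP[]].
  by rewrite mem_cat -[y \in P]/(y \in [::] ++ P) e mem_head orbT.
case/lastP: A' => [|A' y'] cA cA' e.
  have := chain_uniq cA; rewrite cat_rcons cat_uniq /= negb_or => /and4P[_ /andP[_ _] yP _].
  by case/negP: yP; rewrite -[y \in P]/(y \in [::] ++ P) -e cat_rcons mem_cat mem_head orbT.
have uA := chain_uniq cA; have uA' := chain_uniq cA'.
rewrite !cat_rcons in cA cA' e uA uA'.
have key B z B' z' : chain (B ++ z :: P) -> chain (B' ++ z' :: P) ->
    B ++ z :: P =i B' ++ z' :: P -> z != z' -> z \in T /\ z \in B'.
  move=> cB cB' eB zz'.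
  have zB' : z \in B'.
    have : z \in B' ++ z' :: P by rewrite -eB mem_cat mem_head orbT.
    rewrite mem_cat inE (negPf zz') /= => /orP[//|zP].
    by have := chain_uniq (chain_cat_tail cB); rewrite /= zP.
  split=> //; apply: contraT => zT.
  have cz := chain_cat_tail cB.
  have [p [P' PE]] : exists p P', P = p :: P'.
    by case: (P) cz => [|p P']; [rewrite /= (negPf zT) | exists p, P'].
  rewrite PE in cz cB'; have [mpz _ _] := chain_neighbour zT cz.
  have := chain_sep cB' zB' (mem_head _ _); rewrite mpz.
  by case: (p \in T).
have yy' : y = y'.
  apply/eqP; apply: contraT => yy'.
  have ynsy : y' != y by rewrite eq_sym.
  have [yT yA'] := key _ _ _ _ cA cA' e yy'.
  have [y'T y'A] := key _ _ _ _ cA' cA (fun z => esym (e z)) ynsy.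
  have := chain_rank cA y'A y'T yT; rewrite ltnNge ltnW //.
  exact: chain_rank cA' yA' yT y'T.
by rewrite -yy' in cA' e *; rewrite (IHA _ _ cA cA' e).
Qed.

Lemma chain_unique L L' : chain L -> chain L' -> [set s in L] = [set s in L'] -> L = L'.
Proof.
move=> cL cL' e; apply: (@chain_eq_cat _ _ [::]); rewrite ?cats0 // => s.
by have := congr1 (fun A : {set S} => s \in A) e; rewrite !inE.
Qed.

(** Concatenate the listings of the components, in the order of their distinguished
    generators. Letters of different components commute, as each component contains only
    one element of T. *)
Lemma admissible_chain Sigma : admissible m T Sigma -> exists2 L, chain L & [set s in L] = Sigma.
Proof.
move=> [_ SigmaE compP].
pose C t := dynkin_component m Sigma t.
have compSub t s : s \in C t -> s \in Sigma.
  rewrite /C /dynkin_component; case: ifP => tS; rewrite !inE // => /connectP[p pth ->].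
  by elim: p t tS pth => [//|u p IHp] t tS /= /andP[/and4P[_ uS _ _]]; apply: IHp.
have separate t t' s s' : t \in T :&: Sigma -> t' \in T :&: Sigma -> t != t' ->
    s \in C t -> s' \in C t' -> m s s' = Some 2%N.
  move=> tTS t'TS tt' sC s'C; apply/eqP; apply: contraT => mss'.
  have edge_sym : connect_sym (dynkin_edge m Sigma).
    apply: sym_connect_sym => u v; rewrite /dynkin_edge (coxeter_sym hW) eq_sym andbCA.
    by [].
  have [tT tS] : t \in T /\ t \in Sigma by apply/andP; rewrite -finset.in_setI.
  have [t'T t'S] : t' \in T /\ t' \in Sigma by apply/andP; rewrite -finset.in_setI.
  have cs : connect (dynkin_edge m Sigma) t s by move: sC; rewrite /C /dynkin_component tS inE.
  have cs' : connect (dynkin_edge m Sigma) t' s' by move: s'C; rewrite /C /dynkin_component t'S inE.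
  have css' : connect (dynkin_edge m Sigma) s s'.
    have [->|ss'] := eqVneq s s'; first exact: connect0.
    by apply: connect1; rewrite /dynkin_edge (compSub _ _ sC) (compSub _ _ s'C) ss'.
  have t'C : t' \in C t.
    rewrite /C /dynkin_component tS inE; apply: connect_trans cs _.
    by apply: connect_trans css' _; rewrite edge_sym.
  have [_ CT] := compP t tTS.
  have : t' \in C t :&: T by rewrite finset.in_setI t'C.
  by rewrite CT inE eq_sym (negPf tt').
suff main ts : uniq ts -> sorted (fun a b => rank b <= rank a)%N ts -> {subset ts <= T :&: Sigma} ->
    exists2 L, chain L & forall s, s \in L <-> exists2 t, t \in ts & s \in C t.
  have [||t|L cL LP] := main (sort (fun a b => rank b <= rank a)%N (enum (T :&: Sigma))).
  - by rewrite sort_uniq enum_uniq.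
  - by apply: sort_sorted => a b; apply: leq_total.
  - by rewrite mem_sort mem_enum.
  exists L => //; apply/setP => s; rewrite inE [in RHS]SigmaE; apply/idP/finset.bigcupP => [/LP[t tTS sC]|[t tTS sC]].
    by exists t => //; rewrite mem_sort mem_enum in tTS.
  by apply/LP; exists t => //; rewrite mem_sort mem_enum.
elim: ts => [_ _ _|t ts IHts uts sts tsS].
  by exists [::] => // s; split=> // -[].
have [||u uts'|L cL LP] := IHts; first by case/andP: uts.
- exact: path_sorted sts.
- by apply: tsS; rewrite inE uts' orbT.
have tTS : t \in T :&: Sigma by apply: tsS; apply: mem_head.
have [[r [ur rC hr rel]] CT] := compP t tTS.
have tT : t \in T by move: tTS; rewrite finset.in_setI => /andP[].
have rankts t' : t' \in ts -> (rank t' < rank t)%N.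
  have tr : transitive (fun a b : S => rank b <= rank a)%N by move=> a b c ba ca; apply: leq_trans ca ba.
  have /allP := order_path_min tr sts; move=> le t'ts.
  rewrite ltn_neqAle le // andbT; apply: contraTneq t'ts => /rank_inj ->.
  by case/andP: uts.
have rT i : (i < size r)%N -> (nth t r i \in T) = (i == 0%N).
  move=> ir; have : nth t r i \in C t by rewrite -rC mem_nth.
  move=> nC; have -> : (nth t r i \in T) = (nth t r i \in C t :&: T) by rewrite finset.in_setI nC.
  rewrite CT inE; have t0 : nth t r 0 = t by case: (r) hr => [|? ?] //= [].
  by rewrite -[X in _ == X]t0 nth_uniq // (leq_ltn_trans _ ir).
have rL i z : (i < size r)%N -> z \in L -> m (nth t r i) z = Some 2%N.
  move=> ir /LP[t' t'ts zC]; apply: (@separate t t') => //.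
  - by apply: tsS; rewrite inE t'ts orbT.
  - by apply: contraTneq t'ts => <-; case/andP: uts.
  - by rewrite /C -rC mem_nth.
have chain_take k : (k <= size r)%N -> chain (rev (take k r) ++ L).
  elim: k => [|k IHk] kr; first by rewrite take0.
  rewrite (take_nth t kr) rev_rcons cat_cons.
  have [k0|k0] := eqVneq k 0%N.
    rewrite k0 take0 /= in IHk *; rewrite k0 in kr.
    apply: chain_consT; rewrite ?rT //.
      by apply/allP => z zL; rewrite rL.
    apply/allP => z zL; apply/implyP => zT.
    have [t' t'ts zC] := iffLR (LP _) zL.
    have -> : nth t r 0 = t by case: (r) hr => [|? ?] //= [].
    have zt' : z \in C t' :&: T by rewrite finset.in_setI zC.
    have [_ CT'] := compP t' (tsS _ (mem_behead (s := t :: ts) t'ts)).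
    by move: zt'; rewrite CT' inE => /eqP ->; apply: rankts.
  have kE : k = k.-1.+1 by rewrite prednK // lt0n.
  have k1r : (k.-1 < size r)%N by rewrite -kE ltnW.
  have := IHk (ltnW kr); rewrite kE (take_nth t k1r) rev_rcons cat_cons -kE => cK.
  apply: chain_consN => //; first by rewrite rT.
    by rewrite rel -?kE ?leqnn ?kr // eqxx rT.
  apply/allP => z; rewrite mem_cat mem_rev => /orP[zr|zL]; last first.
    by rewrite (coxeter_sym hW) rL.
  have [i ik <-] : exists2 i, (i < k.-1)%N & nth t r i = z.
    have /(nthP t)[i] := zr; rewrite size_take k1r => ik; rewrite nth_take // => <-; by exists i.
  rewrite rel; last by rewrite kr andbT (leq_trans ik) // leq_pred.
  by rewrite ifN // gtn_eqF // kE ltnS.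
exists (rev r ++ L); first by rewrite -{1}(take_size r); apply: chain_take.
move=> s; rewrite mem_cat mem_rev rC; split=> [/orP[sC|/LP[t' t'ts sC]]|[t']].
- by exists t; rewrite ?mem_head.
- by exists t'; rewrite ?inE ?t'ts ?orbT.
- by rewrite inE => /orP[/eqP ->|t'ts] sC; rewrite ?sC //; apply/orP; right; apply/LP; exists t'.
Qed.

End Admissible.

(** * The nerve, and the count of its simplices *)

Lemma seq_argmax (X : eqType) (f : X -> nat) (x0 : X) (s0 : seq X) :
  exists2 xm, xm \in x0 :: s0 & forall y, y \in x0 :: s0 -> (f y <= f xm)%N.
Proof.
elim: s0 x0 => [|x1 s1 IHs] x0.
  by exists x0; rewrite ?mem_head // => y; rewrite inE => /eqP ->.
have [xm xms le] := IHs x1.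
have [le0|lt0] := leqP (f x0) (f xm).
  exists xm; first by rewrite inE xms orbT.
  by move=> y; rewrite inE => /orP[/eqP ->|/le].
exists x0; first exact: mem_head.
move=> y; rewrite inE => /orP[/eqP -> //|/le yxm].
by apply: leq_trans yxm (ltnW lt0).
Qed.

(** In a sorted list the head is any of the k elements of the type of largest rank, and
    the tail is a sorted ordering of the others; so k (k - 1)! = k! comes out. *)
Lemma count_sorted_permutations (X : eqType) (K : finType) (tp : X -> K) (rk : K -> nat)
    (s : seq X) : injective rk -> uniq s ->
  count (sorted (fun x y => rk (tp y) <= rk (tp x))%N) (permutations s) =
  (\prod_(t : K) (count (fun x => tp x == t) s)`!)%N.
Proof.
move=> rk_inj; have [n] := ubnP (size s); elim: n s => // n IHn [|x0 s0] sn us.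
  by rewrite big1.
set s := x0 :: s0 in sn us *; set r := (fun x y : X => rk (tp y) <= rk (tp x))%N.
have rtr : transitive r by move=> y x z xy yz; apply: leq_trans yz xy.
have [xm xms xmax] : exists2 xm, xm \in s & forall y, y \in s -> (rk (tp y) <= rk (tp xm))%N.
  exact: seq_argmax (rk \o tp) x0 s0.
have spos : (0 < size s)%N by [].
clearbody s.
have typ x : x \in s -> all (r x) s = (tp x == tp xm).
  move=> xs; apply/allP/eqP => [le|e y ys]; last by rewrite /r e; apply: xmax.
  by apply: rk_inj; apply/eqP; rewrite eqn_leq xmax //; apply: le.
have /permP -> : perm_eq (permutations s) [seq x :: t | x <- undup s, t <- permutations (rem x s)].
  exact: permutationsE spos.
rewrite undup_id // count_flatten -map_comp sumnE big_map.
have termE x : x \in s -> count (sorted r) [seq x :: t | t <- permutations (rem x s)] =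
    if tp x == tp xm then (\prod_(t : K) (count (fun y => tp y == t) (rem x s))`!)%N else 0%N.
  move=> xs; rewrite count_map -typ //.
  have remx : perm_eq s (x :: rem x s) := perm_to_rem xs.
  transitivity (if all (r x) s then count (sorted r) (permutations (rem x s)) else 0%N).
    rewrite -[if _ then _ else _]/(if all (r x) s then _ else _).
    transitivity (count (fun t => all (r x) s && sorted r t) (permutations (rem x s))).
      apply: eq_in_count => t; rewrite mem_permutations => pt /=.
      rewrite path_sortedE //; congr andb.
      rewrite (perm_all _ pt); transitivity (all (r x) (x :: rem x s)).
        by rewrite /= {2}/r leqnn.
      by apply/esym; apply: perm_all remx.
    by case: (all (r x) s) => //=; rewrite -(count_pred0 (permutations (rem x s))); apply: eq_count.
  case: all => //; apply: IHn; last by apply: rem_uniq.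
  by rewrite size_rem // -ltnS prednK.
set t0 := tp xm in typ termE.
have cnt0 : (0 < count (fun y => tp y == t0) s)%N.
  by rewrite -has_count; apply/hasP; exists xm.
have remE x : x \in s -> tp x = t0 -> (\prod_t (count (fun y => tp y == t) (rem x s))`! =
    (count (fun y => tp y == t0) s).-1`! *
    \prod_(t | t != t0) (count (fun y => tp y == t) s)`!)%N.
  move=> xs xt; rewrite (bigD1 t0) //=; congr muln.
    by rewrite count_rem xs /= xt eqxx subn1.
  by apply: eq_bigr => t /negPf tt0; rewrite count_rem xs /= xt eq_sym tt0 subn0.
rewrite big_seq (eq_bigr _ termE) -big_seq -big_mkcond /=.
rewrite big_seq_cond (eq_bigr (fun=> 1 * ((count (fun y => tp y == t0) s).-1`! *
    \prod_(t | t != t0) (count (fun y => tp y == t) s)`!))%N); last first.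
  by move=> x /andP[xs /eqP xt]; rewrite mul1n remE.
rewrite -big_seq_cond -big_distrl /= sum1_count mulnA [RHS](bigD1 t0) //=; congr muln.
by rewrite -[in RHS](prednK cnt0) factS prednK.
Qed.

Section Nerve.
Local Open Scope group_scope.
Variables (W : groupType) (S : {fset W}) (m : S -> S -> option nat).
Hypothesis hW : coxeter_system [set: W]%classic m.
Variable T : {set S}.
Hypothesis hST : forall s t : S, s \notin T -> t \in T ->
  m s t \in [:: Some 2%N; Some 4%N; None].
Hypothesis hTT : forall t t' : S, t \in T -> t' \in T ->
  m t t' \in [:: Some 1%N; Some 2%N; None].
Hypothesis hfin : finite_set (parabolic (~: T)).
Implicit Types (s t u v : S) (L : seq S) (Sigma : {set S}).

Local Notation X := (conjugate_generators T).
Local Notation G := (parabolic (~: T)).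
Local Notation rank := (fun s : S => nat_of_ord (enum_rank s)).

(** Conjugation by h reduces this to [finite_order_classification]. *)
Lemma torsion_commute t u g h n : t \in T -> u \in T -> G g -> G h -> (0 < n)%N ->
    (g * val t * g^-1 * (h * val u * h^-1)) ^+ n = 1 ->
  g * val t * g^-1 * (h * val u * h^-1) = h * val u * h^-1 * (g * val t * g^-1).
Proof.
move=> tT uT Gg Gh n0 xyn.
have Gk : G (h^-1 * g) by apply: parabolicM => //; apply: parabolicV.
suff com : commute ((h^-1 * g) * val t * (h^-1 * g)^-1) (val u).
  have conj : g * val t * g^-1 = h * ((h^-1 * g) * val t * (h^-1 * g)^-1) * h^-1.
    by rewrite invgM invgK !mulgA mulgV mul1g mulgK.
  by rewrite conj; apply: commute_conj.
have [->|/eqP xu] := eqVneq ((h^-1 * g) * val t * (h^-1 * g)^-1) (val u).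
  exact: commute_refl.
have xyn' : ((h^-1 * g) * val t * (h^-1 * g)^-1 * val u) ^+ n = 1.
  have e : (h^-1 * g) * val t * (h^-1 * g)^-1 * val u
      = (g * val t * g^-1 * (h * val u * h^-1)) ^ h.
    by rewrite conjgE invgM invgK !mulgA mulgVK.
  by rewrite e -conjXg xyn conj1g.
have conjE k p : stabilizer_of m T t ((h^-1 * g)^-1 * p) -> k = p ->
    (h^-1 * g) * val t * (h^-1 * g)^-1 = k * val t * k^-1.
  by move=> Pp ->; rewrite -(conj_stabilizer hW (h^-1 * g) Pp) mulVKg.
have [] := finite_order_classification hW hST hTT tT uT Gk xu n0 xyn'.
  move=> [_ mtu [k Pk /conjE/(_ erefl) ->]].
  have uE : val u = k * val u * k^-1.
    by rewrite (stabilizer_commute hW Pk) mulgK.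
  by rewrite uE; apply: commute_conj; apply: commute_of_m2 hW _ _ mtu.
move=> [tu [s [k [_ mst Pk /conjE/(_ erefl) ->]]]]; rewrite -tu.
have tE : val t = k * val t * k^-1 by rewrite (stabilizer_commute hW Pk) mulgK.
have -> : k * val s * val t * (k * val s)^-1 = k * (val s * val t * val s) * k^-1.
  by rewrite invgM (coxeter_sV hW) !mulgA.
rewrite {2}tE; apply: commute_conj.
by rewrite /commute !mulgA (braid_of_m4 hW mst).
Qed.

Lemma conjugate_ofX (x : X) : exists t : {t | t \in T}, conjugate_of T (val t) (val x).
Proof.
by have [t [g [tT Gg xE]]] := conjugate_valP hfin x; exists (Sub t tT); split=> //; exists g.
Qed.

Lemma conjugate_of_in t (x : W) : conjugate_of T t x -> x \in X.
Proof. by move=> [tT [g Gg ->]]; apply/(in_conjugates hfin); exists t, g. Qed.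

(** Commuting involutions generate a finite group; conversely a product of two elements of
    a finite group has finite order, so that the factors commute. *)
Lemma nerveP (U : {set X}) :
  U \in nerve X <-> (forall x y : X, x \in U -> y \in U -> val x * val y = val y * val x).
Proof.
rewrite inE; split=> [/asboolP fU x y xU yU|Ucom].
  have [t [g [tT Gg xE]]] := conjugate_valP hfin x.
  have [u [h [uT Gh yE]]] := conjugate_valP hfin y.
  have sU : is_subgroup (parabolic U) by apply: generated_subgroup.
  have Uxy : parabolic U (val x * val y).
    by apply: parabolicM; apply: parabolic_gen.
  have [n n0] := finite_subgroup_torsion sU fU Uxy.
  by rewrite xE yE; apply: torsion_commute.
apply/asboolP.
have -> : parabolic U = generated [set` [seq val x | x <- enum U]]%classic.
  congr generated; apply/seteqP; split=> [_ [x /= xU <-]|z /= /mapP[x]].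
    by rewrite /=; apply: map_f; rewrite mem_enum.
  by rewrite mem_enum => xU ->; exists x.
apply: commuting_generated_finite.
  move=> _ /mapP[x _ ->]; have [t tx] := conjugate_ofX x.
  exact: conjugate_of_invol hW _ _ _ tx.
move=> _ _ /mapP[x + ->] /mapP[y + ->]; rewrite !mem_enum; exact: Ucom.
Qed.

End Nerve.

Section Counting.
Local Open Scope ring_scope.
Variables (W : groupType) (S : {fset W}) (m : S -> S -> option nat).
Hypothesis hW : coxeter_system [set: W]%classic m.
Variable T : {set S}.
Hypothesis hST : forall s t : S, s \notin T -> t \in T ->
  m s t \in [:: Some 2%N; Some 4%N; None].
Hypothesis hTT : forall t t' : S, t \in T -> t' \in T ->
  m t t' \in [:: Some 1%N; Some 2%N; None].
Hypothesis hfin : finite_set (parabolic (~: T)).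

Local Notation X := (conjugate_generators T).
Local Notation G := (parabolic (~: T)).
Local Notation rank := (fun s : S => nat_of_ord (enum_rank s)).
Local Notation typ := {t : S | t \in T}.

Variable tp : X -> typ.
Hypothesis tpP : forall x, conjugate_of T (val (tp x)) (val x).
Variables (I : choiceType) (phi : typ -> I).

Implicit Types (c : seq X) (L : seq S) (Sigma : {set S}) (t : typ).

Definition type_ge (x y : X) := (rank (val (tp y)) <= rank (val (tp x)))%N.

Lemma type_ge_trans : transitive type_ge.
Proof. by move=> y x z xy yz; apply: leq_trans yz xy. Qed.

Lemma tp_eq (x : X) t : (tp x == t) = `[< conjugate_of T (val t) (val x) >].
Proof.
apply/eqP/asboolP => [<-//|tx]; apply/val_inj.
exact: (conjugate_of_uniq hW hST hTT (tpP x) tx).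
Qed.

Lemma clique_ordered c : clique T (map val c) <->
  [/\ uniq c, {in c &, forall x y : X, (val x * val y = val y * val x)%g} & sorted type_ge c].
Proof.
elim: c => [|x c IHc]; first by split.
rewrite [sorted _ _]/= path_sortedE; last exact: type_ge_trans.
split=> [[/IHc[uc cc sc] [t tx xjoin]]|[/andP[xc uc] cc /andP[xle sc]]].
  have join y : y \in c -> joins T t (val x) (val y) by move=> yc; apply: xjoin; apply: map_f.
  split.
  - rewrite cons_uniq uc andbT; apply/negP => /join[]; by case.
  - move=> y z; rewrite !inE => /orP[/eqP ->|yc] /orP[/eqP ->|zc] //; last exact: cc.
      by have [_ ->] := join _ zc.
    by have [_ ->] := join _ yc.
  - rewrite sc andbT; apply/allP => y /join[_ _ [t' t'y rt]].
    rewrite /type_ge (conjugate_of_uniq hW hST hTT (tpP y) t'y).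
    by rewrite (conjugate_of_uniq hW hST hTT (tpP x) tx).
split; first by apply/IHc; split=> // y z yc zc; apply: cc; rewrite inE ?yc ?zc orbT.
exists (val (tp x)) => // _ /mapP[y yc ->]; split.
- by move=> /val_inj yx; rewrite -yx yc in xc.
- by apply: cc; rewrite inE ?eqxx // yc orbT.
- by exists (val (tp y)) => //; move/allP: xle => /(_ _ yc).
Qed.

Definition ordered_cliques : seq (seq X) :=
  [seq c | sigma <- enum (nerve X), c <- [seq c <- permutations (enum (sigma : {set X})) | sorted type_ge c]].

Lemma mem_ordered_cliques c : c \in ordered_cliques <-> clique T (map val c).
Proof.
rewrite clique_ordered; split.
  move=> /allpairsPdep[sigma [c' []]]; rewrite mem_enum mem_filter mem_permutations.
  move=> /(nerveP hW hST hTT hfin) com /andP[sc pc] ->; split=> //.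
    by rewrite (perm_uniq pc) enum_uniq.
  by move=> x y; rewrite !(perm_mem pc) !mem_enum; apply: com.
move=> [uc cc sc]; apply/allpairsPdep; exists [set x in c], c; split=> //.
  rewrite mem_enum; apply/(nerveP hW hST hTT hfin) => x y; rewrite !inE; exact: cc.
rewrite mem_filter sc mem_permutations; apply: uniq_perm => //; first exact: enum_uniq.
by move=> x; rewrite mem_enum inE.
Qed.

Lemma ordered_cliques_uniq : uniq ordered_cliques.
Proof.
apply: allpairs_uniq_dep; first exact: enum_uniq.
  by move=> sigma _; apply: filter_uniq; apply: permutations_uniq.
move=> [sigma c] [sigma' c'] /allpairsPdep[s1 [c1 [_ c1s e]]] /allpairsPdep[s2 [c2 [_ c2s e']]] /= cc'.
have e1 : sigma = s1 := congr1 (@tag _ (fun=> seq X)) e.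
have e2 : c = c1 := congr1 (fun p : {_ : {set X} & seq X} => tagged p) e.
have e1' : sigma' = s2 := congr1 (@tag _ (fun=> seq X)) e'.
have e2' : c' = c2 := congr1 (fun p : {_ : {set X} & seq X} => tagged p) e'.
move: c1s c2s; rewrite !mem_filter !mem_permutations -e1 -e2 -e1' -e2' -cc'.
move=> /andP[_ p1] /andP[_ p2]; congr existT; apply/setP => x.
by rewrite -[LHS]mem_enum -[RHS]mem_enum -(perm_mem p1) -(perm_mem p2).
Qed.

Definition type_count t c : nat := count (fun x => tp x == t) c.

Definition weighted_monomial (k : typ -> nat) : {malg rat[{cmonom I}]} :=
  \prod_t (((k t)`!)%:R^-1 *: indet (phi t) ^+ k t).

Lemma weighted_monomialE (k : typ -> nat) :
  (\prod_t (k t)`!)%N%:R *: weighted_monomial k = \prod_t indet (phi t) ^+ k t.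
Proof.
rewrite /weighted_monomial scaler_prod scalerA natr_prod -big_split big1 ?scale1r //=.
by move=> t _; rewrite mulfV // pnatr_eq0 -lt0n fact_gt0.
Qed.

Lemma type_monomialE c :
  \prod_(x <- c) indet (phi (tp x)) = \prod_t indet (phi t) ^+ type_count t c.
Proof.
rewrite (partition_big tp predT) //=; apply: eq_bigr => t _.
rewrite (eq_bigr (fun=> indet (phi t))) => [|x /eqP -> //].
by rewrite big_const_seq iter_mulr_1.
Qed.

(** The prod_t k(t)! sorted orderings of a simplex cancel the denominators. *)
Lemma sum_ordered_cliques :
  \sum_(c <- ordered_cliques) weighted_monomial (type_count^~ c) =
  f_polynomial (nerve X) (phi \o tp).
Proof.
rewrite big_allpairs_dep /= /f_polynomial -[RHS]big_enum /=; apply: eq_bigr => sigma _.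
rewrite big_filter big_seq_cond.
rewrite (eq_bigr (fun=> weighted_monomial (type_count^~ (enum sigma)))); last first.
  move=> c /andP[]; rewrite mem_permutations => /permP pc _.
  by congr weighted_monomial; apply: funext => t; apply: pc.
rewrite -big_seq_cond big_const_seq iter_addr_0 -scaler_nat.
have rinj : injective (fun t : typ => rank (val t)) by move=> t u /rank_inj /val_inj.
rewrite (count_sorted_permutations tp rinj (enum_uniq _)).
by rewrite weighted_monomialE -type_monomialE big_enum.
Qed.

Lemma clique_conj (g : W) (c : seq W) : G g -> clique T c ->
  clique T [seq (g * x * g^-1)%g | x <- c].
Proof.
move=> Gg; elim: c => [//|x c IHc] [/IHc cl [t tx xjoin]]; split=> //.
exists t => [|_ /mapP[z zc ->]]; first exact: conjugate_of_conj.
exact: joins_conj (xjoin _ zc) Gg.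
Qed.

Lemma clique_lift (c : seq W) : clique T c -> exists c' : seq X, map val c' = c.
Proof.
elim: c => [|x c IHc]; first by exists [::].
move=> [/IHc[c' <-] [t /(conjugate_of_in hfin) xX _]].
by exists ([` xX]%fset :: c').
Qed.

Definition conjugate_by L c (g : W) : Prop :=
  G g /\ map val c = [seq (g * x * g^-1)%g | x <- chain_clique T L].

Lemma conjugate_by_clique L c g : chain m T L -> conjugate_by L c g -> c \in ordered_cliques.
Proof.
move=> cL [Gg e]; apply/mem_ordered_cliques; rewrite e; apply: clique_conj => //.
exact: (chain_cliqueP hW hST hTT cL).
Qed.

Lemma conjugate_by_count L c g t : chain m T L -> conjugate_by L c g ->
  type_count t c = type_rank m [set s in L] (val t).
Proof.
move=> cL [Gg e]; rewrite (type_rank_chain hW (valP t) cL).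
elim: L c cL e => [|s L IHL] [|x c] // cL exc.
have [xE e] : val x = (g * chain_refl T (s :: L) * g^-1)%g /\
    map val c = [seq (g * z * g^-1)%g | z <- chain_clique T L] by case: exc.
rewrite [type_count _ _]/= -/(type_count t c) (IHL _ (chain_tail cL) e).
have [u [uL ux ht]] := chain_refl_type hW cL.
have -> : (tp x == t) = (head_type T (s :: L) == Some (val t)).
  rewrite ht tp_eq; apply/asboolP/eqP => [tx|[ut]].
    congr Some; apply: (conjugate_of_uniq hW hST hTT) tx; rewrite xE.
    exact: conjugate_of_conj.
  have ut' : u = val t := ut.
  by rewrite xE -ut'; apply: conjugate_of_conj.
by rewrite blockE; case: ifP.
Qed.

(** The elements of G that conjugate the clique of L to c form a coset of the stabilizer,
    so that the orbit is in bijection with the cosets. *)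
Lemma orbit_index L (A : seq (seq X)) : chain m T L -> uniq A ->
    (forall c, c \in A <-> exists g, conjugate_by L c g) ->
  size A = subgroup_index G (parabolic (free_of m T L)).
Proof.
move=> cL uA AP; rewrite /subgroup_index.
set K := parabolic (free_of m T L).
pose coset (c : seq X) : set W := [set g | conjugate_by L c g]%classic.
have cosetE c g : conjugate_by L c g -> coset c = [set (g * k)%g | k in K]%classic.
  move=> [Gg cE]; apply/seteqP; split=> [h [Gh hE]|_ [k Kk <-]].
    exists (g^-1 * h)%g; last by rewrite mulVKg.
    have Ggh : G (g^-1 * h)%g by apply: parabolicM => //; apply: parabolicV.
    have [//|_] := chain_clique_unique hW hST hTT cL cL Ggh; last by [].
    apply: (inj_map (f := fun x => g * x * g^-1)%g); first by move=> x y /mulIg/mulgI.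
    rewrite -map_comp -cE hE; apply: eq_map => x /=.
    by rewrite !invgM invgK !mulgA mulgV mul1g mulgK.
  split; first by apply: parabolicM => //; apply: free_of_G Kk.
  rewrite cE; apply/eq_in_map => x xL.
  by rewrite invgM -{1}(free_clique hW Kk xL) !mulgA.
have -> : fset_set [set [set (x * k)%g | k in K] | x in G]%classic = seq_fset tt (map coset A).
  apply/fsetP => B; rewrite in_fset_set; last exact: finite_image.
  rewrite seq_fsetE; apply/idP/mapP => [/set_mem[g Gg <-]|[c /AP[g cg] ->]].
    have [c cE] : exists c' : seq X, map val c' = [seq (g * x * g^-1)%g | x <- chain_clique T L].
      by apply: clique_lift; apply: clique_conj => //; apply: (chain_cliqueP hW hST hTT cL).
    have cg : conjugate_by L c g by [].
    by exists c; [apply/AP; exists g | rewrite (cosetE c g)].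
  apply/mem_set; exists g; first by case: cg.
  by rewrite (cosetE c g).
(* Two cliques in the orbit with a common conjugating element are equal. *)
rewrite size_seq_fset undup_id ?size_map // map_inj_in_uniq // => c c' /AP[g cg] /AP[g' c'g'] e.
have : coset c g by [].
rewrite e => -[_ c'E]; case: cg => _ cE.
by apply: (inj_map val_inj); rewrite cE c'E.
Qed.

(** Sort the ordered cliques by the set of letters of the chain to which they are
    conjugate. *)
Lemma sum_admissible :
  \sum_(c <- ordered_cliques) weighted_monomial (type_count^~ c) =
  \sum_(Sigma : {set S} | `[< admissible m T Sigma >])
    (subgroup_index G (parabolic (Sigma0 m T Sigma)))%:R *:
    weighted_monomial (fun t => type_rank m Sigma (val t)).
Proof.
have ex c : exists Sigma, clique T (map val c) ->
    exists L g, [/\ chain m T L, conjugate_by L c g & [set s in L] = Sigma].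
  have [clc|ncl] := pselect (clique T (map val c)); last by exists finset.set0.
  have [L [g [cL Gg e]]] := clique_chain hW hST hTT clc.
  by exists [set s in L] => _; exists L, g.
(* [base c] is the set of letters of the chain to whose clique c is conjugate. *)
have [base baseP] := boolp.choice ex.
rewrite (partition_big base predT) //= [RHS]big_mkcond /=; apply: eq_bigr => Sigma _.
case: asboolP => [adm|nadm]; last first.
  rewrite big_seq_cond big1 // => c /andP[/mem_ordered_cliques/baseP[L [g [cL _ e]]] /eqP bE].
  by case: nadm; rewrite -bE -e; apply: (chain_admissible hW hST hTT hfin).
have [L cL LS] := admissible_chain hW adm.
have inA c : c \in [seq c <- ordered_cliques | base c == Sigma] <-> exists g, conjugate_by L c g.
  rewrite mem_filter; split=> [/andP[/eqP bE /mem_ordered_cliques/baseP[L' [g [cL' cg e]]]]|[g cg]].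
    by exists g; rewrite (_ : L = L') //; apply: (chain_unique hW cL cL'); rewrite LS e.
  have cO := conjugate_by_clique cL cg; rewrite cO andbT; apply/eqP.
  have [L' [g' [cL' [Gg' e'] <-]]] := baseP c (iffLR (mem_ordered_cliques c) cO).
  rewrite -LS; suff -> : L = L' by []; case: cg => Gg e.
  have Ggg : G (g'^-1 * g)%g by apply: parabolicM => //; apply: parabolicV.
  have [|LL' _] := chain_clique_unique hW hST hTT cL cL' Ggg; last exact: LL'.
  apply: (inj_map (f := fun x => g' * x * g'^-1)%g); first by move=> x y /mulIg/mulgI.
  rewrite -map_comp -e' e; apply: eq_map => x /=.
  by rewrite !invgM invgK !mulgA mulgV mul1g mulgK.
rewrite -LS (Sigma0_chain hW cL) LS.
rewrite -(orbit_index cL (filter_uniq _ ordered_cliques_uniq) inA) scaler_nat.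
rewrite -big_filter big_seq (eq_bigr (fun=> weighted_monomial (fun t => type_rank m Sigma (val t)))).
  by rewrite -big_seq big_const_seq count_predT iter_addr_0.
move=> c /inA[g cg]; congr weighted_monomial; apply: funext => t.
by rewrite -LS; apply: conjugate_by_count cL cg.
Qed.

End Counting.

Local Open Scope ring_scope.

Theorem theorem6p6 (W : groupType) (S : {fset W}) (m : S -> S -> option nat)
    (hW : coxeter_system [set: W]%classic m)
    (T : {set S})
    (hfin : finite_set (parabolic (~: T)))
    (hST : forall s t : S, s \notin T -> t \in T ->
       m s t \in [:: Some 2%N; Some 4%N; None])
    (hTT : forall t t' : S, t \in T -> t' \in T ->
       m t t' \in [:: Some 1%N; Some 2%N; None])
    (I : choiceType) (phi : {t : S | t \in T} -> I) :
  [/\ exists mT : conjugate_generators T -> conjugate_generators T -> option nat,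
        right_angled mT /\ coxeter_system (normal_closure (parabolic T)) mT,
      exists psi : conjugate_generators T -> I, is_extension phi psi
    & forall psi : conjugate_generators T -> I, is_extension phi psi ->
        f_polynomial (nerve (conjugate_generators T)) psi =
        \sum_(Sigma : {set S} | `[< admissible m T Sigma >])
          (subgroup_index (parabolic (~: T))
             (parabolic (Sigma0 m T Sigma)))%:R *:
          \prod_(t : {t : S | t \in T})
            (((type_rank m Sigma (val t))`!)%:R^-1 *:
             indet (phi t) ^+ type_rank m Sigma (val t))].
Proof.
split; first by exists (@conjugate_matrix _ _ T); split;
  [exact: conjugate_matrix_right_angled | exact: (conjugate_coxeter hW hST hTT hfin)].
  exact: (extension_exists hW hST hTT hfin phi).
move=> psi psiP.
have [tp tpP] := boolp.choice (conjugate_ofX hfin).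
have -> : psi = phi \o tp.
  by apply: funext => x; have [_ [g Gg xE]] := tpP x; apply: psiP Gg xE.
rewrite -(sum_ordered_cliques tp phi).
exact: (sum_admissible hW hST hTT hfin tpP phi).
Qed.
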